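(* Let $b$ be a non-extreme point of the closed unit ball of $H^\infty$, let $a$ be the unique outer function on the unit disk $\mathbb D$ with $a(0)>0$ and $|a|^2+|b|^2=1$ a.e. on $\mathbb T$, and let $\phi:=b/a$. Let $\mathcal H(b)$ be the de Branges–Rovnyak space with kernel $K(z,w)=\frac{1-b(z)\overline{b(w)}}{1-z\overline w}$. For $\alpha\ge0$ and $h\in\mathcal H(b)$ let $\sigma_n^\alpha(h):=\sum_{j=0}^n\binom{n}{j}\big/\binom{n+\alpha}{j}\,\hat h(j)z^j$, where $\hat h(j)$ are Taylor coefficients. If $\sigma_n^\alpha(h)\to h$ (weakly or in norm) in $\mathcal H(b)$ for all $h\in\mathcal H(b)$, then \[ \phi(z)=O\bigl((1-|z|)^{-\alpha-1/2}\bigr)\quad(|z|\to1^-). \]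
   Context: $H^\infty$ is the space of bounded holomorphic functions on $\mathbb D$ with sup-norm; $b$ non-extreme in its unit ball is equivalent to $\log(1-|b|^2)\in L^1(\mathbb T)$, which guarantees existence of the outer function $a$ (the Pythagorean complement of $b$); then $\phi=b/a$ lies in the Smirnov class. Binomial coefficients with non-integer arguments are defined via the Gamma function. *)

(* Defs.v *)
(* mathcomp-analysis over an abstract R : realType,
   complex numbers R[i] from mathcomp-real-closed. *)
From mathcomp Require Import all_boot all_order all_algebra.
From mathcomp Require Import all_classical all_reals all_analysis.
From mathcomp Require Import complex.
Import Order.TTheory GRing.Theory Num.Theory numFieldNormedType.Exports.
Import ComplexField.

Set Implicit Arguments.
Unset Strict Implicit.
Unset Printing Implicit Defensive.

Local Open Scope ring_scope.
Local Open Scope complex_scope.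
Local Open Scope classical_set_scope.

Section DBR.
Variable R : realType.
Local Notation C := (R[i] : numFieldType).
Local Notation mu := (@lebesgue_measure R).

(* modulus |z| as a real number *)
Definition cmod (z : C) : R := Normc.normc z.

(* the open unit disk D *)
Definition disk : set C := [set z | cmod z < 1].

(* e^{it} *)
Definition expi (t : R) : C := Complex (cos t) (sin t).

(* complex exponential *)
Definition expC (z : C) : C := (expR (complex.Re z))%:C * expi (complex.Im z).

(* Lebesgue integral over [0, 2pi] of a complex valued function
   (real and imaginary parts integrated separately) *)
Definition cint02pi (F : R -> C) : C :=
  Complex (Rintegral mu `[0, 2 * pi] (fun t => complex.Re (F t)))
          (Rintegral mu `[0, 2 * pi] (fun t => complex.Im (F t))).

(* holomorphic on D: complex differentiable at every point of D *)
Definition holomorphic_on_disk (f : C -> C) : Prop :=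
  forall z, disk z -> derivable f z 1.

(* closed unit ball of H^infty (functions considered on D) *)
Definition Hinf_ball (f : C -> C) : Prop :=
  holomorphic_on_disk f /\ forall z, disk z -> cmod (f z) <= 1.

(* b is a non-extreme point of the closed unit ball of H^infty *)
Definition Hinf_nonextreme (b : C -> C) : Prop :=
  Hinf_ball b /\
  exists f g : C -> C, [/\ Hinf_ball f, Hinf_ball g,
    (forall z, disk z -> b z = (f z + g z) / 2) &
    exists2 z, disk z & f z != g z].

(* f has radial limit l at the boundary point e^{it} *)
Definition radial_limit (f : C -> C) (t : R) (l : C) : Prop :=
  f ((r%:C) * expi t) @[r --> 1^'-] --> l.

(* outer function: f(z) = c exp( (1/2pi) \int_0^{2pi} (e^{it}+z)/(e^{it}-z) k(t) dt )
   with |c| = 1 and k real valued Lebesgue integrable on the circle *)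
Definition outer (f : C -> C) : Prop :=
  exists (k : R -> R) (c : C),
    [/\ cmod c = 1,
        mu.-integrable `[0, 2 * pi] (EFin \o k) &
        forall z, disk z ->
          f z = c * expC (((2 * pi)^-1)%:C *
                   cint02pi (fun t => (expi t + z) / (expi t - z) * (k t)%:C))].

(* |a|^2 + |b|^2 = 1 almost everywhere on T (boundary values = radial limits) *)
Definition pythagorean_ae (a b : C -> C) : Prop :=
  {ae mu, forall t, `[0, 2 * pi] t ->
     exists la lb, [/\ radial_limit a t la, radial_limit b t lb &
                      cmod la ^+ 2 + cmod lb ^+ 2 = 1]}.

(* de Branges-Rovnyak kernel *)
Definition dBR_kernel (b : C -> C) (z w : C) : C :=
  (1 - b z * (b w)^*) / (1 - z * w^*).

(* norm induced by a (positive definite) inner product *)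
Definition ip_norm (V : lmodType C) (ip : V -> V -> C) (u : V) : R :=
  Num.sqrt (complex.Re (ip u u)).

(* (V, ip) is a complex Hilbert space whose elements are realised, through the
   injective linear map ev, as functions on D, and kv w is the element of V
   representing the kernel function K(., w), with the reproducing property.
   This is the definition of the reproducing kernel Hilbert space H(b) with
   kernel dBR_kernel b (unique up to the obvious isomorphism). *)
Definition is_dBR_space (b : C -> C) (V : lmodType C) (ip : V -> V -> C)
    (ev : V -> C -> C) (kv : C -> V) : Prop :=
  (* inner product: linear in the first variable, hermitian, positive definite *)
  (forall (c : C) (u v w : V), ip (c *: u + v) w = c * ip u w + ip v w) /\
  (forall u v : V, ip v u = (ip u v)^*) /\
  (forall u : V, 0 <= ip u u) /\
  (forall u : V, ip u u = 0 -> u = 0) /\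
  (* completeness *)
  (forall s : nat -> V,
     (forall e : R, 0 < e -> exists N : nat, forall m n : nat,
        (N <= m)%N -> (N <= n)%N -> ip_norm ip (s m - s n) < e) ->
     exists v : V, ip_norm ip (s n - v) @[n --> \oo] --> 0) /\
  (* elements are functions on D with the pointwise linear structure *)
  (forall (c : C) (u v : V) z, disk z -> ev (c *: u + v) z = c * ev u z + ev v z) /\
  (forall u v : V, (forall z, disk z -> ev u z = ev v z) -> u = v) /\
  (* kernel functions and reproducing property *)
  (forall w z, disk w -> disk z -> ev (kv w) z = dBR_kernel b z w) /\
  (forall w (u : V), disk w -> ip u (kv w) = ev u w).

(* c is the sequence of Taylor coefficients (at 0) of f on D *)
Definition taylor_coeffs (f : C -> C) (c : nat -> C) : Prop :=
  forall z, disk z -> series (fun j => c j * z ^+ j) @ \oo --> f z.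

(* generalised binomial coefficient binom(x, j) = x(x-1)...(x-j+1)/j!
   (= Gamma(x+1)/(Gamma(j+1) Gamma(x-j+1)) whenever x-j+1 > 0) *)
Definition gbinom (x : R) (j : nat) : R :=
  (\prod_(i < j) (x - i%:R)) / (j`!)%:R.

(* the polynomial sigma_n^alpha(h)(z) built from the Taylor coefficients c of h *)
Definition sigma_poly (alpha : R) (c : nat -> C) (n : nat) (z : C) : C :=
  \sum_(j < n.+1) ((('C(n, j))%:R / gbinom (n%:R + alpha) j)%:C * c j * z ^+ j).

End DBR.

(* Main.v *)
(* Let e_n be the element of H(b) representing h |-> h^(n), and let c = (1 - ||b||^2) be
   the (positive) infimum of ||e_n||^2. If A_n is the n-th Taylor coefficient of
   (1 - x)^(-alpha-1), the weights of sigma_n^alpha are A_(n-j) / A_n, so h^(n) z^n is the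
   convolution of A_k sigma_k^alpha(h) with the absolutely summable coefficients of
   (1 - x)^(alpha+1). Two applications of uniform boundedness give ||z^n|| = O(A_n), hence
   the partial sums u of the Szego kernel k_w have ||u|| = O((1 - |w|)^(-alpha-1)).
   On the other hand the Gram matrix of the e_n yields, for every f in H^2,
   |b(w) f(w)|^2 <= liminf ||u||^2 (||f||^2 - ||b f||^2) = O(||u||^2 ||a f||^2). Taking for f the
   Szego kernel k_w times bounded outer approximations of 1/a gives
   |b(w) / a(w)|^2 <= ||u||^2 (1 - |w|^2). *)
Require Import Defs.
From mathcomp Require Import all_boot all_order all_algebra.
From mathcomp Require Import all_classical all_reals all_analysis.
From mathcomp Require Import complex.
From mathcomp Require Import measurable_realfun.
From mathcomp Require Import ring lra.
Import Order.TTheory GRing.Theory Num.Theory numFieldNormedType.Exports.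
Import ComplexField.
Set Implicit Arguments.
Unset Strict Implicit.
Unset Printing Implicit Defensive.
Local Open Scope ring_scope.
Local Open Scope complex_scope.
Local Open Scope classical_set_scope.
Local Notation Re := (@complex.Re _).
Local Notation Im := (@complex.Im _).
Local Notation cj := (@conjc _).

(** * Complex sequences *)

Section Modulus.
Variable R : realType.
Implicit Types (x y z : R[i]).

(** For non-extreme b the Szego kernel has ||k_w||^2 = (1 + |phi(w)|^2) / (1 - |w|^2) in H(b), so
    bounding ||k_w|| bounds phi. Only the needed half of this is proved, by Cauchy-Schwarz against
    combinations of the e_n, and with partial sums of k_w in place of k_w. The exponent arises as
    (alpha + 1) - 1/2: the first term comes from the sum of the A_n |w|^n, the half from the factor
    1 - |w|^2 under a square root. Three obstacles shape the proof. The space is given through its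
    kernel functions only, so the e_n must be constructed; this works because a combination of the
    K_w has norm at most the H^2 norm of the same combination of the k_w. The relation |a|^2 + |b|^2
    = 1 holds only for radial limits almost everywhere, so it is used on circles of radius tending
    to 1, through Parseval and bounded convergence, and no boundary function is formed. Bounded
    convergence asks for bounded integrands while 1/a may be unbounded, hence the bounded
    approximations; the same functions show c > 0, because a times such a function does not vanish
    at 0. *)

Lemma cmod_ge0 z : 0 <= cmod z.
Proof. by case: z => x y; rewrite /cmod /= sqrtr_ge0. Qed.
Lemma cmodM x y : cmod (x * y) = cmod x * cmod y.
Proof. exact: Normc.normcM. Qed.
Lemma cmodD x y : cmod (x + y) <= cmod x + cmod y.
Proof. exact: le_normcD. Qed.
Lemma cmodN x : cmod (- x) = cmod x.
Proof. exact: normcN. Qed.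
Lemma cmodV x : cmod x^-1 = (cmod x)^-1.
Proof. exact: Normc.normcV. Qed.
Lemma cmod0 : cmod (0 : R[i]) = 0. Proof. exact: Normc.normc0. Qed.
Lemma cmod1 : cmod (1 : R[i]) = 1. Proof. exact: Normc.normc1. Qed.
Lemma cmod0_eq0 x : cmod x = 0 -> x = 0. Proof. exact: Normc.eq0_normc. Qed.
Lemma cmod_eq0 x : (cmod x == 0) = (x == 0).
Proof. by apply/eqP/eqP => [/cmod0_eq0 //|->]; rewrite cmod0. Qed.
Lemma cmodB x y : cmod (x - y) = cmod (y - x).
Proof. by rewrite -cmodN opprB. Qed.
Lemma cmodX x n : cmod (x ^+ n) = cmod x ^+ n.
Proof. by elim: n => [|n IH]; rewrite ?expr0 ?cmod1 // !exprS cmodM IH. Qed.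
Lemma cmodJ x : cmod (cj x) = cmod x.
Proof. by case: x => a b; rewrite /cmod /= sqrrN. Qed.
Lemma cmod_real (r : R) : cmod (r%:C) = `|r|.
Proof. by rewrite /cmod /= expr0n addr0 sqrtr_sqr. Qed.
Lemma normC_cmod z : `|z| = (cmod z)%:C.
Proof. by rewrite normc_def; case: z. Qed.
Lemma cmod_sqr z : cmod z ^+ 2 = Re z ^+ 2 + Im z ^+ 2.
Proof. by case: z => a b; rewrite /cmod /= sqr_sqrtr // addr_ge0 // sqr_ge0. Qed.
Lemma cmod_sqrC z : (cmod z ^+ 2)%:C = z * cj z.
Proof. by rewrite cmod_sqr; case: z => a b; simpc; congr Complex; ring. Qed.
Lemma Re_le_cmod z : `|Re z| <= cmod z.
Proof.
case: z => a b; rewrite /cmod /= -sqrtr_sqr ler_wsqrtr // lerDl sqr_ge0 //.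
Qed.
Lemma Im_le_cmod z : `|Im z| <= cmod z.
Proof.
case: z => a b; rewrite /cmod /= -sqrtr_sqr ler_wsqrtr // lerDr sqr_ge0 //.
Qed.
Lemma cmod_le_ReIm z : cmod z <= `|Re z| + `|Im z|.
Proof.
case: z => a b; have -> : Complex a b = a%:C + Complex 0 b by simpc.
apply: (le_trans (cmodD _ _)); rewrite cmod_real /= addr0 /cmod /= expr0n !add0r sqrtr_sqr.
by rewrite lerD2l.
Qed.
Lemma cmod_dist x y : `|cmod x - cmod y| <= cmod (x - y).
Proof.
rewrite ler_norml; apply/andP; split.
  by have := cmodD (y - x) x; rewrite subrK (cmodB y) => h; lra.
by have := cmodD (x - y) y; rewrite subrK => h; lra.
Qed.
Lemma cmod_sum (I : Type) (r : seq I) (P : pred I) (F : I -> R[i]) :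
  cmod (\sum_(i <- r | P i) F i) <= \sum_(i <- r | P i) cmod (F i).
Proof.
elim/big_rec2: _ => [|i u v _ h]; first by rewrite cmod0.
by apply: (le_trans (cmodD _ _)); rewrite lerD2l.
Qed.

Lemma ReD x y : Re (x + y) = Re x + Re y. Proof. by case: x y => ? ? [? ?]. Qed.
Lemma ImD x y : Im (x + y) = Im x + Im y. Proof. by case: x y => ? ? [? ?]. Qed.
Lemma ReN x : Re (- x) = - Re x. Proof. by case: x. Qed.
Lemma ImN x : Im (- x) = - Im x. Proof. by case: x. Qed.
Lemma ReJ x : Re (cj x) = Re x. Proof. by case: x. Qed.
Lemma cjM x y : cj (x * y) = cj x * cj y.
Proof. exact: rmorphM. Qed.
Lemma cReM x y : Re (x * y) = Re x * Re y - Im x * Im y.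
Proof. by case: x y => ? ? [? ?]. Qed.
Lemma cImM x y : Im (x * y) = Re x * Im y + Im x * Re y.
Proof. by case: x y => ? ? [? ?] /=. Qed.
Lemma Re_sum (I : Type) (r : seq I) (P : pred I) (F : I -> R[i]) :
  Re (\sum_(i <- r | P i) F i) = \sum_(i <- r | P i) Re (F i).
Proof. by elim/big_rec2: _ => // i u v _ <-; rewrite ReD. Qed.
Lemma Im_sum (I : Type) (r : seq I) (P : pred I) (F : I -> R[i]) :
  Im (\sum_(i <- r | P i) F i) = \sum_(i <- r | P i) Im (F i).
Proof. by elim/big_rec2: _ => // i u v _ <-; rewrite ImD. Qed.
Lemma realC_sum (I : Type) (r : seq I) (P : pred I) (F : I -> R) :
  (\sum_(i <- r | P i) F i)%:C = \sum_(i <- r | P i) (F i)%:C :> R[i].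
Proof. exact: raddf_sum. Qed.

Lemma cmod_expi (t : R) : cmod (expi t) = 1.
Proof. by rewrite /cmod /= cos2Dsin2 sqrtr1. Qed.
Lemma expiD (s t : R) : expi (s + t) = expi s * expi t.
Proof. by rewrite /expi cosD sinD; simpc; congr Complex; ring. Qed.
Lemma expi0 : expi (0 : R) = 1.
Proof. by rewrite /expi cos0 sin0. Qed.
Lemma expiX (t : R) n : expi t ^+ n = expi (n%:R * t).
Proof.
elim: n => [|n IH]; first by rewrite mul0r expi0.
by rewrite exprS IH -expiD -[in RHS]natr1 mulrDl mul1r addrC.
Qed.
Lemma expiJ (t : R) : cj (expi t) = expi (- t).
Proof. by rewrite /expi cosN sinN; simpc. Qed.
End Modulus.

Section Tends.
Variable R : realType.
Local Notation C := (R[i] : numFieldType).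

(** Complex convergence is carried by the real sequence of distances, so that real squeeze arguments
    apply; [cvg_ctends] translates from and to the topology of C. *)
Definition ctends (u : nat -> R[i]) (l : R[i]) := cmod (u n - l) @[n --> \oo] --> (0 : R).

Lemma cvgC_cmod (T : Type) (F : set_system T) (FF : Filter F) (u : T -> C) (l : C) :
  (u x @[x --> F] --> l) <-> (cmod (u x - l) @[x --> F] --> (0 : R)).
Proof.
split=> [/cvgrPdist_lt h | /cvgrPdist_lt h].
  apply/cvgrPdist_lt => e e0.
  have e0' : (0 : C) < (e%:C : C) by rewrite ltcR.
  have := h _ e0'; apply: filterS => x.
  by rewrite normC_cmod ltcR sub0r normrN ger0_norm ?cmod_ge0 // cmodB.
apply/cvgrPdist_lt => e e0.
have e1 : e = ((Re e)%:C : C).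
  by move: e0; rewrite ltcE /=; case: e => a b /= /andP[/eqP -> _].
have e2 : 0 < Re e by move: e0; rewrite e1 ltcR.
have := h _ e2; apply: filterS => x.
by rewrite e1 normC_cmod ltcR sub0r normrN ger0_norm ?cmod_ge0 // cmodB.
Qed.

Lemma cvg_ctends (u : nat -> C) (l : C) : (u n @[n --> \oo] --> l) <-> ctends u l.
Proof. exact: cvgC_cmod. Qed.

Lemma cvg0_le (u v : nat -> R) : (forall n, 0 <= u n <= v n) ->
  v n @[n --> \oo] --> (0 : R) -> u n @[n --> \oo] --> (0 : R).
Proof.
move=> h hv; apply: (@squeeze_cvgr _ _ _ _ (fun _ => 0) v) => //.
  by apply: nearW => n; exact: h.
exact: cvg_cst.
Qed.

Lemma cvg_le_bound (u : nat -> R) l M n0 : u n @[n --> \oo] --> l ->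
  (forall n, (n0 <= n)%N -> u n <= M) -> l <= M.
Proof.
move=> hu hM; rewrite -(cvg_lim _ hu) //; apply: limr_le; first by apply/cvg_ex; exists l.
by exists n0 => // n /=; exact: hM.
Qed.

Lemma cvg_ge_bound (u : nat -> R) l M n0 : u n @[n --> \oo] --> l ->
  (forall n, (n0 <= n)%N -> M <= u n) -> M <= l.
Proof.
move=> hu hM; rewrite -(cvg_lim _ hu) //; apply: limr_ge; first by apply/cvg_ex; exists l.
by exists n0 => // n /=; exact: hM.
Qed.

Lemma ctends_le (u : nat -> R[i]) l (v : nat -> R) : (forall n, cmod (u n - l) <= v n) ->
  v n @[n --> \oo] --> (0 : R) -> ctends u l.
Proof. by move=> h; apply: cvg0_le => n; rewrite cmod_ge0 h. Qed.

Lemma ctends_cst l : ctends (fun=> l) l.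
Proof. by rewrite /ctends subrr cmod0; exact: cvg_cst. Qed.

Lemma ctendsD u v l m : ctends u l -> ctends v m -> ctends (fun n => u n + v n) (l + m).
Proof.
move=> hu hv; apply: (@ctends_le _ _ (fun n => cmod (u n - l) + cmod (v n - m))).
  by move=> n; rewrite opprD addrACA cmodD.
by rewrite -[0]addr0; exact: cvgD.
Qed.

Lemma ctends_bnd u l : ctends u l -> exists B, 0 <= B /\ forall n, cmod (u n) <= B.
Proof.
move=> hu; have : cvgn (fun n => cmod (u n - l)) by apply/cvg_ex; exists 0.
move=> /cvg_seq_bounded [M [_ hM]].
exists (`|M| + 1 + cmod l); split; first by rewrite addr_ge0 ?cmod_ge0 // addr_ge0.
move=> n; have h1 : M < `|M| + 1 by rewrite ltr_pwDr // ler_norm.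
have := hM _ h1 n I; rewrite /= ger0_norm ?cmod_ge0 // => h2.
by have := cmodD (u n - l) l; rewrite subrK => h3; lra.
Qed.

Lemma cvg0_M (u : nat -> R) c : u n @[n --> \oo] --> (0 : R) -> c * u n @[n --> \oo] --> (0 : R).
Proof. by move=> h; rewrite -(mulr0 c); apply: cvgM => //; exact: cvg_cst. Qed.

Lemma ctendsM u v l m : ctends u l -> ctends v m -> ctends (fun n => u n * v n) (l * m).
Proof.
move=> hu hv; have [B [B0 hB]] := ctends_bnd hv.
apply: (@ctends_le _ _ (fun n => B * cmod (u n - l) + cmod l * cmod (v n - m))).
  move=> n; have -> : u n * v n - l * m = (u n - l) * v n + l * (v n - m) by ring.
  apply: (le_trans (cmodD _ _)); rewrite !cmodM lerD2r mulrC ler_wpM2r ?cmod_ge0 //.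
by rewrite -[0]addr0; apply: cvgD; exact: cvg0_M.
Qed.

Lemma ctendsZ c u l : ctends u l -> ctends (fun n => c * u n) (c * l).
Proof. by move=> h; apply: ctendsM => //; exact: ctends_cst. Qed.

Lemma ctendsN u l : ctends u l -> ctends (fun n => - u n) (- l).
Proof.
by apply: cvg_trans; apply: near_eq_cvg; apply: nearW => n; rewrite -opprD cmodN.
Qed.

Lemma ctendsB u v l m : ctends u l -> ctends v m -> ctends (fun n => u n - v n) (l - m).
Proof. by move=> hu hv; apply: ctendsD => //; exact: ctendsN. Qed.

Lemma ctends_cmod u l : ctends u l -> cmod (u n) @[n --> \oo] --> cmod l.
Proof.
move=> h; apply: cvg_sub0 (cvg_cst _); apply: norm_cvg0.
by apply: (cvg0_le _ h) => n; rewrite normr_ge0 /= cmod_dist.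
Qed.

Lemma ctends_Re u l : ctends u l -> Re (u n) @[n --> \oo] --> Re l.
Proof.
move=> h; apply: cvg_sub0 (cvg_cst _); apply: norm_cvg0.
apply: (@cvg0_le _ (fun n => cmod (u n - l))) => // n; rewrite normr_ge0 /=.
by apply: le_trans (Re_le_cmod _); rewrite ReD ReN.
Qed.

Lemma ctends_Im u l : ctends u l -> Im (u n) @[n --> \oo] --> Im l.
Proof.
move=> h; apply: cvg_sub0 (cvg_cst _); apply: norm_cvg0.
apply: (@cvg0_le _ (fun n => cmod (u n - l))) => // n; rewrite normr_ge0 /=.
by apply: le_trans (Im_le_cmod _); rewrite ImD ImN.
Qed.

Lemma ctends_ReIm u l : Re (u n) @[n --> \oo] --> Re l -> Im (u n) @[n --> \oo] --> Im l ->
  ctends u l.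
Proof.
move=> hr hi; apply: (@ctends_le _ _ (fun n => `|Re (u n) - Re l| + `|Im (u n) - Im l|)).
  by move=> n; apply: (le_trans (cmod_le_ReIm _)); rewrite ReD ImD ReN ImN.
rewrite -[0]addr0; apply: cvgD.
  by rewrite -(normr0 R) -(subrr (Re l)); apply: cvg_norm; apply: cvgB => //; exact: cvg_cst.
by rewrite -(normr0 R) -(subrr (Im l)); apply: cvg_norm; apply: cvgB => //; exact: cvg_cst.
Qed.

Lemma ctends_unique u l m : ctends u l -> ctends u m -> l = m.
Proof.
move=> h1 h2; have := ctendsB h1 h2; rewrite /ctends => h.
apply/eqP; rewrite -subr_eq0 -cmod_eq0 -(cmodN (l - m)); apply/eqP.
have h' : (fun=> cmod (- (l - m))) @ \oo --> (0 : R).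
  by apply: cvg_trans h; apply: near_eq_cvg; apply: nearW => n; rewrite subrr sub0r.
by rewrite -(cvg_lim _ h') // lim_cst.
Qed.

Lemma eq_ctends u v l : (forall n, u n = v n) -> ctends u l -> ctends v l.
Proof. by move=> h; have -> : u = v by apply/funext. Qed.

Lemma cvg0_eps (u : nat -> R) : (forall n, 0 <= u n) ->
  (u n @[n --> \oo] --> (0 : R)) <->
  (forall e, 0 < e -> exists N, forall n, (N <= n)%N -> u n < e).
Proof.
move=> u0; split=> [/cvgrPdist_lt h e e0|h].
  have [N _ hN] := h e e0; exists N => n hn.
  by have := hN n hn; rewrite /= sub0r normrN ger0_norm.
apply/cvgrPdist_lt => e e0; have [N hN] := h e e0.
by exists N => // n /hN; rewrite /= sub0r normrN ger0_norm.
Qed.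

Lemma ctends_eps u l : ctends u l <->
  (forall e : R, 0 < e -> exists N, forall n, (N <= n)%N -> cmod (u n - l) < e).
Proof. by apply: cvg0_eps => n; exact: cmod_ge0. Qed.

Lemma ctends_cauchy (u : nat -> R[i]) :
  (forall e : R, 0 < e -> exists N, forall m n, (N <= m)%N -> (N <= n)%N -> cmod (u m - u n) < e) ->
  exists l, ctends u l.
Proof.
move=> h.
(* Real and imaginary part are both 1-Lipschitz for [cmod], so one argument for such a [g] yields
   both limits. *)
have key (g : R[i] -> R) : (forall x y, `|g x - g y| <= cmod (x - y)) ->
    cvgn (fun n => g (u n)).
  move=> hg; apply/cauchy_cvgP/cauchy_ballP => e e0; have [N hN] := h e e0.
  pose A := [set x | exists2 n, (N <= n)%N & x = g (u n)].
  have hA : (g (u n) @[n --> \oo]) A by exists N => // n /= hn; exists n.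
  exists (A, A) => //= -[x y] /= [[i hi ->] [j hj ->]].
  by apply: (le_lt_trans (hg _ _)); exact: hN.
exists (Complex (limn (fun n => Re (u n))) (limn (fun n => Im (u n)))).
apply: ctends_ReIm; apply: key => x y; rewrite -?ReN -?ImN -?ReD -?ImD.
  exact: Re_le_cmod.
exact: Im_le_cmod.
Qed.

End Tends.

(** * Hilbert space geometry *)

Section Hilbert.
Variables (R : realType).
Local Notation C := (R[i] : numFieldType).
Variables (V : lmodType C) (ip : V -> V -> C).
Hypothesis ipL : forall (c : C) (u v w : V), ip (c *: u + v) w = c * ip u w + ip v w.
Hypothesis ipJ : forall u v : V, ip v u = cj (ip u v).
Hypothesis ip_ge0 : forall u : V, 0 <= ip u u.
Hypothesis ip_def : forall u : V, ip u u = 0 -> u = 0.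
Implicit Types (u v w : V) (c : C).
Local Notation N := (ip_norm ip).

Lemma ip0l w : ip 0 w = 0.
Proof.
have := ipL 1 0 0 w; rewrite scaler0 addr0 mul1r => h.
by apply: (@addrI _ (ip 0 w)); rewrite addr0 -h.
Qed.
Lemma ipDl u v w : ip (u + v) w = ip u w + ip v w.
Proof. by rewrite -[u]scale1r ipL mul1r scale1r. Qed.
Lemma ipZl c u w : ip (c *: u) w = c * ip u w.
Proof. by rewrite -[c *: u]addr0 ipL ip0l addr0. Qed.
Lemma ip0r w : ip w 0 = 0. Proof. by rewrite ipJ ip0l conjc0. Qed.
Lemma ipDr u v w : ip w (u + v) = ip w u + ip w v.
Proof. by rewrite ipJ ipDl rmorphD /= -!ipJ. Qed.
Lemma ipZr c u w : ip w (c *: u) = cj c * ip w u.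
Proof. by rewrite ipJ ipZl rmorphM /= -!ipJ. Qed.
Lemma ipNl u w : ip (- u) w = - ip u w.
Proof. by rewrite -scaleN1r ipZl mulN1r. Qed.
Lemma ipNr u w : ip w (- u) = - ip w u.
Proof. by rewrite ipJ ipNl rmorphN /= -ipJ. Qed.
Lemma ipBl u v w : ip (u - v) w = ip u w - ip v w. Proof. by rewrite ipDl ipNl. Qed.
Lemma ipBr u v w : ip w (u - v) = ip w u - ip w v. Proof. by rewrite ipDr ipNr. Qed.
Lemma ip_suml (I : Type) (r : seq I) (P : pred I) (F : I -> V) w :
  ip (\sum_(i <- r | P i) F i) w = \sum_(i <- r | P i) ip (F i) w.
Proof. by elim/big_rec2: _ => [|i u v _ <-]; rewrite ?ip0l ?ipDl. Qed.
Lemma ip_sumr (I : Type) (r : seq I) (P : pred I) (F : I -> V) w :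
  ip w (\sum_(i <- r | P i) F i) = \sum_(i <- r | P i) ip w (F i).
Proof. by elim/big_rec2: _ => [|i u v _ <-]; rewrite ?ip0r ?ipDr. Qed.

Lemma ip_normC u : ip u u = (N u ^+ 2)%:C.
Proof.
have := ip_ge0 u; rewrite lecE /= => /andP[/eqP hi hr].
rewrite sqr_sqrtr //; case: (ip u u) hi hr => a b /= -> _ //.
Qed.
Lemma ip_norm_ge0 u : 0 <= N u. Proof. exact: sqrtr_ge0. Qed.
Lemma ip_norm_sqr u : N u ^+ 2 = Re (ip u u).
Proof. by rewrite ip_normC. Qed.
Lemma ip_norm0 : N 0 = 0. Proof. by rewrite /ip_norm ip0l sqrtr0. Qed.
Lemma ip_norm_eq0 u : N u = 0 -> u = 0.
Proof. by move=> h; apply: ip_def; rewrite ip_normC h expr0n. Qed.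
Lemma ip_normZ c u : N (c *: u) = cmod c * N u.
Proof.
apply/eqP; rewrite -(@eqrXn2 _ 2) ?mulr_ge0 ?ip_norm_ge0 ?cmod_ge0 //.
apply/eqP/complexI; rewrite -ip_normC ipZl ipZr exprMn rmorphM /= -ip_normC mulrA.
by rewrite cmod_sqrC.
Qed.
Lemma ip_normN u : N (- u) = N u.
Proof. by rewrite -scaleN1r ip_normZ cmodN cmod1 mul1r. Qed.
Lemma ip_normB u v : N (u - v) = N (v - u).
Proof. by rewrite -ip_normN opprB. Qed.

(** Positivity of the square norm of ||v||^2 u - <u, v> v, a form of the projection residue that
    avoids division. *)
Lemma cauchy_schwarz u v : cmod (ip u v) <= N u * N v.
Proof.
have [->|v0] := eqVneq v 0; first by rewrite ip0r cmod0 ip_norm0 mulr0.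
have Nv : 0 < N v.
  by rewrite lt_neqAle ip_norm_ge0 andbT eq_sym; apply: contra_neq v0 => /ip_norm_eq0.
set a := ip u v.
have := ip_ge0 ((N v ^+ 2)%:C *: u - a *: v).
have -> : ip ((N v ^+ 2)%:C *: u - a *: v) ((N v ^+ 2)%:C *: u - a *: v)
   = ((N v ^+ 2) * (N u ^+ 2 * N v ^+ 2 - cmod a ^+ 2))%:C.
  rewrite ipBl !ipBr !ipZl !ipZr -/a (ipJ u v) -/a !ip_normC conjc_real.
  by rewrite [in RHS]rmorphM [in RHS]rmorphB /= [in RHS]rmorphM /= cmod_sqrC; ring.
rewrite ler0c pmulr_rge0 ?exprn_gt0 // subr_ge0 -exprMn => h.
by rewrite -(@ler_pXn2r _ 2) // nnegrE ?cmod_ge0 // mulr_ge0 // ip_norm_ge0.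
Qed.

Lemma ip_normD u v : N (u + v) <= N u + N v.
Proof.
rewrite -(@ler_pXn2r _ 2) ?nnegrE ?ip_norm_ge0 ?addr_ge0 ?ip_norm_ge0 //.
rewrite ip_norm_sqr ipDl !ipDr !ReD -!ip_norm_sqr (ipJ u v) ReJ.
have := le_trans (ler_norm _) (le_trans (Re_le_cmod (ip u v)) (cauchy_schwarz u v)).
by move=> h; rewrite sqrrD; lra.
Qed.

Lemma ip_norm_sum (I : Type) (r : seq I) (P : pred I) (F : I -> V) :
  N (\sum_(i <- r | P i) F i) <= \sum_(i <- r | P i) N (F i).
Proof.
elim/big_rec2: _ => [|i u v _ h]; first by rewrite ip_norm0.
by apply: (le_trans (ip_normD _ _)); rewrite lerD2l.
Qed.

Lemma ctends_ipl (s : nat -> V) v w : N (s n - v) @[n --> \oo] --> (0 : R) ->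
  ctends (fun n => ip (s n) w) (ip v w).
Proof.
move=> h; apply: (@ctends_le _ _ _ (fun n => N w * N (s n - v))).
  by move=> n; rewrite -ipBl mulrC cauchy_schwarz.
exact: cvg0_M.
Qed.

Lemma cvg_ip_norm (s : nat -> V) v : N (s n - v) @[n --> \oo] --> (0 : R) ->
  N (s n) @[n --> \oo] --> N v.
Proof.
move=> h; apply: cvg_sub0 (cvg_cst _); apply: norm_cvg0.
apply: (@cvg0_le _ _ (fun n => N (s n - v))) => // n; rewrite normr_ge0 /=.
rewrite ler_norml; apply/andP; split => /=.
  by have := ip_normD (v - s n) (s n); rewrite subrK (ip_normB v) !fctE => h'; lra.
by have := ip_normD (s n - v) v; rewrite subrK !fctE => h'; lra.
Qed.

Hypothesis ip_complete : forall s : nat -> V,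
  (forall e : R, 0 < e -> exists n0 : nat, forall m n : nat,
     (n0 <= m)%N -> (n0 <= n)%N -> N (s m - s n) < e) ->
  exists v : V, N (s n - v) @[n --> \oo] --> 0.

(* Sokal's gliding hump: one of x + xi, x - xi is at least as far from the kernel of <., y> as xi. *)
Lemma sokal_step (x y : V) (r : R) : 0 <= r ->
  exists x', N (x' - x) <= r /\ r * N y <= cmod (ip x' y).
Proof.
move=> r0; have [->|y0] := eqVneq y 0.
  by exists x; rewrite subrr ip_norm0 ip0r cmod0 mulr0.
have Ny : 0 < N y.
  by rewrite lt_neqAle ip_norm_ge0 andbT eq_sym; apply: contra_neq y0 => /ip_norm_eq0.
pose xi := (r / N y)%:C *: y.
have Nxi : N xi = r.
  rewrite ip_normZ cmod_real (ger0_norm (divr_ge0 r0 (ltW Ny))) divfK // gt_eqF //.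
have hxi : cmod (ip xi y) = r * N y.
  rewrite ipZl ip_normC cmodM !cmod_real (ger0_norm (sqr_ge0 _)) (ger0_norm (divr_ge0 r0 (ltW Ny))).
  by field; rewrite gt_eqF.
have hs : r * N y *+ 2 <= cmod (ip (x + xi) y) + cmod (ip (x - xi) y).
  rewrite -hxi.
  apply: le_trans (_ : cmod (ip (x + xi) y - ip (x - xi) y) <= _); last first.
    by apply: (le_trans (cmodD _ _)); rewrite cmodN.
  rewrite -ipBl opprD addrACA subrr add0r opprK ipDl -mulr2n.
  by rewrite /cmod normcMn.
have [h|h] := leP (r * N y) (cmod (ip (x + xi) y)).
  by exists (x + xi); rewrite [x + xi]addrC addrK Nxi; split => //; rewrite addrC.
exists (x - xi); rewrite addrC addKr ip_normN Nxi; split => //.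
by rewrite mulr2n in hs; lra.
Qed.

(** If the norms were unbounded, step k could choose a vector y with ||y|| > 4^k and move the
    current point by at most 3^(-k) so that its pairing with y reaches 3^(-k) ||y||. All later moves
    together amount to at most half of 3^(-k), so the limit point still pairs to at least (4/3)^k /
    2, which is unbounded in k. *)
Lemma uniform_boundedness (y : nat -> V) :
  (forall x, exists M, forall n, cmod (ip x (y n)) <= M) ->
  exists M, 0 <= M /\ forall n, N (y n) <= M.
Proof.
move=> bnd; apply: contrapT => unb.
have hu M : exists n, M < N (y n).
  apply: contrapT => h; apply: unb; exists `|M|; split=> // n.
  apply: le_trans (ler_norm _); rewrite leNgt; apply/negP => h'; apply: h; by exists n.
have q0 k : 0 <= (3^-1 : R) ^+ k by rewrite exprn_ge0.
have step (k : nat) (x : V) : exists x' : V * nat, [/\ N (x'.1 - x) <= 3^-1 ^+ k,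
    3^-1 ^+ k * N (y x'.2) <= cmod (ip x'.1 (y x'.2)) & 4 ^+ k < N (y x'.2)].
  have [n hn] := hu (4 ^+ k); have [x' [h1 h2]] := sokal_step x (y n) (q0 k).
  by exists (x', n).
(* [F] returns the moved point together with the index of the vector on which it was made large. *)
have /choice[F hF] : forall kx : nat * V, exists x' : V * nat, [/\ N (x'.1 - kx.2) <= 3^-1 ^+ kx.1,
    3^-1 ^+ kx.1 * N (y x'.2) <= cmod (ip x'.1 (y x'.2)) & 4 ^+ kx.1 < N (y x'.2)].
  by move=> [k x]; exact: step.
pose s := fix s n := if n is m.+1 then (F (m, s m)).1 else 0.
have ds n : N (s n.+1 - s n) <= 3^-1 ^+ n by have [] := hF (n, s n).
(* The right-hand side is the exact sum of the k geometric steps from m on. *)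
have dsm m k : N (s (m + k)%N - s m) <= (1 - 3^-1 ^+ k) * (3 / 2) * 3^-1 ^+ m.
  elim: k => [|k IH]; first by rewrite addn0 subrr ip_norm0 mulr_ge0 // mulr_ge0 // subrr.
  rewrite addnS -(subrKA (s (m + k)%N)); apply: (le_trans (ip_normD _ _)).
  apply: (le_trans (lerD (ds _) IH)); rewrite exprD exprS.
  have := q0 k; have := q0 m; nra.
have dsm' m n : (m <= n)%N -> N (s n - s m) <= (3 / 2) * 3^-1 ^+ m.
  move=> hmn; have := dsm m (n - m)%N; rewrite subnKC // => h; apply: (le_trans h).
  by have := mulr_ge0 (q0 (n - m)%N) (q0 m); lra.
have q1 : `|3^-1 : R| < 1 by rewrite ger0_norm // invf_lt1 // ltr1n.
have qcv : (3 / 2 * (3^-1 : R) ^+ n) @[n --> \oo] --> (0 : R).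
  by apply: cvg0_M; exact: cvg_expr.
have [x hx] : exists x, N (s n - x) @[n --> \oo] --> (0 : R).
  apply: ip_complete => e e0.
  have pos n : 0 <= 3 / 2 * (3^-1 : R) ^+ n by rewrite mulr_ge0.
  have e2 : 0 < e / 2 by rewrite divr_gt0.
  have [n0 hn0] := (cvg0_eps pos).1 qcv _ e2.
  exists n0 => m n hm hn; rewrite -(subrKA (s n0)); apply: (le_lt_trans (ip_normD _ _)).
  rewrite (ip_normB (s n0)); have := dsm' _ _ hm; have := dsm' _ _ hn; have := hn0 n0 (leqnn _).
  by lra.
have hxs m : N (x - s m) <= (3 / 2) * 3^-1 ^+ m.
  have hc : N (s n - s m) @[n --> \oo] --> N (x - s m).
    apply: cvg_ip_norm; apply: cvg_trans hx; apply: near_eq_cvg; apply: nearW => n.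
    by rewrite opprB addrA subrK.
  by apply: (cvg_le_bound hc (n0 := m)) => n; exact: dsm'.
have [M hM] := bnd x.
have key k : (1/2) * (4/3) ^+ k <= M.
  have [_ h2 h3] := hF (k, s k); set n := (F (k, s k)).2 in h2 h3.
  have h4 : cmod (ip (s k.+1) (y n)) <= cmod (ip x (y n)) + N (x - s k.+1) * N (y n).
    have := cmodD (ip x (y n)) (ip (s k.+1 - x) (y n)); rewrite -ipDl addrC subrK.
    move=> h; apply: (le_trans h); rewrite lerD2l ip_normB; exact: cauchy_schwarz.
  have h5 := hxs k.+1; have h6 := hM n.
  have Ny := ip_norm_ge0 (y n).
  have h7 : N (x - s k.+1) * N (y n) <= (1/2) * 3^-1 ^+ k * N (y n).
    by rewrite ler_wpM2r //; apply: (le_trans h5); rewrite exprS; have := q0 k; lra.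
  have h8 : (1/2) * (3^-1 ^+ k * N (y n)) <= M by move: h2 => /=; lra.
  apply: le_trans h8; rewrite ler_pM2l // -[4 / 3]mulrC exprMn ler_wpM2l //.
  exact: ltW h3.
have bern k : 1 + k%:R / 3 <= (4/3 : R) ^+ k.
  elim: k => [|k IH]; first by rewrite expr0 mul0r addr0.
  by rewrite exprS -natr1; have := ler0n R k; nra.
have M0 : 0 <= M by apply: le_trans (key 0%N); rewrite expr0; lra.
have [k hk] : exists k : nat, 6 * M < k%:R.
  by exists (Num.bound (6 * M)); apply: archi_boundP; rewrite mulr_ge0.
by have := key k; have := bern k; lra.
Qed.

End Hilbert.

(** * Coefficient functionals on H(b) *)

Section Geometric.
Variable R : realType.
Implicit Types (q r : R).

Lemma geo_sum (F : fieldType) (q : F) N : q != 1 -> \sum_(i < N) q ^+ i = (1 - q ^+ N) / (1 - q).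
Proof.
move=> q1; have q1' : 1 - q != 0 by rewrite subr_eq0 eq_sym.
elim: N => [|N IH]; first by rewrite big_ord0 expr0 subrr mul0r.
by rewrite big_ord_recr /= IH exprS; field.
Qed.

Lemma geo_le q N : 0 <= q < 1 -> \sum_(i < N) q ^+ i <= (1 - q)^-1.
Proof.
move=> /andP[q0 q1]; rewrite geo_sum ?lt_eqF // -[leRHS]mul1r.
have h := exprn_ge0 N q0; apply: ler_wpM2r; last by lra.
by rewrite invr_ge0; lra.
Qed.

Lemma cvg_expr0 q : 0 <= q < 1 -> (fun n => q ^+ n) @ \oo --> (0 : R).
Proof. by move=> /andP[q0 q1]; apply: cvg_expr; rewrite ger0_norm. Qed.

Lemma ctends_geo (z : R[i]) : cmod z < 1 ->
  ctends (fun N => \sum_(n < N) z ^+ n) (1 - z)^-1.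
Proof.
move=> hz.
have z1 : z != 1 by apply: contraTneq hz => ->; rewrite cmod1 ltxx.
apply: (@ctends_le _ _ _ (fun n => cmod (1 - z)^-1 * cmod z ^+ n)).
  move=> n; rewrite geo_sum // -[X in _ - X]mul1r -mulrBl addrAC subrr add0r mulNr cmodN.
  by rewrite cmodM cmodX mulrC.
by apply: cvg0_M; apply: cvg_expr0; rewrite cmod_ge0.
Qed.
End Geometric.

(** * Square-summable sequences *)

Section SquareSums.
Variable R : realType.
Implicit Types (x y : nat -> R[i]) (M K : R).

(** An upper bound for the l^2 norm expressed through finite sums, so that no infinite sum has to be
    formed. *)
Definition l2bnd x M := forall N, \sum_(n < N) cmod (x n) ^+ 2 <= M ^+ 2.

(** Minkowski's inequality from the weighted Young inequality; the weights 1 + K/M and 1 + M/K are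
    those for which the two bounds add up to exactly (M + K)^2. *)
Lemma l2bndD x y M K : 0 < M -> 0 < K -> l2bnd x M -> l2bnd y K ->
  l2bnd (fun n => x n + y n) (M + K).
Proof.
move=> M0 K0 hx hy N.
have young n : cmod (x n + y n) ^+ 2 <= (1 + K / M) * cmod (x n) ^+ 2 + (1 + M / K) * cmod (y n) ^+ 2.
  set s := cmod (x n); set t := cmod (y n).
  have h : cmod (x n + y n) <= s + t by exact: cmodD.
  have s0 : 0 <= s by exact: cmod_ge0.
  have t0 : 0 <= t by exact: cmod_ge0.
  apply: (@le_trans _ _ ((s + t) ^+ 2)); first by rewrite ler_pXn2r // nnegrE ?cmod_ge0 // addr_ge0.
  rewrite -subr_ge0.
  have -> : (1 + K / M) * s ^+ 2 + (1 + M / K) * t ^+ 2 - (s + t) ^+ 2 =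
            (K * s - M * t) ^+ 2 / (M * K) by field; rewrite !gt_eqF.
  by rewrite divr_ge0 ?sqr_ge0 // mulr_ge0 // ltW.
apply: le_trans; first by apply: ler_sum => n _; exact: young.
rewrite big_split /= -!mulr_sumr.
have -> : (M + K) ^+ 2 = (1 + K / M) * M ^+ 2 + (1 + M / K) * K ^+ 2 by field; rewrite !gt_eqF.
have h1 : 0 <= 1 + K / M by rewrite addr_ge0 // divr_ge0 // ltW.
have h2 : 0 <= 1 + M / K by rewrite addr_ge0 // divr_ge0 // ltW.
exact: lerD (ler_wpM2l h1 (hx N)) (ler_wpM2l h2 (hy N)).
Qed.

Lemma l2bndZ c x M : l2bnd x M -> l2bnd (fun n => c * x n) (cmod c * M).
Proof.
move=> h N; rewrite exprMn; under eq_bigr do rewrite cmodM exprMn.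
by rewrite -mulr_sumr ler_wpM2l ?sqr_ge0.
Qed.

Lemma l2bnd_le x M K : 0 <= M -> M <= K -> l2bnd x M -> l2bnd x K.
Proof.
move=> M0 MK h N; apply: (le_trans (h N)); rewrite ler_pXn2r // nnegrE //; exact: le_trans MK.
Qed.

Lemma eq_l2bnd x y M : (forall n, x n = y n) -> l2bnd x M -> l2bnd y M.
Proof. by move=> /funext ->. Qed.

Lemma l2bndC x y M : l2bnd (fun n => x n - y n) M -> l2bnd (fun n => y n - x n) M.
Proof. by move=> h N; under eq_bigr do rewrite cmodB; exact: h. Qed.

Lemma l2bnd0 M : l2bnd (fun=> 0) M.
Proof. by move=> N; rewrite big1 ?sqr_ge0 // => i _; rewrite cmod0 expr0n. Qed.

(** The bound is the geometric sum of r^(2i) over i >= k. The shift [m] serves the construction of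
    the e_n, the cut [k] the tail of a Szego kernel. *)
Lemma l2bnd_tail (w : R[i]) (r : R) (m k : nat) : cmod w <= r -> 0 < r < 1 ->
  l2bnd (fun n => if (n < m + k)%N then 0 else w ^+ (n - m)) (r ^+ k / Num.sqrt (1 - r ^+ 2)).
Proof.
move=> wr /andP[r0 r1] N.
have r2 : 0 < 1 - r ^+ 2 by rewrite subr_gt0 exprn_ilt1 // ltW.
rewrite exprMn exprVn sqr_sqrtr ?(ltW r2) //.
have [h|h] := leqP N (m + k).
  rewrite big1 ?divr_ge0 ?sqr_ge0 ?(ltW r2) // => i _.
  by rewrite (leq_trans (ltn_ord i) h) cmod0 expr0n.
rewrite -(big_mkord xpredT (fun n => cmod (if (n < m + k)%N then 0 else w ^+ (n - m)) ^+ 2)).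
rewrite (@big_cat_nat _ _ _ (m + k)) //=; last exact: ltnW.
rewrite big_nat_cond big1 ?add0r; last first.
  by move=> i /andP[/andP[_ hi] _]; rewrite hi cmod0 expr0n.
rewrite -{1}[(m + k)%N]add0n big_addn big_mkord.
apply: le_trans (_ : \sum_(i < N - (m + k)) (r ^+ k) ^+ 2 * (r ^+ 2) ^+ i <= _).
  apply: ler_sum => i _; rewrite ltnNge leq_addl /= addnCA [(m + _)%N]addnC addnK cmodX.
  rewrite [r ^+ 2 ^+ i]exprAC -exprMn -exprD addnC.
  by rewrite ler_pXn2r ?nnegrE ?exprn_ge0 ?cmod_ge0 ?(ltW r0) // lerXn2r // ?nnegrE ?cmod_ge0 ?(ltW r0).
rewrite -mulr_sumr ler_wpM2l ?sqr_ge0 //; apply: geo_le.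
by rewrite sqr_ge0 -subr_gt0.
Qed.
End SquareSums.

(** * Transport of Szego kernels to H(b) and the vectors e_n *)

Section CoefficientVectors.
Variables (R : realType).
Local Notation C := (R[i] : numFieldType).
Variables (b : C -> C) (V : lmodType C) (ip : V -> V -> C) (ev : V -> C -> C) (kv : C -> V).
Hypothesis ipL : forall (c : C) (u v w : V), ip (c *: u + v) w = c * ip u w + ip v w.
Hypothesis ipJ : forall u v : V, ip v u = cj (ip u v).
Hypothesis ip_ge0 : forall u : V, 0 <= ip u u.
Hypothesis ip_def : forall u : V, ip u u = 0 -> u = 0.
Hypothesis ip_complete : forall s : nat -> V,
  (forall e : R, 0 < e -> exists n0 : nat, forall m n : nat,
     (n0 <= m)%N -> (n0 <= n)%N -> ip_norm ip (s m - s n) < e) ->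
  exists v : V, ip_norm ip (s n - v) @[n --> \oo] --> 0.
Hypothesis ev_kv : forall w z, disk w -> disk z -> ev (kv w) z = (1 - b z * cj (b w)) / (1 - z * cj w).
Hypothesis ip_kv : forall w (u : V), disk w -> ip u (kv w) = ev u w.
Local Notation N := (ip_norm ip).
Implicit Types (x y : nat -> R[i]).

(* x and y are the coefficients of the Szego-kernel combinations sum c k_w and
   sum c conj(b(w)) k_w attached to the combination v = sum c K_w. *)
Inductive kspan : V -> (nat -> R[i]) -> (nat -> R[i]) -> Prop :=
| kspan0 : kspan 0 (fun=> 0) (fun=> 0)
| kspanD c w v x y : disk w -> kspan v x y ->
    kspan (c *: kv w + v) (fun n => c * cj w ^+ n + x n)
          (fun n => c * cj (b w) * cj w ^+ n + y n).

Lemma kspan_add v x y v' x' y' : kspan v x y -> kspan v' x' y' ->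
  kspan (v + v') (fun n => x n + x' n) (fun n => y n + y' n).
Proof.
move=> h h'; elim: h => {v x y} [|c w v x y hw h IH].
  rewrite add0r; have -> : (fun n => 0 + x' n) = x' by apply/funext => n; rewrite add0r.
  by have -> : (fun n => 0 + y' n) = y' by apply/funext => n; rewrite add0r.
rewrite -addrA; have := kspanD c hw IH.
congr kspan; apply/funext => n; exact: addrA.
Qed.

Lemma kspan_scale a v x y : kspan v x y -> kspan (a *: v) (fun n => a * x n) (fun n => a * y n).
Proof.
elim=> {v x y} [|c w v x y hw h IH].
  rewrite scaler0; have -> : (fun _ : nat => a * 0 : R[i]) = (fun=> 0) by apply/funext => n; rewrite mulr0.
  exact: kspan0.
rewrite scalerDr scalerA; have := kspanD (a * c) hw IH.
by congr kspan; apply/funext => n; rewrite mulrDr !mulrA.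
Qed.

Lemma disk_mulJ (w z : R[i]) : disk w -> disk z -> cmod (z * cj w) < 1.
Proof.
rewrite /disk /= => hw hz; rewrite cmodM cmodJ.
by apply: mulr_ilt1 => //; exact: cmod_ge0.
Qed.

(** By the reproducing property <K_w, K_z> = (1 - b(z) conj b(w)) / (1 - z conj w); expanding the
    denominator as a geometric series writes the inner product of H(b) as a difference of two l^2
    pairings. *)
Lemma kv_kspan_ip w v x y : disk w -> kspan v x y ->
  ctends (fun M => \sum_(n < M) (cj w ^+ n * cj (x n) - cj (b w) * cj w ^+ n * cj (y n))) (ip (kv w) v).
Proof.
move=> hw; elim=> {v x y} [|c z v x y hz h IH].
  rewrite (ip0r ipL ipJ); apply: eq_ctends (ctends_cst 0) => n.
  by rewrite big1 // => i _; rewrite conjc0 !mulr0 subr0.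
rewrite (ipDr ipL ipJ) (ipZr ipL ipJ) ip_kv // ev_kv //.
have g := ctends_geo (disk_mulJ hw hz).
have := ctendsD (ctendsZ (cj c * (1 - b z * cj (b w))) g) IH.
rewrite mulrA; apply: eq_ctends => M; rewrite mulr_sumr -big_split /=; apply: eq_bigr => i _.
rewrite !rmorphD !rmorphM /= !rmorphXn /= !conjcK exprMn; ring.
Qed.

Lemma kspan_ip v x y v' x' y' : kspan v x y -> kspan v' x' y' ->
  ctends (fun M => \sum_(n < M) (x n * cj (x' n) - y n * cj (y' n))) (ip v v').
Proof.
move=> h h'; elim: h => {v x y} [|c w v x y hw h IH].
  rewrite (ip0l ipL); apply: eq_ctends (ctends_cst 0) => n.
  by rewrite big1 // => i _; rewrite !mul0r subr0.
rewrite ipL; have := ctendsD (ctendsZ c (kv_kspan_ip hw h')) IH.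
apply: eq_ctends => M; rewrite mulr_sumr -big_split /=; apply: eq_bigr => i _; ring.
Qed.

(** ||v||^2 = ||x||^2 - ||y||^2, and the second term is dropped. *)
Lemma kspan_contractive v x y M : kspan v x y -> 0 < M -> l2bnd x M -> N v <= M.
Proof.
move=> h M0 hx; rewrite -(@ler_pXn2r _ 2) ?nnegrE ?(ip_norm_ge0 ip) ?(ltW M0) //.
rewrite (ip_norm_sqr ip_ge0); apply: (cvg_le_bound (ctends_Re (kspan_ip h h)) (n0 := 0%N)) => n _.
apply: le_trans (hx n); rewrite Re_sum; apply: ler_sum => i _.
by rewrite -!cmod_sqrC -rmorphB /= gerBl sqr_ge0.
Qed.

(** Says that [v] is the image of the H^2 function with coefficients [x] under the contraction
    taking k_w to K_w, which is 1 - T_b T_b^* in operator terms. Approximation by finite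
    combinations replaces the operator. *)
Definition kclosure (v : V) (x : nat -> R[i]) := forall e : R, 0 < e ->
  exists v' x' y', [/\ kspan v' x' y', N (v - v') <= e & l2bnd (fun n => x n - x' n) e].

Lemma kclosure_kv w : disk w -> kclosure (kv w) (fun n => cj w ^+ n).
Proof.
move=> hw e e0; do 3 eexists; split; first exact: (kspanD 1 hw kspan0).
  by rewrite scale1r addr0 subrr (ip_norm0 ipL) ltW.
by apply: eq_l2bnd (@l2bnd0 _ e) => n; rewrite mul1r addr0 subrr.
Qed.

Lemma kclosure0 : kclosure 0 (fun=> 0).
Proof.
move=> e e0; exists 0, (fun=> 0), (fun=> 0); split; first exact: kspan0.
  by rewrite subrr (ip_norm0 ipL) ltW.
by apply: eq_l2bnd (@l2bnd0 _ e) => n; rewrite subrr.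
Qed.

Lemma kclosure_lin a v x v' x' : kclosure v x -> kclosure v' x' ->
  kclosure (a *: v + v') (fun n => a * x n + x' n).
Proof.
move=> h h' e e0; have a0 := cmod_ge0 a.
have a1 : 0 < cmod a + 1 by rewrite ltr_wpDl.
pose d := e / 2 / (cmod a + 1).
have d0 : 0 < d by rewrite !divr_gt0.
have e2 : 0 < e / 2 by rewrite divr_gt0.
have ad : (cmod a + 1) * d = e / 2 by rewrite /d; field; rewrite gt_eqF.
have ade : cmod a * d <= e / 2 by rewrite -ad ler_wpM2r ?(ltW d0) // lerDl.
have [u [s [t [k1 n1 l1]]]] := h _ d0.
have [u' [s' [t' [k2 n2 l2]]]] := h' _ e2.
do 3 eexists; split; first exact: kspan_add (kspan_scale a k1) k2.
  rewrite opprD addrACA -scalerBr; apply: (le_trans (ip_normD ipL ipJ ip_ge0 ip_def _ _)).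
  rewrite (ip_normZ ipL ipJ ip_ge0); have : cmod a * N (v - u) <= cmod a * d by rewrite ler_wpM2l.
  by lra.
have -> : e = e / 2 + e / 2 by field.
have h1 : l2bnd (fun n => a * (x n - s n)) (e / 2).
  by apply: l2bnd_le (l2bndZ a l1) => //; rewrite mulr_ge0 // ltW.
by apply: eq_l2bnd (l2bndD e2 e2 h1 l2) => n; ring.
Qed.

Lemma kclosure_contractive v x M : kclosure v x -> 0 < M -> l2bnd x M -> N v <= M.
Proof.
move=> h M0 hx; apply/ler_addgt0Pr => e e0.
have e2 : 0 < e / 2 by rewrite divr_gt0.
have [u [s [t [k1 n1 l1]]]] := h _ e2.
have l3 : l2bnd s (M + e / 2).
  by apply: eq_l2bnd (l2bndD M0 e2 hx (l2bndC l1)) => n; rewrite addrC subrK.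
have hu : N u <= M + e / 2 by apply: kspan_contractive k1 _ l3; rewrite addr_gt0.
have := ip_normD ipL ipJ ip_ge0 ip_def (v - u) u; rewrite subrK; lra.
Qed.

(** Contractivity applied to differences turns l^2 convergence of the coefficient sequences into a
    Cauchy sequence in H(b), and completeness supplies the limit. *)
Lemma kclosure_closed (v : nat -> V) (x : nat -> nat -> R[i]) (s : nat -> R[i]) (d : nat -> R) :
  (forall k, kclosure (v k) (x k)) -> (forall k, 0 < d k) ->
  (forall k, l2bnd (fun n => x k n - s n) (d k)) -> d @ \oo --> (0 : R) ->
  exists u, kclosure u s.
Proof.
move=> hv d0 hx hd.
have d0' k : 0 <= d k by rewrite ltW.
have dist m n : N (v m - v n) <= d m + d n.
  have := kclosure_lin (-1) (hv n) (hv m); rewrite scaleN1r addrC => h.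
  apply: kclosure_contractive h _ _; first by rewrite addr_gt0.
  by apply: eq_l2bnd (l2bndD (d0 m) (d0 n) (hx m) (l2bndC (hx n))) => k; ring.
have [u hu] : exists u, N (v n - u) @[n --> \oo] --> (0 : R).
  apply: ip_complete => e e0; have e2 : 0 < e / 2 by rewrite divr_gt0.
  have [n0 hn0] := (cvg0_eps d0').1 hd _ e2.
  exists n0 => m n hm hn; apply: (le_lt_trans (dist _ _)).
  by have := hn0 _ hm; have := hn0 _ hn; lra.
exists u => e e0; have e2 : 0 < e / 2 by rewrite divr_gt0.
have [n0 hn0] := (cvg0_eps d0').1 hd _ e2.
have [n1 hn1] := (cvg0_eps (fun n => ip_norm_ge0 ip (v n - u))).1 hu _ e2.
pose k := maxn n0 n1.
have [v' [x' [y' [k1 h1 l1]]]] := hv k _ e2.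
exists v', x', y'; split => //.
  rewrite -(subrKA (v k)); apply: (le_trans (ip_normD ipL ipJ ip_ge0 ip_def _ _)).
  rewrite (ip_normB ipL ipJ ip_ge0); have := hn1 k (leq_maxr _ _); lra.
have -> : e = e / 2 + e / 2 by field.
have l2 : l2bnd (fun n => s n - x k n) (e / 2).
  by apply: l2bnd_le (ltW (hn0 k (leq_maxl _ _))) (l2bndC (hx k)).
by apply: eq_l2bnd (l2bndD e2 e2 l2 l1) => n; ring.
Qed.

Lemma kclosure_sum (I : Type) (r : seq I) (a : I -> C) (v : I -> V) (x : I -> nat -> R[i]) :
  (forall i, kclosure (v i) (x i)) ->
  kclosure (\sum_(i <- r) a i *: v i) (fun n => \sum_(i <- r) a i * x i n).
Proof.
move=> h; elim: r => [|i r IH].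
  rewrite big_nil; have -> : (fun n : nat => \sum_(i <- [::]) a i * x i n) = (fun=> 0).
    by apply/funext => n; rewrite big_nil.
  exact: kclosure0.
rewrite big_cons; have := kclosure_lin (a i) (h i) IH.
by congr kclosure; apply/funext => n; rewrite big_cons.
Qed.

Local Notation delta n := (fun m : nat => (m == n)%:R : R[i]).

(* e_n is the limit of (K_w - sum_(j<n) conj(w)^j e_j) / conj(w)^n as w -> 0. *)
Lemma kclosure_delta n : exists v, kclosure v (delta n).
Proof.
elim/ltn_ind: n => n IH.
have /choice[e he] : forall j : 'I_n, exists v, kclosure v (delta j) by move=> j; apply: IH.
(* Real points tending to 0 and staying at most 1/2, so that a single ratio 1/2 controls every
   tail. *)
pose w k : R := (k%:R + 2)^-1.
have w2 k : 0 < w k <= 2^-1.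
  have k0 := ler0n R k; rewrite invr_gt0 lef_pV2 ?posrE ?lerDr ?ltr_wpDl //.
have wd k : disk ((w k)%:C : R[i]).
  by change (cmod ((w k)%:C : R[i]) < 1); rewrite cmod_real ger0_norm; have := w2 k; lra.
pose v k := ((w k)%:C ^- n : C) *: (kv (w k)%:C + \sum_(j < n) (- (w k)%:C ^+ j : C) *: e j).
pose x k m : R[i] := if (m < n)%N then 0 else (w k)%:C ^+ (m - n).
have wn0 k : (w k)%:C != 0 :> R[i] by rewrite -cmod_eq0 cmod_real normr_eq0 gt_eqF //; have := w2 k; lra.
(* [x k] agrees with the delta at n up to index n; beyond n it is w_k times a geometric sequence of
   ratio at most 1/2, whence the distance. *)
apply: (@kclosure_closed v x _ (fun k => w k / Num.sqrt (1 - 2^-1 ^+ 2))).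
- move=> k; rewrite /v.
  have h1 := kclosure_lin 1 (kclosure_kv (wd k)) (kclosure_sum (index_enum _) (fun j : 'I_n => - (w k)%:C ^+ j) he).
  have := kclosure_lin ((w k)%:C ^- n) h1 kclosure0; rewrite scale1r addr0.
  congr kclosure; apply/funext => m; rewrite addr0 mul1r conjc_real /x.
  have [mn|mn] := ltnP m n.
    rewrite (bigD1 (Ordinal mn)) //= eqxx mulr1 big1 ?addr0 ?subrr ?mulr0 // => i hi.
    rewrite (_ : (m == i) = false) ?mulr0 //; apply/negbTE; apply: contra hi => /eqP mi.
    by apply/eqP/val_inj; rewrite /= -mi.
  rewrite big1 ?addr0; last first.
    by move=> i _; rewrite gtn_eqF ?mulr0 // (leq_trans (ltn_ord i)).
  by rewrite -{1}(subnK mn) exprD mulrC mulfK // expf_neq0.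
- move=> k; have := w2 k; move=> /andP[h1 h2]; rewrite divr_gt0 // sqrtr_gt0; lra.
- move=> k; have := w2 k; move=> /andP[h1 h2] M.
  have q1 : 0 < (2^-1 : R) < 1 by lra.
  have hw : cmod ((w k)%:C : R[i]) <= 2^-1 by rewrite cmod_real ger0_norm // ltW.
  have := l2bndZ ((w k)%:C) (@l2bnd_tail R _ _ n.+1 0 hw q1).
  rewrite addn0 expr0 div1r cmod_real ger0_norm ?(ltW h1) // => /(_ M); apply: le_trans.
  apply: ler_sum => i _; rewrite /x /= ltnS.
  have [lin|lin|->] := ltngtP i n; rewrite ?subr0 ?mulr0 //.
  + by rewrite -exprS subnSK // lin.
  + by apply: le_trans (sqr_ge0 _); rewrite subnn expr0 subrr cmod0 expr0n.
rewrite -[X in _ --> X](mul0r (Num.sqrt (1 - 2^-1 ^+ 2))^-1).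
apply: cvgM; last exact: cvg_cst.
have -> : w = (fun j => (j.+2%:R)^-1) by apply/funext => j; rewrite /w -natrD addn2.
have := @cvg_harmonic R; rewrite -(cvg_shiftS _ _) /harmonic => h.
exact: h.
Qed.

(** The l^2 tails of the coefficients conj(w)^n of k_w tend to 0, so by contractivity K_w is the
    norm limit of the partial sums of conj(w)^n e_n. Pairing [h] with this limit gives the Taylor
    expansion of h at w. *)
Lemma coef_vectors : exists e : nat -> V, forall h w, disk w ->
  ctends (fun M => \sum_(n < M) ip h (e n) * w ^+ n) (ev h w).
Proof.
have /choice[e he] := kclosure_delta.
exists e => h w hw; have w1 : cmod w < 1 by [].
(* A ratio that is positive even for w = 0, as [l2bnd_tail] requires. *)
pose r := (1 + cmod w) / 2.
have w0 := cmod_ge0 w.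
have r01 : 0 < r < 1 by rewrite /r; lra.
have wr : cmod (cj w) <= r by rewrite cmodJ /r; lra.
pose d M := r ^+ M / Num.sqrt (1 - r ^+ 2).
have r2 : 0 < 1 - r ^+ 2 by rewrite subr_gt0 exprn_ilt1 //; lra.
have key M : N (kv w - \sum_(n < M) (cj w ^+ n : C) *: e n) <= d M.
  have := kclosure_lin 1 (kclosure_kv hw) (kclosure_sum (index_enum _) (fun j : 'I_M => - cj w ^+ j) (fun j => he j)).
  rewrite scale1r => h1.
  rewrite -sumrN; under eq_bigr do rewrite -scaleNr.
  apply: kclosure_contractive h1 _ _; first by rewrite divr_gt0 ?exprn_gt0 ?sqrtr_gt0 //; lra.
  apply: eq_l2bnd (l2bnd_tail 0 M wr r01) => n; rewrite add0n subn0 mul1r.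
  have [nM|nM] := ltnP n M.
    rewrite (bigD1 (Ordinal nM)) //= eqxx mulr1 big1 ?addr0 ?subrr // => i hi.
    rewrite (_ : (n == i) = false) ?mulr0 //; apply/negbTE; apply: contra hi => /eqP mi.
    by apply/eqP/val_inj; rewrite /= -mi.
  rewrite big1 ?addr0 // => i _; rewrite gtn_eqF ?mulr0 // (leq_trans (ltn_ord i)) //.
rewrite -ip_kv //; apply: (@ctends_le _ _ _ (fun M => N h * d M)).
  move=> M; have -> : \sum_(n < M) ip h (e n) * w ^+ n - ip h (kv w)
      = - ip h (kv w - \sum_(n < M) (cj w ^+ n : C) *: e n).
    rewrite (ipBr ipL ipJ) opprB (ip_sumr ipL ipJ); congr (_ - _); apply: eq_bigr => i _.
    by rewrite (ipZr ipL ipJ) rmorphXn /= conjcK mulrC.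
  rewrite cmodN; apply: (le_trans (cauchy_schwarz ipL ipJ ip_ge0 ip_def _ _)).
  by rewrite ler_wpM2l // ip_norm_ge0.
apply: cvg0_M; rewrite /d -(mul0r (Num.sqrt (1 - r ^+ 2))^-1); apply: cvgM; last exact: cvg_cst.
by apply: cvg_expr0; lra.
Qed.
End CoefficientVectors.

Lemma le_of_eq (R : numDomainType) (x y : R) : x = y -> x <= y.
Proof. by move=> ->. Qed.

(** * Power series on the disk *)

Section PowerSeries.
Variable R : realType.
Local Notation C := (R[i] : numFieldType).
Implicit Types (c d : nat -> R[i]) (f g : R[i] -> R[i]) (z : R[i]).

(** The working form of holomorphy on the disk: products, exponentials and circle integrals are all
    treated through the expansion. *)
Definition psum f c := forall z, disk z -> ctends (fun M => \sum_(n < M) c n * z ^+ n) (f z).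

Lemma taylor_coeffsP f c : taylor_coeffs f c <-> psum f c.
Proof.
split=> h z hz.
  have /cvg_ctends := h z hz; apply: eq_ctends => n.
  by rewrite /series /= big_mkord.
apply/cvg_ctends; apply: eq_ctends (h z hz) => n.
by rewrite /series /= big_mkord.
Qed.

Lemma disk_real (r : R) : 0 <= r < 1 -> disk (r%:C : R[i]).
Proof. by move=> /andP[r0 r1]; change (cmod (r%:C : R[i]) < 1); rewrite cmod_real ger0_norm. Qed.

(** Convergence at the larger radius s = (1 + r)/2 bounds the partial sums there by some B, hence
    the terms by 2B, which leaves the ratio r/s at radius r. *)
Lemma psum_geo f c (r : R) : psum f c -> 0 <= r < 1 ->
  exists B q, [/\ 0 <= B, 0 <= q < 1 & forall n, cmod (c n) * r ^+ n <= B * q ^+ n].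
Proof.
move=> h /andP[r0 r1]; pose s := (1 + r) / 2.
have s01 : 0 <= s < 1 by rewrite /s; lra.
have [B [B0 hB]] := ctends_bnd (h _ (disk_real s01)).
exists (B + B), (r / s); have s0 : 0 < s by rewrite /s; lra.
split; [exact: addr_ge0| by rewrite divr_ge0 ?(ltW s0) //= ltr_pdivrMr // mul1r /s; lra|].
move=> n; rewrite expr_div_n mulrA ler_pdivlMr ?exprn_gt0 // mulrAC ler_wpM2r ?exprn_ge0 //.
have := cmodD (\sum_(k < n.+1) c k * s%:C ^+ k) (- \sum_(k < n) c k * s%:C ^+ k).
rewrite cmodN big_ord_recr /= addrAC subrr add0r cmodM cmodX cmod_real (ger0_norm (ltW s0)) => h1.
apply: (le_trans h1); have := hB n.+1; rewrite big_ord_recr /=; have := hB n; lra.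
Qed.

Definition cauchy_prod c d n := \sum_(k < n.+1) c k * d (n - k)%N.

Lemma sum_conv (a b : nat -> R[i]) N :
  \sum_(n < N) cauchy_prod a b n = \sum_(i < N) a i * \sum_(j < N - i) b j.
Proof.
elim: N => [|N IH]; first by rewrite !big_ord0.
rewrite big_ord_recr IH /= big_ord_recr /= subSn // subnn big_ord1.
rewrite /cauchy_prod big_ord_recr /= subnn addrA; congr (_ + _).
rewrite -big_split /=; apply: eq_bigr => i _.
by rewrite -mulrDr subSn 1?ltnW // big_ord_recr.
Qed.

(** With s the square root of q, n s^n is at most the sum of the s^i with i < n, so n q^n <= s^n /
    (1 - s). *)
Lemma cvg_nexp (q : R) : 0 <= q < 1 -> n%:R * q ^+ n @[n --> \oo] --> (0 : R).
Proof.
move=> /andP[q0 q1]; pose s := Num.sqrt q.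
have s0 : 0 <= s by exact: sqrtr_ge0.
have qs : q = s ^+ 2 by rewrite sqr_sqrtr.
have s1 : s < 1 by rewrite -sqrtr1 ltr_sqrt.
have s01 : 0 <= s < 1 by rewrite s0.
apply: (@cvg0_le _ _ (fun n => (1 - s)^-1 * s ^+ n)); last first.
  by apply: cvg0_M; exact: cvg_expr0.
move=> n; rewrite mulr_ge0 ?ler0n ?exprn_ge0 //= qs -exprM mulnC exprM expr2 mulrA.
apply: ler_wpM2r; first exact: exprn_ge0.
apply: le_trans (geo_le n s01); rewrite -[n in n%:R]card_ord mulr_natl -sumr_const.
by apply: ler_sum => i _; apply: ler_wiXn2l => //; [exact: ltW|exact: ltnW].
Qed.

(** The partial sum of the Cauchy product differs from the product of partial sums by the terms with
    i + j >= N, at most N K^2 q^N / (1 - q) in modulus. *)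
Lemma ctends_conv (a b : nat -> R[i]) (A B : R[i]) (K q : R) : 0 <= K -> 0 <= q < 1 ->
  (forall n, cmod (a n) <= K * q ^+ n) -> (forall n, cmod (b n) <= K * q ^+ n) ->
  ctends (fun N => \sum_(n < N) a n) A -> ctends (fun N => \sum_(n < N) b n) B ->
  ctends (fun N => \sum_(n < N) cauchy_prod a b n) (A * B).
Proof.
move=> K0 q01 ha hb hA hB; have /andP[q0 q1] := q01.
have h1 := ctendsM hA hB.
have h2 : ctends (fun N => \sum_(n < N) cauchy_prod a b n - (\sum_(n < N) a n) * (\sum_(n < N) b n)) 0.
  apply: (@ctends_le _ _ _ (fun n => K ^+ 2 / (1 - q) * (n%:R * q ^+ n))); last first.
    by apply: cvg0_M; exact: cvg_nexp.
  move=> N; rewrite subr0 sum_conv mulr_suml -sumrB.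
  apply: (le_trans (cmod_sum _ _ _)).
  apply: le_trans (_ : \sum_(i < N) K ^+ 2 / (1 - q) * q ^+ N <= _); last first.
    by rewrite sumr_const card_ord -[_ *+ N]mulr_natl mulrCA.
  apply: ler_sum => i _; rewrite -mulrBr cmodM.
  have iN : (N - i <= N)%N by exact: leq_subr.
  have -> : \sum_(j < N - i) b j - \sum_(j < N) b j = - \sum_(j < i) b (N - i + j)%N.
    rewrite -!(big_mkord xpredT b) (@big_cat_nat _ _ _ (N - i) 0 N) //= opprD addrA subrr add0r.
    rewrite -{1}[(N - i)%N]add0n big_addn subKn 1?ltnW // big_mkord; congr (- _).
    by apply: eq_bigr => j _; rewrite addnC.
  rewrite cmodN.
  have h3 : cmod (\sum_(j < i) b (N - i + j)%N) <= K * q ^+ (N - i) / (1 - q).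
    apply: (le_trans (cmod_sum _ _ _)).
    apply: le_trans (_ : \sum_(j < i) K * q ^+ (N - i) * q ^+ j <= _).
      by apply: ler_sum => j _; rewrite -mulrA -exprD.
    rewrite -mulr_sumr; apply: ler_wpM2l; last exact: geo_le.
    by rewrite mulr_ge0 ?exprn_ge0.
  apply: le_trans (ler_pM (cmod_ge0 _) (cmod_ge0 _) (ha i) h3) _.
  have -> : q ^+ N = q ^+ i * q ^+ (N - i) by rewrite -exprD subnKC // ltnW.
  by apply: le_of_eq; ring.
have := ctendsD h2 h1; rewrite add0r; apply: eq_ctends => n; by rewrite subrK.
Qed.

Lemma conv_exp c d z n : cauchy_prod c d n * z ^+ n = cauchy_prod (fun k => c k * z ^+ k) (fun k => d k * z ^+ k) n.
Proof.
rewrite /cauchy_prod mulr_suml; apply: eq_bigr => k _.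
have -> : z ^+ n = z ^+ k * z ^+ (n - k) by rewrite -exprD subnKC // -ltnS.
ring.
Qed.

Lemma psum_mul f g c d : psum f c -> psum g d -> psum (fun z => f z * g z) (cauchy_prod c d).
Proof.
move=> hf hg z hz; have z01 : 0 <= cmod z < 1 by rewrite cmod_ge0.
have [B [q [B0 /andP[q0 q1] hB]]] := psum_geo hf z01.
have [B' [q' [B0' /andP[q0' q1'] hB']]] := psum_geo hg z01.
(* Used to weaken both geometric bounds to a common constant and a common ratio, as [ctends_conv]
   asks. *)
have m s1 s2 B1 B2 n : 0 <= s1 -> 0 <= B1 -> s1 <= s2 -> B1 <= B2 -> B1 * s1 ^+ n <= B2 * s2 ^+ n :> R.
  move=> h1 h2 h3 h4; apply: ler_pM => //; first exact: exprn_ge0.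
  by apply: lerXn2r => //; rewrite nnegrE // (le_trans h1).
have BB : 0 <= B + B' by rewrite addr_ge0.
have qq : 0 <= Num.max q q' < 1 by rewrite le_max q0 gt_max q1.
have hc n : cmod (c n * z ^+ n) <= (B + B') * Num.max q q' ^+ n.
  by rewrite cmodM cmodX; apply: (le_trans (hB n)); apply: m => //; [rewrite le_max lexx|lra].
have hd n : cmod (d n * z ^+ n) <= (B + B') * Num.max q q' ^+ n.
  by rewrite cmodM cmodX; apply: (le_trans (hB' n)); apply: m => //; [rewrite le_max lexx orbT|lra].
have := ctends_conv BB qq hc hd (hf z hz) (hg z hz).
by apply: eq_ctends => N; apply: eq_bigr => n _; rewrite conv_exp.
Qed.

Lemma psum_lin a f g c d : psum f c -> psum g d ->
  psum (fun z => a * f z + g z) (fun n => a * c n + d n).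
Proof.
move=> hf hg z hz; apply: eq_ctends (ctendsD (ctendsZ a (hf z hz)) (hg z hz)) => M.
by rewrite mulr_sumr -big_split /=; apply: eq_bigr => i _; ring.
Qed.

Lemma psum_eq f g c d : (forall z, disk z -> f z = g z) -> (forall n, c n = d n) -> psum f c -> psum g d.
Proof. by move=> fg /funext <- h z hz; rewrite -fg //; exact: h. Qed.

Lemma psum_cst (a : R[i]) : psum (fun=> a) (fun n => if n is 0%N then a else 0).
Proof.
move=> z hz; apply: (@ctends_le _ _ _ (fun n => cmod a * 0 ^+ n)); last first.
  by apply: cvg0_M; apply: cvg_expr0; rewrite lexx ltr01.
case=> [|n]; first by rewrite big_ord0 expr0 sub0r cmodN mulr1.
rewrite big_ord_recl /= expr0 mulr1 big1 ?addr0 ?subrr ?cmod0 ?expr0n ?mulr0 // => i _.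
by rewrite mul0r.
Qed.

Lemma psum_X : psum (fun z => z) (fun n => (n == 1%N)%:R).
Proof.
move=> z hz; rewrite -/(ctends _ _).
have : ctends (fun M => \sum_(n < M.+2) (n == 1%N :> nat)%:R * z ^+ n) z.
  apply: eq_ctends (ctends_cst z) => M.
  by rewrite !big_ord_recl /= mul0r add0r mul1r expr1 big1 ?addr0 // => i _; rewrite mul0r.
rewrite /ctends -(cvg_shiftn 2 (fun M => cmod (\sum_(n < M) (n == 1%N :> nat)%:R * z ^+ n - z))).
apply: cvg_trans; apply: near_eq_cvg; apply: nearW => n; by rewrite /= addn2.
Qed.

Lemma psum_szego (w : R[i]) : disk w -> psum (fun z => (1 - z * cj w)^-1) (fun n => cj w ^+ n).
Proof.
move=> hw z hz; have h := ctends_geo (_ : cmod (z * cj w) < 1).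
have hzw : cmod (z * cj w) < 1.
  by rewrite cmodM cmodJ; apply: mulr_ilt1; rewrite ?cmod_ge0.
by apply: eq_ctends (h hzw) => M; apply: eq_bigr => n _; rewrite exprMn mulrC.
Qed.

End PowerSeries.

(** * The exponential series *)

Section ComplexExponential.
Variable R : realType.
Implicit Types (z w : R[i]).

Lemma expCD z w : expC (z + w) = expC z * expC w.
Proof. by rewrite /expC ReD ImD expRD expiD rmorphM /=; ring. Qed.

Lemma cmod_expC z : cmod (expC z) = expR (Re z).
Proof. by rewrite /expC cmodM cmod_expi mulr1 cmod_real ger0_norm // expR_ge0. Qed.

Lemma exp_coeff_cvg (x : R) : \sum_(k < n) x ^+ k / k`!%:R @[n --> \oo] --> expR x.
Proof.
have := @is_cvg_series_exp_coeff R x; rewrite /expR.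
by rewrite /series /exp_coeff /=; under eq_fun do rewrite big_mkord.
Qed.

Lemma expR_partial_le (x : R) n : 0 <= x -> \sum_(k < n) x ^+ k / k`!%:R <= expR x.
Proof.
move=> x0; apply: (cvg_ge_bound (@exp_coeff_cvg x) (n0 := n)) => m nm.
rewrite -(subnKC nm) big_split_ord /= lerDl; apply: sumr_ge0 => i _.
by rewrite divr_ge0 ?exprn_ge0 ?ler0n.
Qed.

(** Doubling x costs e^(2x) and buys the geometric factor 2^(-n), the decay under which
    [ctends_conv] applies. *)
Lemma exp_term_geo (x : R) n : 0 <= x -> x ^+ n / n`!%:R <= expR (2 * x) * 2^-1 ^+ n.
Proof.
move=> x0; have x20 : 0 <= 2 * x by rewrite mulr_ge0.
have := expR_partial_le n.+1 x20; rewrite big_ord_recr /= => h.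
have h2 : (2 * x) ^+ n / n`!%:R <= expR (2 * x).
  apply: le_trans h; rewrite lerDr; apply: sumr_ge0 => i _.
  by rewrite divr_ge0 ?exprn_ge0 ?ler0n.
have -> : x ^+ n / n`!%:R = (2 * x) ^+ n / n`!%:R * 2^-1 ^+ n.
  by rewrite exprMn exprVn; field; rewrite expf_neq0 // pnatr_eq0 -lt0n fact_gt0.
by apply: ler_wpM2r => //; rewrite exprn_ge0.
Qed.

Definition cexp_term z k : R[i] := z ^+ k / k`!%:R.

Lemma natC n : (n%:R : R[i]) = (n%:R : R)%:C.
Proof. by rewrite rmorph_nat. Qed.

Lemma cmod_nat n : cmod (n%:R : R[i]) = n%:R.
Proof. by rewrite natC cmod_real ger0_norm. Qed.

Lemma cmod_cexp_term z k : cmod (cexp_term z k) = cmod z ^+ k / k`!%:R.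
Proof. by rewrite /cexp_term cmodM cmodX cmodV cmod_nat. Qed.

Lemma factC_neq0 n : (n`!%:R : R[i]) != 0.
Proof. by rewrite -cmod_eq0 cmod_nat pnatr_eq0 -lt0n fact_gt0. Qed.

Lemma conv_cexp z w n : cauchy_prod (cexp_term z) (cexp_term w) n = cexp_term (z + w) n.
Proof.
rewrite /cauchy_prod /cexp_term addrC exprDn mulr_suml; apply: eq_bigr => k _.
have kn : (k <= n)%N by rewrite -ltnS.
have h := congr1 (fun n : nat => n%:R : R[i]) (bin_fact kn); rewrite !natrM in h.
have f1 := factC_neq0 n; have f2 := factC_neq0 k; have f3 := factC_neq0 (n - k).
have f4 : 'C(n, k)%:R != 0 :> R[i] by apply: contraTneq f1 => h0; rewrite -h h0 mul0r eqxx.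
by rewrite -mulr_natr -h; field; rewrite f2 f3 f4.
Qed.

Lemma cexp_real (x : R) : ctends (fun n => \sum_(k < n) cexp_term x%:C k) (expR x)%:C.
Proof.
have term k : cexp_term x%:C k = (x ^+ k / k`!%:R)%:C.
  by rewrite /cexp_term rmorphM fmorphV rmorphXn /= natC.
apply: (@ctends_le _ _ _ (fun n => `|\sum_(k < n) x ^+ k / k`!%:R - expR x|)).
  by move=> n; under eq_bigr do rewrite term; rewrite -realC_sum -rmorphB cmod_real.
have h : \sum_(k < n) x ^+ k / k`!%:R - expR x @[n --> \oo] --> (0 : R).
  by rewrite -[X in _ --> X](subrr (expR x)); apply: cvgB; [exact: exp_coeff_cvg|exact: cvg_cst].
have := cvg_norm h; rewrite normr0; exact.
Qed.

Lemma cexp_imag (y : R) : ctends (fun n => \sum_(k < n) cexp_term (Complex 0 y) k) (expi y).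
Proof.
(* The truncated predecessor at k = 0 is harmless, since the factor [odd k] vanishes there. *)
have iX k : (Complex 0 y) ^+ k =
    Complex ((~~ odd k)%:R * (-1) ^+ k./2 * y ^+ k) ((odd k)%:R * (-1) ^+ k.-1./2 * y ^+ k).
  elim: k => [|k IH]; first by rewrite !expr0 /= !mul0r !mul1r.
  rewrite exprS IH /= negbK !exprS; simpc; congr Complex; last by ring.
  case: k {IH} => [|k] /=; first by rewrite !mul0r mulr0 oppr0.
  by rewrite !exprS; ring.
have term k : cexp_term (Complex 0 y) k = Complex (cos_coeff y k) (sin_coeff y k).
  rewrite /cexp_term iX natC -fmorphV /cos_coeff /sin_coeff /=; simpc.
  by rewrite -exprnP.
apply: ctends_ReIm.
- under eq_fun do rewrite Re_sum; under eq_fun do (under eq_bigr do rewrite term /=).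
  have : series (cos_coeff y) @ \oo --> cos y by rewrite unlock; exact: is_cvg_series_cos_coeff.
  by rewrite /series /=; under eq_fun do rewrite big_mkord.
- under eq_fun do rewrite Im_sum; under eq_fun do (under eq_bigr do rewrite term /=).
  have : series (sin_coeff y) @ \oo --> sin y by rewrite unlock; exact: is_cvg_series_sin_coeff.
  by rewrite /series /=; under eq_fun do rewrite big_mkord.
Qed.

Lemma ReImE z : (Re z)%:C + Complex 0 (Im z) = z.
Proof. by case: z => a b; simpc. Qed.

(** [expC] is a product of a real exponential and a rotation, so its series is the Cauchy product of
    the series for the real and the imaginary part, recombined by the binomial theorem. *)
Lemma expC_series z : ctends (fun n => \sum_(k < n) cexp_term z k) (expC z).
Proof.
have q01 : 0 <= (2^-1 : R) < 1 by lra.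
pose x := (Re z)%:C : R[i]; pose y := Complex 0 (Im z).
have bnd (u : R[i]) L n : cmod u <= L -> cmod (cexp_term u n) <= expR (2 * L) * 2^-1 ^+ n.
  move=> uL; rewrite cmod_cexp_term; apply: le_trans (exp_term_geo _ (le_trans (cmod_ge0 u) uL)).
  by rewrite ler_wpM2r ?invr_ge0 // lerXn2r ?nnegrE ?cmod_ge0 // (le_trans (cmod_ge0 u)).
have hx : cmod x <= cmod x + cmod y by rewrite lerDl cmod_ge0.
have hy : cmod y <= cmod x + cmod y by rewrite lerDr cmod_ge0.
have := ctends_conv (expR_ge0 _) q01 (fun n => bnd _ _ n hx) (fun n => bnd _ _ n hy)
  (cexp_real (Re z)) (cexp_imag (Im z)).
rewrite /expC; apply: eq_ctends => n; apply: eq_bigr => k _; rewrite conv_cexp; congr cexp_term.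
by rewrite /x /y ReImE.
Qed.

(** The tail is majorised by that of e^L, hence uniformly on |z| <= L; this uniformity is what
    [psum_expC] uses. *)
Lemma expC_tail z L n : cmod z <= L ->
  cmod (expC z - \sum_(k < n) cexp_term z k) <= expR L - \sum_(k < n) L ^+ k / k`!%:R.
Proof.
move=> zL; have L0 : 0 <= L := le_trans (cmod_ge0 z) zL.
have h := ctends_cmod (ctendsB (expC_series z) (ctends_cst (\sum_(k < n) cexp_term z k))).
have hc : \sum_(k < m) L ^+ k / k`!%:R - \sum_(k < n) L ^+ k / k`!%:R @[m --> \oo] -->
    expR L - \sum_(k < n) L ^+ k / k`!%:R.
  by apply: cvgB; [exact: exp_coeff_cvg|exact: cvg_cst].
have key m : (n <= m)%N -> cmod (\sum_(k < m) cexp_term z k - \sum_(k < n) cexp_term z k) <=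
    \sum_(k < m) L ^+ k / k`!%:R - \sum_(k < n) L ^+ k / k`!%:R.
  move=> /subnKC <-; rewrite !big_split_ord /= ![_ + _ - _]addrAC !subrr !add0r.
  apply: (le_trans (cmod_sum _ _ _)); apply: ler_sum => i _; rewrite cmod_cexp_term.
  by rewrite ler_wpM2r ?invr_ge0 // lerXn2r // nnegrE cmod_ge0.
by apply: (cvg_le_bound h (n0 := n)) => m nm; apply: (le_trans (key m nm));
  rewrite lerD2r; exact: expR_partial_le.
Qed.
End ComplexExponential.

(** * Integrals over circles *)

Section CircleIntegral.
Variable R : realType.
Local Notation mu := (@lebesgue_measure R).
Local Notation T := (measurableTypeR R).
Local Notation circle := (`[0, 2 * pi]%classic : set T).
Local Notation J g := (Rintegral mu circle g).
Implicit Types (g h : T -> R).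

Lemma measurable_circle : measurable circle.
Proof. exact: measurable_itv. Qed.

Lemma mu_circle : mu circle = (2 * pi)%:E.
Proof.
have p0 : (0 : R) < 2 * pi by rewrite mulr_gt0 // pi_gt0.
by rewrite lebesgue_measure_itv /= lte_fin p0 sube0.
Qed.

Lemma bounded_integrable g B : measurable_fun circle g ->
  (forall t, circle t -> `|g t| <= B) -> mu.-integrable circle (EFin \o g).
Proof.
move=> mg gB; apply: measurable_bounded_integrable => //.
- by rewrite [X in (X < _)%E]mu_circle ltry.
- exists B; split; first exact: num_real.
  by move=> M BM t /= ht; apply: (le_trans (gB _ ht)); exact: ltW.
Qed.

Lemma circle_int_cst (c : R) : J (fun=> c) = 2 * pi * c.
Proof. rewrite Rintegral_cst // mulrC; congr (_ * _).
by rewrite [X in fine X](_ : _ = (2 * pi)%:E) //; exact: mu_circle. Qed.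

Lemma circle_int_le_cst g B : mu.-integrable circle (EFin \o g) -> (forall t, circle t -> g t <= B) ->
  J g <= 2 * pi * B.
Proof.
move=> ig gB; rewrite -circle_int_cst; apply: le_Rintegral => //.
by apply: (@bounded_integrable _ `|B|) => //; exact: measurable_cst.
Qed.

Lemma bounded_convergence (G : nat -> T -> R) (B : R) :
  (forall n, measurable_fun circle (G n)) -> (forall n t, circle t -> `|G n t| <= B) ->
  {ae mu, forall t, circle t -> G n t @[n --> \oo] --> (0 : R)} ->
  J (G n) @[n --> \oo] --> (0 : R).
Proof.
move=> mG GB G0.
have iB : mu.-integrable circle (EFin \o (fun=> B)).
  by apply: (@bounded_integrable _ `|B|) => //; exact: measurable_cst.
have := @dominated_convergence _ T R mu circle measurable_circle
  (fun n t => (G n t)%:E) (fun=> 0%E) (fun=> B%:E).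
case.
- by move=> n; apply/measurable_EFinP; exact: mG.
- exact: measurable_cst.
- apply: filterS G0 => t h ct; apply/cvg_EFin; first by apply: nearW => n.
  exact: h.
- exact: iB.
- by apply: aeW => t n ct /=; rewrite lee_fin; exact: GB.
move=> _ _; rewrite integral0 => h.
by have /fine_cvg := h; apply: cvg_trans; apply: near_eq_cvg; apply: nearW => n.
Qed.

Lemma circle_int_add g h : mu.-integrable circle (EFin \o g) -> mu.-integrable circle (EFin \o h) ->
  J (fun t => g t + h t) = J g + J h.
Proof. by apply: RintegralD; exact: measurable_circle. Qed.

Lemma circle_int_sub g h : mu.-integrable circle (EFin \o g) -> mu.-integrable circle (EFin \o h) ->
  J (fun t => g t - h t) = J g - J h.
Proof. by apply: RintegralB; exact: measurable_circle. Qed.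

Lemma circle_int_scale g c : mu.-integrable circle (EFin \o g) -> J (fun t => c * g t) = c * J g.
Proof. by apply: RintegralZl; exact: measurable_circle. Qed.

Lemma circle_int_FTC (F f : R -> R) : (forall t : R, is_derive t 1 F (f t)) -> continuous f -> 
  J f = F (2 * pi) - F 0.
Proof.
move=> dF cf; have p0 : (0 : R) < 2 * pi by rewrite mulr_gt0 // pi_gt0.
have cF : continuous F.
  by move=> t; apply: differentiable_continuous; apply/derivable1_diffP; have [] := dF t.
rewrite /Rintegral (@continuous_FTC2 _ f F) //.
- exact: continuous_subspaceT.
- split; [|exact/cvg_at_right_filter/cF|exact/cvg_at_left_filter/cF].
  by move=> t _; have [] := dF t.
- by move=> t _; rewrite derive1E; have [] := dF t.
Qed.

Lemma expi_2pi n : expi (n%:R * (2 * pi)) = 1 :> R[i].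
Proof.
have e : expi (2 * pi : R) = 1.
  by rewrite /expi mulrC mulr_natr cos2pi sin2pi.
by rewrite -expiX e expr1n.
Qed.

Lemma circle_int_cos n : J (fun t => cos (n.+1%:R * t)) = 0.
Proof.
have n0 : (n.+1%:R : R) != 0 by rewrite pnatr_eq0.
have D (t : R) : is_derive t 1 (fun t : R => sin (n.+1%:R * t) / n.+1%:R) (cos (n.+1%:R * t)).
  by apply: is_derive_eq; rewrite /GRing.scale /=; field.
rewrite (circle_int_FTC D).
- have := congr1 (@complex.Im R) (expi_2pi n.+1); rewrite /expi /= => ->.
  by rewrite mulr0 sin0 subrr.
- move=> t; apply: continuous_comp; last exact: continuous_cos.
  by apply: cvgM; [exact: cvg_cst|exact: cvg_id].
Qed.

Lemma circle_int_sin n : J (fun t => sin (n.+1%:R * t)) = 0.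
Proof.
have n0 : (n.+1%:R : R) != 0 by rewrite pnatr_eq0.
have D (t : R) : is_derive t 1 (fun t : R => - cos (n.+1%:R * t) / n.+1%:R) (sin (n.+1%:R * t)).
  by apply: is_derive_eq; rewrite /GRing.scale /=; field.
rewrite (circle_int_FTC D).
- have := congr1 (@complex.Re R) (expi_2pi n.+1); rewrite /expi /= => ->.
  by rewrite mulr0 cos0 subrr.
- move=> t; apply: continuous_comp; last exact: continuous_sin.
  by apply: cvgM; [exact: cvg_cst|exact: cvg_id].
Qed.

Definition cmeasurable (F : T -> R[i]) :=
  measurable_fun circle (fun t => Re (F t)) /\ measurable_fun circle (fun t => Im (F t)).

Lemma cmeasurable_cst c : cmeasurable (fun=> c).
Proof. by split; exact: measurable_cst. Qed.

Lemma cmeasurableD F G : cmeasurable F -> cmeasurable G -> cmeasurable (fun t => F t + G t).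
Proof.
move=> [h1 h2] [h3 h4]; split.
  by under [X in measurable_fun _ X]eq_fun do rewrite ReD; exact: measurable_funD.
by under [X in measurable_fun _ X]eq_fun do rewrite ImD; exact: measurable_funD.
Qed.

Lemma cmeasurableM F G : cmeasurable F -> cmeasurable G -> cmeasurable (fun t => F t * G t).
Proof.
move=> [h1 h2] [h3 h4]; split.
  by under [X in measurable_fun _ X]eq_fun do rewrite cReM; apply: measurable_funB; exact: measurable_funM.
by under [X in measurable_fun _ X]eq_fun do rewrite cImM; apply: measurable_funD; exact: measurable_funM.
Qed.

Lemma cmeasurable_expi (c : R) : cmeasurable (fun t => expi (c * t)).
Proof.
have ch : continuous (fun t : R => c * t).
  by move=> t; apply: cvgM; [exact: cvg_cst|exact: cvg_id].
have cc : continuous (fun t : R => cos (c * t)).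
  by move=> t; apply: continuous_comp; [exact: ch|exact: continuous_cos].
have cs : continuous (fun t : R => sin (c * t)).
  by move=> t; apply: continuous_comp; [exact: ch|exact: continuous_sin].
by split => /=; apply: measurable_funTS; exact: continuous_measurable_fun.
Qed.

Lemma cmeasurable_sum (I : Type) (r : seq I) (F : I -> T -> R[i]) :
  (forall i, cmeasurable (F i)) -> cmeasurable (fun t => \sum_(i <- r) F i t).
Proof.
move=> h; elim: r => [|i r IH].
  by under [X in cmeasurable X]eq_fun do rewrite big_nil; exact: cmeasurable_cst.
by under [X in cmeasurable X]eq_fun do rewrite big_cons; exact: cmeasurableD.
Qed.

Lemma cmeasurable_cvg (F : nat -> T -> R[i]) G : (forall n, cmeasurable (F n)) ->
  (forall t, circle t -> ctends (F ^~ t) (G t)) -> cmeasurable G.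
Proof.
move=> mF FG; split.
  apply: (@measurable_fun_cvg _ _ _ _ (fun n t => Re (F n t))).
    by move=> n; have [] := mF n.
  by move=> t ct; apply: ctends_Re; exact: FG.
apply: (@measurable_fun_cvg _ _ _ _ (fun n t => Im (F n t))).
  by move=> n; have [] := mF n.
by move=> t ct; apply: ctends_Im; exact: FG.
Qed.

Lemma measurable_cmod2 F : cmeasurable F -> measurable_fun circle (fun t => cmod (F t) ^+ 2).
Proof.
move=> [h1 h2]; under [X in measurable_fun _ X]eq_fun do rewrite cmod_sqr.
by apply: measurable_funD; exact: measurable_funX.
Qed.

Lemma cpoly_mul (c : nat -> R[i]) (r : R) n t :
  c n * (r%:C * expi t) ^+ n = (c n * (r ^+ n)%:C) * expi (n%:R * t).
Proof. by rewrite exprMn expiX rmorphXn /= mulrA. Qed.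

Lemma disk_circle (r t : R) : 0 <= r < 1 -> disk (r%:C * expi t).
Proof.
move=> /andP[r0 r1]; change (cmod (r%:C * expi t) < 1).
by rewrite cmodM cmod_expi mulr1 cmod_real ger0_norm.
Qed.

Lemma psum_cmeasurable f c (r : R) : psum f c -> 0 <= r < 1 ->
  cmeasurable (fun t => f (r%:C * expi t)).
Proof.
move=> h r01; apply: (@cmeasurable_cvg (fun N t => \sum_(n < N) c n * (r%:C * expi t) ^+ n)).
  move=> N; apply: cmeasurable_sum => n; under [X in cmeasurable X]eq_fun do rewrite cpoly_mul.
  by apply: cmeasurableM; [exact: cmeasurable_cst|exact: cmeasurable_expi].
by move=> t _; apply: h; exact: disk_circle.
Qed.

(** Frequencies are written as negated successors, so none of them is 0 and every term integrates to
    0. *)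
Lemma circle_int_trig N (a : nat -> R[i]) (m : nat -> nat) :
  J (fun t => Re (\sum_(n < N) a n * expi (- ((m n).+1%:R * t)))) = 0.
Proof.
have ci (b : R[i]) k : cmeasurable (fun t => b * expi (- (k%:R * t))).
  apply: cmeasurableM; first exact: cmeasurable_cst.
  by under [X in cmeasurable X]eq_fun do rewrite -mulNr; exact: cmeasurable_expi.
have bnd (b : R[i]) (k : nat) t : `|Re (b * expi (- (k%:R * t)))| <= cmod b.
  by apply: (le_trans (Re_le_cmod _)); rewrite cmodM cmod_expi mulr1.
have int1 (b : R[i]) k : mu.-integrable circle (EFin \o (fun t => Re (b * expi (- (k%:R * t))))).
  apply: (@bounded_integrable _ (cmod b)) => [|t _]; last exact: bnd.
  by have [] := ci b k.
have z1 (b : R[i]) k : J (fun t => Re (b * expi (- (k.+1%:R * t)))) = 0.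
  under eq_Rintegral do rewrite cReM /= cosN sinN mulrN opprK.
  have mc : measurable_fun circle (fun t => cos (k.+1%:R * t)).
    by have [] := cmeasurable_expi k.+1%:R.
  have ms : measurable_fun circle (fun t => sin (k.+1%:R * t)).
    by have [] := cmeasurable_expi k.+1%:R.
  have ic : mu.-integrable circle (EFin \o (fun t => cos (k.+1%:R * t))).
    by apply: (@bounded_integrable _ 1) => // t _; rewrite ler_norml cos_geN1 cos_le1.
  have is_ : mu.-integrable circle (EFin \o (fun t => sin (k.+1%:R * t))).
    by apply: (@bounded_integrable _ 1) => // t _; rewrite ler_norml sin_geN1 sin_le1.
  rewrite circle_int_add.
  - by rewrite !circle_int_scale // circle_int_cos circle_int_sin !mulr0 addr0.
  - apply: (@bounded_integrable _ `|Re b|) => [|t _].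
      by apply: measurable_funM => //; exact: measurable_cst.
    by rewrite normrM ler_piMr // ler_norml cos_geN1 cos_le1.
  - apply: (@bounded_integrable _ `|Im b|) => [|t _].
      by apply: measurable_funM => //; exact: measurable_cst.
    by rewrite normrM ler_piMr // ler_norml sin_geN1 sin_le1.
elim: N => [|N IH].
  by under eq_Rintegral do rewrite big_ord0; rewrite circle_int_cst mulr0.
under eq_Rintegral do rewrite big_ord_recr ReD.
rewrite circle_int_add ?IH ?z1 ?addr0 //.
apply: (@bounded_integrable _ (\sum_(n < N) cmod (a n))) => [|t _].
  by have [] := cmeasurable_sum (index_enum _) (fun n : 'I_N => ci (a n) (m n).+1).
rewrite Re_sum; apply: (le_trans (ler_norm_sum _ _ _)); apply: ler_sum => n _; exact: bnd.
Qed.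

Lemma cmod2D (x y : R[i]) : cmod (x + y) ^+ 2 = cmod x ^+ 2 + cmod y ^+ 2 + 2 * Re (x * cj y).
Proof. by rewrite !cmod_sqr ReD ImD cReM; case: x y => a b [c d] /=; ring. Qed.

(** Adding the term of index N contributes |d_N|^2 and a cross term whose frequencies n - N are all
    negative, which therefore integrates to 0. *)
Lemma circle_int_cmod2_trig (d : nat -> R[i]) N :
  J (fun t => cmod (\sum_(n < N) d n * expi (n%:R * t)) ^+ 2) = 2 * pi * \sum_(n < N) cmod (d n) ^+ 2.
Proof.
have ms k : cmeasurable (fun t => \sum_(n < k) d n * expi (n%:R * t)).
  apply: cmeasurable_sum => n; apply: cmeasurableM; [exact: cmeasurable_cst|exact: cmeasurable_expi].
have bd k t : cmod (\sum_(n < k) d n * expi (n%:R * t)) <= \sum_(n < k) cmod (d n).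
  apply: (le_trans (cmod_sum _ _ _)); apply: ler_sum => n _; by rewrite cmodM cmod_expi mulr1.
elim: N => [|N IH].
  by under eq_Rintegral do rewrite big_ord0 cmod0 expr0n; rewrite circle_int_cst big_ord0.
under eq_Rintegral do rewrite big_ord_recr cmod2D /= cmodM cmod_expi mulr1.
have key t : (\sum_(n < N) d n * expi (n%:R * t)) * cj (d N * expi (N%:R * t)) =
    \sum_(n < N) (d n * cj (d N)) * expi (- ((N - n).-1.+1%:R * t)).
  rewrite mulr_suml; apply: eq_bigr => n _; rewrite cjM expiJ.
  have nN := ltn_ord n; rewrite prednK ?subn_gt0 // natrB 1?ltnW //.
  rewrite (_ : - ((N%:R - n%:R) * t) = n%:R * t + - (N%:R * t)); last by ring.
  by rewrite expiD; ring.
have i1 : mu.-integrable circle (EFin \o (fun t => cmod (\sum_(n < N) d n * expi (n%:R * t)) ^+ 2)).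
  apply: (@bounded_integrable _ ((\sum_(n < N) cmod (d n)) ^+ 2)); first exact: measurable_cmod2.
  by move=> t _; rewrite normrX ger0_norm ?cmod_ge0 // lerXn2r ?nnegrE ?cmod_ge0 ?sumr_ge0 // => n _; exact: cmod_ge0.
have i2 : mu.-integrable circle (EFin \o (fun t : T => cmod (d N) ^+ 2)).
  by apply: (@bounded_integrable _ (cmod (d N) ^+ 2)) => [|t _]; [exact: measurable_cst|rewrite ger0_norm // sqr_ge0].
have mprod : cmeasurable (fun t => (\sum_(n < N) d n * expi (n%:R * t)) * cj (d N * expi (N%:R * t))).
  apply: cmeasurableM => //; under [X in cmeasurable X]eq_fun do rewrite cjM expiJ -mulNr.
  by apply: cmeasurableM; [exact: cmeasurable_cst|exact: cmeasurable_expi].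
have bprod t : `|Re ((\sum_(n < N) d n * expi (n%:R * t)) * cj (d N * expi (N%:R * t)))| <=
    (\sum_(n < N) cmod (d n)) * cmod (d N).
  apply: (le_trans (Re_le_cmod _)); rewrite cmodM cmodJ [cmod (d N * _)]cmodM cmod_expi mulr1.
  by rewrite ler_wpM2r ?cmod_ge0.
have i3 : mu.-integrable circle (EFin \o (fun t => Re ((\sum_(n < N) d n * expi (n%:R * t)) * cj (d N * expi (N%:R * t))))).
  apply: (@bounded_integrable _ ((\sum_(n < N) cmod (d n)) * cmod (d N))) => [|t _]; last exact: bprod.
  by have [] := mprod.
rewrite circle_int_add; last 2 first.
- by apply: integrableD i1 i2; exact: measurable_circle.
- apply: (@bounded_integrable _ (2 * ((\sum_(n < N) cmod (d n)) * cmod (d N)))) => [|t _].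
    by apply: measurable_funM; [exact: measurable_cst|have [] := mprod].
  by rewrite normrM ger0_norm // ler_wpM2l.
rewrite circle_int_add // IH circle_int_cst circle_int_scale //; under [J (fun t => Re _)]eq_Rintegral do rewrite key.
by rewrite (circle_int_trig N (fun n => d n * cj (d N)) (fun n => (N - n).-1)) mulr0 addr0 big_ord_recr /= -mulrDr.
Qed.

(** The geometric bound on the terms yields one constant for f and all its partial sums; it serves
    as the bound in bounded convergence. *)
Lemma psum_bounded f c (r : R) : psum f c -> 0 <= r < 1 ->
  exists B, [/\ 0 <= B, forall N z, cmod z <= r -> cmod (\sum_(n < N) c n * z ^+ n) <= B &
     forall z, cmod z <= r -> cmod (f z) <= B].
Proof.
move=> h r01; have [B [q [B0 q01 hB]]] := psum_geo h r01; have /andP[r0 r1] := r01.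
have /andP[q0 q1] := q01.
have key N z : cmod z <= r -> cmod (\sum_(n < N) c n * z ^+ n) <= B / (1 - q).
  move=> zr; apply: (le_trans (cmod_sum _ _ _)).
  apply: le_trans (_ : \sum_(n < N) B * q ^+ n <= _).
    apply: ler_sum => n _; rewrite cmodM cmodX; apply: le_trans (hB n).
    by rewrite ler_wpM2l ?cmod_ge0 // lerXn2r ?nnegrE ?cmod_ge0.
  by rewrite -mulr_sumr ler_wpM2l // geo_le.
exists (B / (1 - q)); split=> //; first by rewrite divr_ge0 // subr_ge0 ltW.
move=> z zr; have dz : disk z by exact: le_lt_trans r1.
by apply: (cvg_le_bound (ctends_cmod (h z dz)) (n0 := 0%N)) => N _; exact: key.
Qed.

(** The finite identity for partial sums passes to the limit by bounded convergence on the circle of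
    radius r. *)
Lemma parseval f c (r : R) : psum f c -> 0 <= r < 1 ->
  2 * pi * \sum_(n < N) cmod (c n) ^+ 2 * r ^+ (2 * n) @[N --> \oo] -->
  J (fun t => cmod (f (r%:C * expi t)) ^+ 2).
Proof.
move=> h r01; have [B [B0 hB hf]] := psum_bounded h r01; have /andP[r0 r1] := r01.
have cr t : cmod (r%:C * expi t) <= r by rewrite cmodM cmod_expi mulr1 cmod_real ger0_norm.
pose S N t := \sum_(n < N) c n * (r%:C * expi t) ^+ n.
have mS N : cmeasurable (S N).
  apply: cmeasurable_sum => n; under [X in cmeasurable X]eq_fun do rewrite cpoly_mul.
  by apply: cmeasurableM; [exact: cmeasurable_cst|exact: cmeasurable_expi].
have mf := psum_cmeasurable h r01.
have sq (x : R[i]) : cmod x <= B -> `|cmod x ^+ 2| <= B ^+ 2.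
  by move=> hx; rewrite normrX ger0_norm ?cmod_ge0 // lerXn2r ?nnegrE ?cmod_ge0.
have iS N : mu.-integrable circle (EFin \o (fun t => cmod (S N t) ^+ 2)).
  by apply: (@bounded_integrable _ (B ^+ 2)) => [|t _]; [exact: measurable_cmod2|apply/sq/hB].
have if_ : mu.-integrable circle (EFin \o (fun t => cmod (f (r%:C * expi t)) ^+ 2)).
  by apply: (@bounded_integrable _ (B ^+ 2)) => [|t _]; [exact: measurable_cmod2|apply/sq/hf].
have JS N : J (fun t => cmod (S N t) ^+ 2) = 2 * pi * \sum_(n < N) cmod (c n) ^+ 2 * r ^+ (2 * n).
  rewrite /S; under eq_Rintegral do under eq_bigr do rewrite cpoly_mul.
  rewrite (circle_int_cmod2_trig (fun n => c n * (r ^+ n)%:C)); congr (_ * _); apply: eq_bigr => n _.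
  by rewrite cmodM cmod_real ger0_norm ?exprn_ge0 // exprMn -exprM mulnC.
have := @bounded_convergence (fun N t => cmod (S N t) ^+ 2 - cmod (f (r%:C * expi t)) ^+ 2) (B ^+ 2 + B ^+ 2).
have -> : (fun N => J (fun t => cmod (S N t) ^+ 2 - cmod (f (r%:C * expi t)) ^+ 2)) =
   (fun N => 2 * pi * (\sum_(n < N) cmod (c n) ^+ 2 * r ^+ (2 * n)) - J (fun t => cmod (f (r%:C * expi t)) ^+ 2)).
  by apply/funext => N; rewrite circle_int_sub // JS.
move=> H; apply: cvg_sub0 (cvg_cst _); apply: H.
- by move=> n; apply: measurable_funB; exact: measurable_cmod2.
- move=> n t _; apply: (le_trans (ler_normB _ _)); apply: lerD; apply: sq; [exact: hB|exact: hf].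
- apply: aeW => t _; rewrite -[X in _ --> X](subrr (cmod (f (r%:C * expi t)) ^+ 2)).
  apply: cvgB; last exact: cvg_cst.
  have h1 := ctends_cmod (h _ (disk_circle t r01)).
  by under eq_fun do rewrite expr2; rewrite expr2; exact: cvgM.
Qed.

Lemma bessel f c (r : R) N : psum f c -> 0 <= r < 1 ->
  2 * pi * \sum_(n < N) cmod (c n) ^+ 2 * r ^+ (2 * n) <=
  J (fun t => cmod (f (r%:C * expi t)) ^+ 2).
Proof.
move=> h r01; have /andP[r0 _] := r01.
apply: (cvg_ge_bound (parseval h r01) (n0 := N)) => M NM.
have p0 : (0 : R) <= 2 * pi by rewrite mulr_ge0 // pi_ge0.
rewrite ler_wpM2l // -(subnKC NM) big_split_ord /= lerDl; apply: sumr_ge0 => i _.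
by rewrite mulr_ge0 ?sqr_ge0 ?exprn_ge0.
Qed.

(** Cauchy's estimate, obtained by keeping a single term of Bessel's inequality. *)
Lemma psum_coef_le f c (r B : R) n : psum f c -> 0 <= r < 1 -> 0 <= B ->
  (forall z, cmod z <= r -> cmod (f z) <= B) -> cmod (c n) * r ^+ n <= B.
Proof.
move=> h r01 B0 hB; have /andP[r0 _] := r01.
have cr t : cmod (r%:C * expi t) <= r by rewrite cmodM cmod_expi mulr1 cmod_real ger0_norm.
have := bessel n.+1 h r01; rewrite big_ord_recr /= => h1.
have p0 : (0 : R) < 2 * pi by rewrite mulr_gt0 // pi_gt0.
have h2 : J (fun t => cmod (f (r%:C * expi t)) ^+ 2) <= 2 * pi * B ^+ 2.
  apply: circle_int_le_cst => [|t _]; last by rewrite lerXn2r ?nnegrE ?cmod_ge0 // hB.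
  apply: (@bounded_integrable _ (B ^+ 2)) => [|t _].
    by apply: measurable_cmod2; exact: psum_cmeasurable h r01.
  by rewrite ger0_norm ?sqr_ge0 // lerXn2r ?nnegrE ?cmod_ge0 // hB.
have := le_trans h1 h2; rewrite ler_pM2l // => h3.
rewrite -(@ler_pXn2r _ 2) ?nnegrE ?mulr_ge0 ?cmod_ge0 ?exprn_ge0 // exprMn -exprM mulnC.
apply: le_trans h3; rewrite lerDr; apply: sumr_ge0 => i _.
by rewrite mulr_ge0 ?sqr_ge0 ?exprn_ge0.
Qed.

Lemma psum_unique (f : R[i] -> R[i]) (c d : nat -> R[i]) : psum f c -> psum f d -> forall n, c n = d n.
Proof.
move=> hc hd n.
have h0 : psum (fun=> 0) (fun n => c n - d n).
  apply: psum_eq (psum_lin (-1) hd hc) => [z _|k]; by rewrite mulN1r addrC subrr || rewrite mulN1r addrC.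
have r01 : 0 <= (2^-1 : R) < 1 by lra.
have := @psum_coef_le _ _ _ 0 n h0 r01 (lexx _) (fun z _ => le_of_eq (cmod0 R)).
rewrite pmulr_lle0 ?exprn_gt0 // => h1; apply/eqP; rewrite -subr_eq0 -cmod_eq0.
by rewrite eq_le h1 cmod_ge0.
Qed.

(** Weierstrass' theorem. Cauchy's estimate on differences makes each coefficient sequence converge,
    with error at most e_K / r^n; on a smaller radius these errors sum to a multiple of e_K. *)
Lemma psum_uniform_limit (F : R[i] -> R[i]) (G : nat -> R[i] -> R[i]) (c : nat -> nat -> R[i]) :
  (forall K, psum (G K) (c K)) ->
  (forall r, 0 <= r < 1 -> exists e : nat -> R, e @ \oo --> (0 : R) /\
     forall K z, cmod z <= r -> cmod (F z - G K z) <= e K) ->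
  exists d, psum F d.
Proof.
move=> hG hF.
have key r e : 0 <= r < 1 -> (forall K z, cmod z <= r -> cmod (F z - G K z) <= e K) ->
    forall K L n, cmod (c K n - c L n) * r ^+ n <= e K + e L.
  move=> r01 he K L n; have /andP[r0 _] := r01.
  have e0 M : 0 <= e M by apply: le_trans (he M 0 _); rewrite ?cmod_ge0 // cmod0.
  apply: (@psum_coef_le (fun z => G K z - G L z) (fun n => c K n - c L n)) => //; last 2 first.
  - by rewrite addr_ge0.
  - move=> z zr; have -> : G K z - G L z = (F z - G L z) - (F z - G K z) by ring.
    by apply: (le_trans (cmodD _ _)); rewrite cmodN addrC lerD // he.
  by apply: psum_eq (psum_lin (-1) (hG L) (hG K)) => [z _|k]; rewrite mulN1r addrC.
have lim n : exists l, ctends (fun K => c K n) l.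
  have h01 : 0 <= (2^-1 : R) < 1 by lra.
  have [e [ecv he]] := hF _ h01; have hk := key _ _ h01 he.
  have e0 M : 0 <= e M by apply: le_trans (he M 0 _); rewrite ?cmod_ge0 // cmod0.
  apply: ctends_cauchy => eps eps0; pose eta := eps / 2 * 2^-1 ^+ n.
  have eta0 : 0 < eta by rewrite mulr_gt0 ?divr_gt0 ?exprn_gt0.
  have [N hN] := (cvg0_eps e0).1 ecv _ eta0; exists N => K L NK NL.
  rewrite -(@ltr_pM2r _ (2^-1 ^+ n)) ?exprn_gt0 //; apply: (le_lt_trans (hk _ _ _)).
  by have := hN _ NK; have := hN _ NL; rewrite /eta; lra.
have /choice[d hd] := lim.
exists d => z hz; have z1 : cmod z < 1 by [].
have z0 := cmod_ge0 z.
pose r := (1 + cmod z) / 2; have r01 : 0 <= r < 1 by rewrite /r; lra.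
have rpos : 0 < r by rewrite /r; lra.
have [e [ecv he]] := hF _ r01; have hk := key _ _ r01 he.
have e0 M : 0 <= e M by apply: le_trans (he M 0 _); rewrite ?cmod_ge0 // cmod0 ltW.
have hd' K n : cmod (c K n - d n) * r ^+ n <= e K.
  have h1 : cmod (c K n - c L n) * r ^+ n - e L @[L --> \oo] --> cmod (c K n - d n) * r ^+ n - 0.
    apply: cvgB => //; apply: cvgM; last exact: cvg_cst.
    by apply: ctends_cmod; apply: ctendsB (hd n); exact: ctends_cst.
  rewrite subr0 in h1; apply: (cvg_le_bound h1 (n0 := 0%N)) => L _.
  by rewrite lerBlDr; exact: hk.
pose q := cmod z / r.
have q01 : 0 <= q < 1 by rewrite /q divr_ge0 ?(ltW rpos) //= ltr_pdivrMr // mul1r /r; lra.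
have /andP[q0 q1] := q01.
have tail K N : cmod (\sum_(n < N) d n * z ^+ n - \sum_(n < N) c K n * z ^+ n) <= e K / (1 - q).
  rewrite -sumrB; apply: (le_trans (cmod_sum _ _ _)).
  apply: le_trans (_ : \sum_(n < N) e K * q ^+ n <= _).
    apply: ler_sum => n _; rewrite -mulrBl cmodM cmodX cmodB.
    rewrite /q expr_div_n mulrA ler_pdivlMr ?exprn_gt0 // mulrAC ler_wpM2r ?exprn_ge0 //.
  by rewrite -mulr_sumr ler_wpM2l // geo_le.
apply/ctends_eps => eps eps0.
(* e_K enters twice: as the distance from F to G_K, and with factor 1/(1 - q) through the
   coefficient errors. *)
pose eta := eps / 2 / (1 + (1 - q)^-1).
have iq : 0 < (1 - q)^-1 by rewrite invr_gt0 subr_gt0.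
have c0 : 0 < 1 + (1 - q)^-1 by lra.
have eta0 : 0 < eta by rewrite !divr_gt0.
have [K hK] := (cvg0_eps e0).1 ecv _ eta0.
have eps2 : 0 < eps / 2 by rewrite divr_gt0.
have [N hN] := (ctends_eps _ _).1 (hG K z hz) _ eps2.
exists N => n nN; have h1 := hN _ nN; have h2 := tail K n; have h3 := he K z (_ : cmod z <= r).
have h4 : e K * (1 + (1 - q)^-1) < eps / 2.
  by rewrite -ltr_pdivlMr //; exact: hK.
have zr : cmod z <= r by rewrite /r; lra.
set S := \sum_(m < n) d m * z ^+ m in h2 *; set S' := \sum_(m < n) c K m * z ^+ m in h1 h2.
have := cmodD (S - S') ((S' - G K z) - (F z - G K z)).
rewrite (_ : S - S' + (S' - G K z - (F z - G K z)) = S - F z); last by ring.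
have := cmodD (S' - G K z) (- (F z - G K z)).
rewrite cmodN; have := h3 zr; rewrite mulrDr mulr1 in h4; lra.
Qed.

(** The partial exponential sums are polynomials in f, and they converge uniformly on |z| <= r
    because f is bounded there. *)
Lemma psum_expC (f : R[i] -> R[i]) (c : nat -> R[i]) : psum f c -> exists d, psum (fun z => expC (f z)) d.
Proof.
move=> h.
have pw k : exists d, psum (fun z => cexp_term (f z) k) d.
  elim: k => [|k [d hd]].
    by eexists; apply: psum_eq (psum_cst 1) => // z _; rewrite /cexp_term expr0 divr1.
  eexists; apply: psum_eq (psum_lin (k.+1%:R^-1) (psum_mul h hd) (psum_cst 0)) => // z _.
  have k0 : (k.+1%:R : R[i]) != 0 by rewrite pnatr_eq0.
  rewrite addr0 /cexp_term exprS factS natrM; field.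
  by rewrite factC_neq0 /= addrC natr1 k0.
have ps K : exists d, psum (fun z => \sum_(k < K) cexp_term (f z) k) d.
  elim: K => [|K [d hd]].
    by eexists; apply: psum_eq (psum_cst 0) => // z _; rewrite big_ord0.
  have [d' hd'] := pw K.
  by eexists; apply: psum_eq (psum_lin 1 hd hd') => // z _; rewrite big_ord_recr mul1r.
have /choice[c' hc'] := ps.
apply: (psum_uniform_limit hc') => r r01.
have [B [B0 _ hB]] := psum_bounded h r01.
exists (fun K => expR B - \sum_(k < K) B ^+ k / k`!%:R); split; last first.
  by move=> K z zr; apply: expC_tail; exact: hB.
rewrite -[X in _ --> X](subrr (expR B)); apply: cvgB; first exact: cvg_cst.
exact: exp_coeff_cvg.
Qed.
End CircleIntegral.

(** * Herglotz integrals and outer functions *)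

Section Herglotz.
Variable R : realType.
Local Notation mu := (@lebesgue_measure R).
Local Notation T := (measurableTypeR R).
Local Notation circle := (`[0, 2 * pi]%classic : set T).
Local Notation J g := (Rintegral mu circle g).
Implicit Types (k l : T -> R) (z w : R[i]) (F G : T -> R[i]).

Definition cintegrable F := mu.-integrable circle (EFin \o (fun t => Re (F t))) /\
  mu.-integrable circle (EFin \o (fun t => Im (F t))).

Lemma pi2_gt0 : 0 < 2 * pi :> R. Proof. by rewrite mulr_gt0 // pi_gt0. Qed.

Lemma integrable_mul (g k : T -> R) (B : R) : measurable_fun circle g -> (forall t, circle t -> `|g t| <= B) ->
  mu.-integrable circle (EFin \o k) -> mu.-integrable circle (EFin \o (fun t => g t * k t)).
Proof.
move=> mg gB ik; have mc : measurable circle := @measurable_circle R.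
have mk : measurable_fun circle k by apply/measurable_EFinP; exact: measurable_int ik.
have := integrableZl mc B ik.
apply: le_integrable => //.
  by apply/measurable_EFinP; exact: measurable_funM.
move=> t ct; rewrite /= lee_fin !normrM ler_wpM2r //.
exact: le_trans (gB t ct) (ler_norm _).
Qed.

Lemma integrable_scale (c : R) (g : T -> R) : mu.-integrable circle (EFin \o g) ->
  mu.-integrable circle (EFin \o (fun t => c * g t)).
Proof. by move=> ig; have := integrableZl (@measurable_circle R) c ig. Qed.

Lemma integrable_add (g h : T -> R) : mu.-integrable circle (EFin \o g) ->
  mu.-integrable circle (EFin \o h) -> mu.-integrable circle (EFin \o (fun t => g t + h t)).
Proof. by move=> ig ih; have := integrableD (@measurable_circle R) ig ih. Qed.

Lemma integrable_dom (g k : T -> R) : measurable_fun circle g -> (forall t, circle t -> `|g t| <= `|k t|) ->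
  mu.-integrable circle (EFin \o k) -> mu.-integrable circle (EFin \o g).
Proof.
move=> mg gk; apply: le_integrable; [exact: measurable_circle|exact/measurable_EFinP|].
by move=> t ct; rewrite /= lee_fin; exact: gk.
Qed.

Lemma cintegrable_mul G k B : cmeasurable G -> (forall t, circle t -> cmod (G t) <= B) ->
  mu.-integrable circle (EFin \o k) -> cintegrable (fun t => G t * (k t)%:C).
Proof.
move=> [m1 m2] GB ik; split.
  under [X in _.-integrable _ (_ \o X)]eq_fun do rewrite cReM /= mulr0 subr0.
  by apply: (@integrable_mul _ _ B) => // t ct; apply: le_trans (Re_le_cmod _) (GB t ct).
under [X in _.-integrable _ (_ \o X)]eq_fun do rewrite cImM /= mulr0 add0r.
by apply: (@integrable_mul _ _ B) => // t ct; apply: le_trans (Im_le_cmod _) (GB t ct).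
Qed.

Lemma cintegrable_scale (c : R[i]) F : cintegrable F -> cintegrable (fun t => c * F t).
Proof.
case: c => a b [f1 f2]; split.
  have := integrable_add (integrable_scale a f1) (integrable_scale (- b) f2).
  by congr (is_true (_.-integrable _ (_ \o _))); apply/funext => t; rewrite cReM mulNr.
have := integrable_add (integrable_scale a f2) (integrable_scale b f1).
by congr (is_true (_.-integrable _ (_ \o _))); apply/funext => t; rewrite cImM.
Qed.

Lemma cint_add F G : cintegrable F -> cintegrable G ->
  cint02pi (fun t => F t + G t) = cint02pi F + cint02pi G.
Proof.
move=> [f1 f2] [g1 g2]; rewrite /cint02pi; simpc; congr Complex.
  by rewrite -circle_int_add //; apply: eq_Rintegral => t _; rewrite ReD.
by rewrite -circle_int_add //; apply: eq_Rintegral => t _; rewrite ImD.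
Qed.

Lemma cint_scale (c : R[i]) F : cintegrable F -> cint02pi (fun t => c * F t) = c * cint02pi F.
Proof.
move=> [f1 f2]; case: c => a b; rewrite /cint02pi; simpc; congr Complex.
  have [i1 i2] := (integrable_scale a f1, integrable_scale b f2).
  by rewrite -!circle_int_scale // -circle_int_sub //; apply: eq_Rintegral => t _; rewrite cReM.
have [i1 i2] := (integrable_scale a f2, integrable_scale b f1).
by rewrite -!circle_int_scale // -circle_int_add //; apply: eq_Rintegral => t _; rewrite cImM.
Qed.

(** The factor 2 comes from treating real and imaginary part separately; it is harmless where the
    bound only has to tend to 0. *)
Lemma cint_mul_le G k B : cmeasurable G -> (forall t, circle t -> cmod (G t) <= B) -> 0 <= B ->
  mu.-integrable circle (EFin \o k) ->
  cmod (cint02pi (fun t => G t * (k t)%:C)) <= 2 * B * J (fun t => `|k t|).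
Proof.
move=> mG GB B0 ik; have [i1 i2] := cintegrable_mul mG GB ik.
have iabs : mu.-integrable circle (EFin \o (fun t => `|k t|)) by exact: integrable_norm.
have bnd t : circle t -> cmod (G t * (k t)%:C) <= B * `|k t|.
  by move=> ct; rewrite cmodM cmod_real ler_wpM2r // GB.
have key (g : T -> R) : mu.-integrable circle (EFin \o g) -> (forall t, circle t -> `|g t| <= B * `|k t|) ->
    `|J g| <= B * J (fun t => `|k t|).
  move=> ig gB; apply: (le_trans (le_normr_Rintegral (@measurable_circle R) ig)).
  rewrite -circle_int_scale //; apply: le_Rintegral => //.
  - exact: integrable_norm.
  - exact: integrable_scale.
apply: (le_trans (cmod_le_ReIm _)); rewrite /cint02pi /=.
have h1 := key _ i1 (fun t ct => le_trans (Re_le_cmod _) (bnd t ct)).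
have h2 := key _ i2 (fun t ct => le_trans (Im_le_cmod _) (bnd t ct)).
by apply: (le_trans (lerD h1 h2)); apply: le_of_eq; ring.
Qed.

Definition herglotz k z := ((2 * pi)^-1)%:C * cint02pi (fun t => (expi t + z) / (expi t - z) * (k t)%:C).

(** The Taylor coefficients in z of the Herglotz kernel (e^(it) + z) / (e^(it) - z); [P] collects
    the partial sums. *)
Let p n (t : R) : R[i] := (if n is 0%N then 1 else 2) * expi (- (n%:R * t)).
Let P N z (t : R) : R[i] := \sum_(n < N) p n t * z ^+ n.

Let p_meas n : cmeasurable (p n).
Proof.
apply: cmeasurableM; first exact: cmeasurable_cst.
by under [X in cmeasurable X]eq_fun do rewrite -mulNr; exact: cmeasurable_expi.
Qed.

Let p_le n t : cmod (p n t) <= 2.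
Proof.
rewrite /p cmodM cmod_expi mulr1; case: n => [|n]; first by rewrite cmod1 ler1n.
by rewrite (natC R 2) cmod_real ger0_norm.
Qed.

Let P_meas N z : cmeasurable (P N z).
Proof.
by apply: cmeasurable_sum => n; apply: cmeasurableM; [exact: p_meas|exact: cmeasurable_cst].
Qed.

Lemma expi_unit_sub z t : cmod z < 1 -> expi t - z != 0.
Proof.
move=> z1; rewrite subr_eq0; apply: contraTneq z1 => <-; by rewrite cmod_expi ltxx.
Qed.

(* With u = z e^{-it} the kernel is (1 + u) / (1 - u) = 1 + 2 (u + u^2 + ...). *)
Let kernel_tail N z t : cmod z < 1 ->
  cmod ((expi t + z) / (expi t - z) - P N z t) <= 2 / (1 - cmod z) * cmod z ^+ N.
Proof.
move=> z1; pose u := z * expi (- t).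
have uz : cmod u = cmod z by rewrite /u cmodM cmod_expi mulr1.
have ee : expi t * expi (- t) = 1 :> R[i] by rewrite -expiD subrr expi0.
have e0 := expi_unit_sub t z1.
have u1 : 1 - u != 0.
  by rewrite subr_eq0; apply: contraTneq z1 => h; rewrite -uz -h cmod1 ltxx.
have -> : (expi t + z) / (expi t - z) = (1 + u) / (1 - u).
  apply/eqP; rewrite eqr_div //; apply/eqP; rewrite /u; apply/eqP; rewrite -subr_eq0; apply/eqP.
  transitivity (2 * z * (1 - expi t * expi (- t))); last by rewrite ee subrr mulr0.
  by ring.
(* N = 0 is set apart because the closed form would give -1 there instead of 0. *)
have PE : P N z t = if N is 0%N then 0 else -1 + 2 * ((1 - u ^+ N) / (1 - u)).
  case: N => [|N]; first by rewrite /P big_ord0.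
  have u1' : u != 1 by rewrite -subr_eq0 -oppr_eq0 opprB.
  rewrite -geo_sum // /P !big_ord_recl /= /p mul0r oppr0 expi0 !expr0 !mulr1 mulrDr mulr1 addrA.
  rewrite (_ : -1 + 2 = 1 :> R[i]); last by ring.
  congr (_ + _); rewrite mulr_sumr; apply: eq_bigr => i _.
  by rewrite /bump /= /u exprMn expiX mulrN -mulrA; congr (_ * _); rewrite mulrC.
have den : 1 - cmod z <= cmod (1 - u).
  by have := cmodD (1 - u) u; rewrite subrK cmod1 uz; lra.
have d0 : 0 < 1 - cmod z by rewrite subr_gt0.
have inv : cmod (1 - u)^-1 <= (1 - cmod z)^-1.
  by rewrite cmodV lef_pV2 // posrE // (lt_le_trans d0).
have c2 : cmod (2 : R[i]) = 2 by rewrite (natC R 2) cmod_real ger0_norm.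
rewrite PE; case: N {PE} => [|N].
  rewrite subr0 expr0 mulr1 cmodM; apply: ler_pM => //; try exact: cmod_ge0.
  by apply: (le_trans (cmodD _ _)); rewrite cmod1 uz; lra.
rewrite (_ : _ - _ = 2 * (u ^+ N.+1 / (1 - u))); last by field.
rewrite cmodM c2 cmodM cmodX uz [leRHS](_ : _ = 2 * (cmod z ^+ N.+1 * (1 - cmod z)^-1)); last by ring.
by apply: ler_wpM2l => //; apply: ler_wpM2l => //; rewrite exprn_ge0 // cmod_ge0.
Qed.

Let kernel_le z t : cmod z < 1 -> cmod ((expi t + z) / (expi t - z)) <= 2 / (1 - cmod z).
Proof. by move=> z1; have := kernel_tail 0 t z1; rewrite /P big_ord0 subr0 expr0 mulr1. Qed.

Let P_le N z t : cmod z < 1 ->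
  cmod (P N z t) <= 2 / (1 - cmod z) + 2 / (1 - cmod z) * cmod z ^+ N.
Proof.
move=> z1; have -> : P N z t = (expi t + z) / (expi t - z) + - ((expi t + z) / (expi t - z) - P N z t) by ring.
apply: (le_trans (cmodD _ _)); rewrite cmodN; apply: lerD; [exact: kernel_le|exact: kernel_tail].
Qed.

Let kernel_meas z : cmod z < 1 -> cmeasurable (fun t => (expi t + z) / (expi t - z)).
Proof.
move=> z1; apply: (@cmeasurable_cvg _ (fun N => P N z)) => [N|t _]; first exact: P_meas.
apply: (@ctends_le _ _ _ (fun N => 2 / (1 - cmod z) * cmod z ^+ N)).
  by move=> N; rewrite cmodB; exact: kernel_tail.
by apply: cvg0_M; apply: cvg_expr0; rewrite cmod_ge0.
Qed.

Let kernel_int z k : cmod z < 1 -> mu.-integrable circle (EFin \o k) ->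
  cintegrable (fun t => (expi t + z) / (expi t - z) * (k t)%:C).
Proof.
by move=> z1; apply: cintegrable_mul; [exact: kernel_meas|move=> t _; exact: kernel_le].
Qed.

Let herglotz_coef k n := ((2 * pi)^-1)%:C * cint02pi (fun t => p n t * (k t)%:C).

(** For fixed z the kernel expansion converges uniformly in t, so it may be integrated term by term
    against an integrable k. *)
Lemma psum_herglotz_coef k : mu.-integrable circle (EFin \o k) -> psum (herglotz k) (herglotz_coef k).
Proof.
move=> ik z hz; have z1 : cmod z < 1 by [].
have ip_ n : cintegrable (fun t => p n t * (k t)%:C).
  by apply: cintegrable_mul ik; [exact: p_meas|move=> t _; exact: p_le].
have iP N : cintegrable (fun t => P N z t * (k t)%:C).
  apply: (@cintegrable_mul _ _ (2 / (1 - cmod z) + 2 / (1 - cmod z) * cmod z ^+ N)) ik => [|t _]; [exact: P_meas|exact: P_le].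
have sumE N : \sum_(n < N) herglotz_coef k n * z ^+ n =
    ((2 * pi)^-1)%:C * cint02pi (fun t => P N z t * (k t)%:C).
  elim: N => [|N IH].
    rewrite big_ord0 /P /cint02pi; under eq_Rintegral do rewrite big_ord0 mul0r /=.
    under [X in Complex _ X]eq_Rintegral do rewrite big_ord0 mul0r /=.
    by rewrite circle_int_cst mulr0 mulr0.
  rewrite big_ord_recr /= IH /herglotz_coef -mulrA -mulrDr; congr (_ * _).
  rewrite [_ * z ^+ N]mulrC -cint_scale // -cint_add //; last exact: cintegrable_scale.
  by congr cint02pi; apply/funext => t; rewrite /P big_ord_recr /= mulrDl; congr (_ + _); ring.
apply: (@ctends_le _ _ _ (fun N => (2 * pi)^-1 * (2 * 2 / (1 - cmod z) * J (fun t => `|k t|)) * cmod z ^+ N)).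
  move=> N; rewrite sumE /herglotz -mulrBr cmodM cmod_real ger0_norm ?invr_ge0 ?(ltW pi2_gt0) //.
  rewrite -mulrA ler_wpM2l ?invr_ge0 ?(ltW pi2_gt0) //.
  have -> : cint02pi (fun t => P N z t * (k t)%:C) - cint02pi (fun t => (expi t + z) / (expi t - z) * (k t)%:C)
      = - cint02pi (fun t => ((expi t + z) / (expi t - z) - P N z t) * (k t)%:C).
    have -> : (fun t : R => ((expi t + z) / (expi t - z) - P N z t) * (k t)%:C) =
        (fun t => (expi t + z) / (expi t - z) * (k t)%:C + -1 * (P N z t * (k t)%:C)).
      by apply/funext => t; ring.
    rewrite cint_add ?cint_scale //; [by ring|exact: kernel_int|exact: cintegrable_scale].
  rewrite cmodN; have := @cint_mul_le (fun t => (expi t + z) / (expi t - z) - P N z t) k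
     (2 / (1 - cmod z) * cmod z ^+ N) _ (fun t _ => kernel_tail N t z1) _ ik.
  move=> h; apply: le_trans (h _ _) _.
  - have := cmeasurableD (kernel_meas z1) (cmeasurableM (cmeasurable_cst (-1)) (P_meas N z)).
    by under [X in cmeasurable X -> _]eq_fun do rewrite mulN1r.
  - by rewrite mulr_ge0 ?exprn_ge0 ?cmod_ge0 // divr_ge0 // subr_ge0 ltW.
  - by apply: le_of_eq; ring.
by apply: cvg0_M; apply: cvg_expr0; rewrite cmod_ge0.
Qed.

(** The real part is the Poisson kernel (1 - |z|^2) / |e^(it) - z|^2. *)
Lemma Re_kernel_ge0 z t : cmod z < 1 -> 0 <= Re ((expi t + z) / (expi t - z)).
Proof.
move=> z1; have e0 := expi_unit_sub t z1.
have n0 : 0 < cmod (expi t - z) ^+ 2 by rewrite exprn_gt0 // lt_neqAle cmod_ge0 eq_sym cmod_eq0 e0.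
have -> : (expi t + z) / (expi t - z) = (expi t + z) * cj (expi t - z) / (cmod (expi t - z) ^+ 2)%:C.
  rewrite cmod_sqrC; set e := expi t - z in e0 *; have e1 : cj e != 0 by rewrite conjc_eq0.
  by field; rewrite e0 e1.
rewrite -fmorphV cReM /= mulr0 subr0 mulr_ge0 ?invr_ge0 ?(ltW n0) //.
have -> : Re ((expi t + z) * cj (expi t - z)) = cmod (expi t : R[i]) ^+ 2 - cmod z ^+ 2.
  by rewrite !cmod_sqr cReM; case: (expi t) z {e0 n0 z1} => x y [x' y'] /=; ring.
by rewrite cmod_expi subr_ge0 expr1n exprn_ile1 ?cmod_ge0 // ltW.
Qed.

Lemma Re_herglotz k z : Re (herglotz k z) =
  (2 * pi)^-1 * J (fun t => Re ((expi t + z) / (expi t - z)) * k t).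
Proof.
rewrite /herglotz /cint02pi cReM /= mul0r subr0; congr (_ * _).
by apply: eq_Rintegral => t _; rewrite cReM /= mulr0 subr0.
Qed.

Lemma Re_herglotz_abs k z : cmod z < 1 -> mu.-integrable circle (EFin \o k) ->
  `|Re (herglotz k z)| <= (2 * pi)^-1 * (2 * (2 / (1 - cmod z)) * J (fun t => `|k t|)).
Proof.
move=> z1 ik; apply: (le_trans (Re_le_cmod _)).
rewrite /herglotz cmodM cmod_real ger0_norm ?invr_ge0 ?(ltW pi2_gt0) // ler_wpM2l ?invr_ge0 ?(ltW pi2_gt0) //.
apply: cint_mul_le ik; [exact: kernel_meas|by move=> t _; exact: kernel_le|].
by rewrite divr_ge0 // subr_ge0 ltW.
Qed.

Lemma herglotz_add k l z : cmod z < 1 -> mu.-integrable circle (EFin \o k) ->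
  mu.-integrable circle (EFin \o l) -> herglotz (fun t => k t + l t) z = herglotz k z + herglotz l z.
Proof.
move=> z1 ik il; rewrite /herglotz -mulrDr -cint_add; [|exact: kernel_int|exact: kernel_int].
by congr (_ * cint02pi _); apply/funext => t; rewrite rmorphD /= mulrDr.
Qed.

(** The Poisson kernel is nonnegative and reproduces constants; the latter is read off from the
    coefficients, of which only the one of index 0 survives for a constant. *)
Lemma Re_herglotz_le k z (M : R) : cmod z < 1 -> mu.-integrable circle (EFin \o k) ->
  (forall t, k t <= M) -> Re (herglotz k z) <= M.
Proof.
move=> z1 ik kM.
have iM : mu.-integrable circle (EFin \o (fun=> M)).
  by apply: (@bounded_integrable _ _ `|M|) => //; exact: measurable_cst.
have -> : M = Re (herglotz (fun=> M) z).
  have h1 := psum_herglotz_coef iM z1; have h2 := psum_cst M%:C z1.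
  rewrite (_ : herglotz (fun=> M) z = M%:C) //; apply: ctends_unique h1 _; apply: eq_ctends h2 => N.
  apply: eq_bigr => n _; congr (_ * _); rewrite /herglotz_coef; case: (n : nat) => [|m].
    have -> : (fun t : R => p 0 t * M%:C) = (fun=> M%:C).
      by apply/funext => t; rewrite /p mul0r oppr0 expi0 !mul1r.
    rewrite /cint02pi /= !circle_int_cst mulr0 -[Complex _ 0]/((2 * pi * M)%:C) -rmorphM /=.
    by rewrite mulKf // gt_eqF // pi2_gt0.
  have ic : mu.-integrable circle (EFin \o (fun t => cos (m.+1%:R * t))).
    apply: (@bounded_integrable _ _ 1) => [|t _]; last by rewrite ler_norml cos_geN1 cos_le1.
    by have [] := cmeasurable_expi (m.+1%:R : R).
  have is_ : mu.-integrable circle (EFin \o (fun t => sin (m.+1%:R * t))).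
    apply: (@bounded_integrable _ _ 1) => [|t _]; last by rewrite ler_norml sin_geN1 sin_le1.
    by have [] := cmeasurable_expi (m.+1%:R : R).
  rewrite (_ : cint02pi _ = 0) ?mulr0 // /cint02pi.
  have E (t : R) : 2 * expi (- (m.+1%:R * t)) * M%:C =
      Complex (2 * M * cos (m.+1%:R * t)) (- (2 * M) * sin (m.+1%:R * t)).
    rewrite (natC R 2) /expi cosN sinN; simpc; congr Complex; ring.
  under eq_Rintegral do rewrite E /=; under [X in Complex _ X]eq_Rintegral do rewrite E /=.
  by rewrite !circle_int_scale // circle_int_cos circle_int_sin !mulr0.
rewrite !Re_herglotz ler_wpM2l ?invr_ge0 ?(ltW pi2_gt0) //.
have Kint (l : T -> R) : mu.-integrable circle (EFin \o l) ->
    mu.-integrable circle (EFin \o (fun t => Re ((expi t + z) / (expi t - z)) * l t)).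
  apply: (@integrable_mul _ _ (2 / (1 - cmod z))); first by have [] := kernel_meas z1.
  by move=> t _; apply: le_trans (Re_le_cmod _) (kernel_le t z1).
apply: le_Rintegral; [exact: measurable_circle|exact: Kint|exact: Kint|].
by move=> t _; rewrite ler_wpM2l // Re_kernel_ge0.
Qed.

Lemma outer_psum (a : R[i] -> R[i]) : outer a -> exists c, psum a c.
Proof.
move=> [k [c [c1 ik ha]]]; have [d hd] := psum_expC (psum_herglotz_coef ik).
exists (fun n => c * d n + 0); apply: psum_eq (psum_lin c hd (_ : psum (fun=> 0) (fun=> 0))) => //.
  by move=> z hz; rewrite addr0 ha.
by move=> z hz; apply: eq_ctends (ctends_cst 0) => N; rewrite big1 // => i _; rewrite mul0r.
Qed.

(* f_m = exp(- H[max(k, -m)]) for log|a| = k: the truncation keeps f_m bounded, while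
   a f_m = c exp(H[min(k + m, 0)]) is bounded by 1 and tends to a unimodular constant. *)
Lemma outer_inverse (a : R[i] -> R[i]) : outer a -> exists f : nat -> R[i] -> R[i],
  [/\ forall m, exists d, psum (f m) d,
      forall m z, disk z -> cmod (f m z) <= expR m%:R,
      forall m z, disk z -> cmod (a z * f m z) <= 1,
      forall m z, disk z -> a z * f m z != 0 &
      forall z, disk z -> cmod (a z * f m z) @[m --> \oo] --> (1 : R)].
Proof.
move=> [k [c [c1 ik ha]]].
have mk : measurable_fun circle k by apply/measurable_EFinP; exact: measurable_int ik.
pose kM (m : nat) (t : T) := Num.max (k t) (- m%:R).
pose km (m : nat) (t : T) := Num.min (k t + m%:R) 0.
have mkM m : measurable_fun circle (kM m).
  by apply: measurable_maxr => //; exact: measurable_cst.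
have mkm m : measurable_fun circle (km m).
  apply: measurable_minr; last exact: measurable_cst.
  by apply: measurable_funD => //; exact: measurable_cst.
have absM m t : `|kM m t| <= `|k t|.
  rewrite /kM; have m0 : 0 <= m%:R :> R by []; case: (leP (k t) (- m%:R)) => h //.
  by rewrite ler0_norm ?oppr_le0 // opprK ler0_norm; lra.
have absm m t : `|km m t| <= `|k t|.
  rewrite /km; have m0 : 0 <= m%:R :> R by []; case: (leP (k t + m%:R) 0) => h; last by rewrite normr0.
  by rewrite !ler0_norm; lra.
have iM m : mu.-integrable circle (EFin \o kM m) by apply: integrable_dom ik => // t _.
have im m : mu.-integrable circle (EFin \o km m) by apply: integrable_dom ik => // t _.
have iN m : mu.-integrable circle (EFin \o (fun t => - kM m t)).
  by under [X in _.-integrable _ (_ \o X)]eq_fun do rewrite -mulN1r; exact: integrable_scale.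
pose f (m : nat) z := expC (herglotz (fun t => - kM m t) z).
(* The exponents match because k - max(k, -m) = min(k + m, 0). *)
have af m z : disk z -> a z * f m z = c * expC (herglotz (km m) z).
  move=> hz; rewrite ha // -/(herglotz k z) /f -mulrA -expCD -herglotz_add //.
  congr (_ * expC (herglotz _ z)); apply/funext => t; rewrite /kM /km.
  by case: (leP (k t) (- m%:R)) => h1; case: (leP (k t + m%:R) 0) => h2; lra.
have afn m z : disk z -> cmod (a z * f m z) = expR (Re (herglotz (km m) z)).
  by move=> hz; rewrite af // cmodM c1 mul1r cmod_expC.
exists f; split.
- by move=> m; apply: psum_expC; exact: psum_herglotz_coef (iN m).
- move=> m z hz; rewrite /f cmod_expC ler_expR; apply: Re_herglotz_le => // t.
  by rewrite /kM lerNl le_max lexx orbT.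
- move=> m z hz; rewrite afn // expR_le1; apply: Re_herglotz_le => // t.
  by rewrite /km ge_min lexx orbT.
- by move=> m z hz; rewrite -cmod_eq0 afn // expR_eq0.
move=> z hz.
(* Dominated by |k|; at each t the function [km m] vanishes once m exceeds |k t|. *)
have J0 : J (fun t => `|km m t|) @[m --> \oo] --> (0 : R).
  have [] := @dominated_convergence _ T R mu circle (@measurable_circle R)
    (fun m t => (`|km m t|)%:E) (fun=> 0%E) (fun t => (`|k t|)%:E).
  - by move=> m; apply/measurable_EFinP; exact: measurableT_comp.
  - exact: measurable_cst.
  - apply: aeW => t _; apply/cvg_EFin; first by apply: nearW => n.
    have [n hn] : exists n : nat, `|k t| < n%:R by exists (Num.bound (`|k t|)); exact: archi_boundP.
    apply: cvg_near_cst; exists n => // m /= nm.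
    rewrite /km (_ : Num.min _ _ = 0) ?normr0 //; apply: min_r.
    have : (n%:R : R) <= m%:R by rewrite ler_nat.
    by have := ler_norm (- k t); rewrite normrN; lra.
  - exact: integrable_norm.
  - by apply: aeW => t m _; rewrite /= lee_fin normr_id.
  move=> _ _; rewrite integral0 => h.
  by have /fine_cvg := h; apply: cvg_trans; apply: near_eq_cvg; apply: nearW => n.
have R0 : Re (herglotz (km m) z) @[m --> \oo] --> (0 : R).
  apply: norm_cvg0; apply: (@cvg0_le _ _ (fun m => (2 * pi)^-1 * (2 * (2 / (1 - cmod z))) * J (fun t => `|km m t|))).
    by move=> m; rewrite normr_ge0 /= -mulrA; exact: Re_herglotz_abs.
  exact: cvg0_M.
rewrite -(expR0 R); under eq_fun do rewrite afn //.
by apply: (cvg_comp _ _ R0); exact: continuous_expR.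
Qed.
End Herglotz.

(** * The Pythagorean identity *)

Section Pythagorean.
Variable R : realType.
Local Notation mu := (@lebesgue_measure R).
Local Notation T := (measurableTypeR R).
Local Notation circle := (`[0, 2 * pi]%classic : set T).
Local Notation J g := (Rintegral mu circle g).
Implicit Types (a b f : R[i] -> R[i]) (c d : nat -> R[i]).

(** A fixed sequence of radii tending to 1, which turns radial limits into the sequential limits of
    bounded convergence. *)
Let rad (j : nat) : R := 1 - j.+2%:R^-1.

Let rad01 j : 0 <= rad j < 1.
Proof.
have h : 0 < (j.+2%:R : R)^-1 <= 2^-1.
  by rewrite invr_gt0 ltr0n /= lef_pV2 ?posrE ?ltr0n // ler_nat.
move: h => /andP[]; rewrite /rad; set y := (_)^-1 => h1 h2; lra.
Qed.

Let rad_cvg : rad @ \oo --> (1 : R).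
Proof.
rewrite -[X in _ --> X]subr0; apply: cvgB; first exact: cvg_cst.
by have := @cvg_harmonic R; rewrite -(cvg_shiftS _ _) /harmonic => h; exact: h.
Qed.

Let radial_sq f t l : radial_limit f t l ->
  cmod (f ((rad j)%:C * expi t)) ^+ 2 @[j --> \oo] --> cmod l ^+ 2.
Proof.
move=> /cvgC_cmod h.
have /cvg_at_leftP h1 := h.
have h2 : ctends (fun j => f ((rad j)%:C * expi t)) l.
  by apply: h1; split => [n|]; [have /andP[] := rad01 n|exact: rad_cvg].
have h3 := ctends_cmod h2.
by under eq_fun do rewrite expr2; rewrite expr2; exact: cvgM.
Qed.

Let pyth_rad a b : pythagorean_ae a b -> {ae mu, forall t, circle t ->
  cmod (a ((rad j)%:C * expi t)) ^+ 2 + cmod (b ((rad j)%:C * expi t)) ^+ 2 @[j --> \oo] --> (1 : R)}.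
Proof.
case=> A [mA A0 sA]; exists A; split => //; apply: subset_trans sA; apply: subsetC => t h ct.
by have [la [lb [h1 h2 <-]]] := h ct; apply: cvgD; exact: radial_sq.
Qed.

Let cvg_max0 (u : nat -> R) : u @ \oo --> (0 : R) -> Num.max (u n) 0 @[n --> \oo] --> (0 : R).
Proof.
move=> h; apply: (@cvg0_le _ _ (fun n => `|u n|)).
  by move=> n; rewrite le_max lexx orbT ge_max ler_norm normr_ge0.
by rewrite -(normr0 R); exact: cvg_norm.
Qed.

Lemma psum_at0 f c : psum f c -> f 0 = c 0%N.
Proof.
move=> h; have d0 : disk (0 : R[i]) by change (cmod (0 : R[i]) < 1); rewrite cmod0.
apply: (ctends_unique (h 0 d0)); rewrite /ctends -(cvg_shiftS _ _).
have -> : [sequence cmod (\sum_(n < n0.+1) c n * 0 ^+ n - c 0%N)]_n0 = (fun=> 0).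
  apply/funext => n; rewrite /= big_ord_recl expr0 mulr1 big1 ?addr0 ?subrr ?cmod0 // => i _.
  by rewrite exprS mul0r mulr0.
exact: cvg_cst.
Qed.

Let sq_le (x : R[i]) (B : R) : cmod x <= B -> cmod x ^+ 2 <= B ^+ 2.
Proof. by move=> h; rewrite lerXn2r ?nnegrE ?cmod_ge0 // (le_trans (cmod_ge0 x)). Qed.

Let cmod2_int (G : T -> R[i]) B : cmeasurable G -> (forall t, circle t -> cmod (G t) <= B) ->
  mu.-integrable circle (EFin \o (fun t => cmod (G t) ^+ 2)).
Proof.
move=> mG GB; apply: (@bounded_integrable _ _ (B ^+ 2)) => [|t ct]; first exact: measurable_cmod2.
by rewrite ger0_norm ?sqr_ge0 // sq_le // GB.
Qed.

Let cvg_radX (x : R) n : x * rad j ^+ n @[j --> \oo] --> x.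
Proof.
have h : rad j ^+ n @[j --> \oo] --> (1 : R).
  elim: n => [|n IH]; first by under eq_fun do rewrite expr0; exact: cvg_cst.
  under eq_fun do rewrite exprS.
  have := cvgM rad_cvg IH; rewrite mulr1 => h; exact: h.
by rewrite -[X in _ --> X]mulr1; apply: cvgM => //; exact: cvg_cst.
Qed.

Let cvg_radsum c N : \sum_(n < N) cmod (c n) ^+ 2 * rad j ^+ (2 * n) @[j --> \oo] -->
  \sum_(n < N) cmod (c n) ^+ 2.
Proof.
elim: N => [|N IH].
  by under eq_fun do rewrite big_ord0; rewrite big_ord0; exact: cvg_cst.
under eq_fun do rewrite big_ord_recr /=; rewrite big_ord_recr /=.
by apply: cvgD => //; exact: cvg_radX.
Qed.

(** Let g = a f_0, where |f_0| <= 1. Then |g| <= |a|, so |g|^2 + |b|^2 is asymptotically at most 1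
    at the boundary, and Bessel gives |g(0)|^2 + sum |b_n|^2 <= 1. As g has no zero, [eta] =
    |g(0)|^2 is positive. Unlike a, g comes with the bound 1 inside the disk. *)
Lemma sum_cmod2_lt1 a b ca cb : psum a ca -> psum b cb -> outer a ->
  (forall z, disk z -> cmod (b z) <= 1) -> pythagorean_ae a b ->
  exists eta : R, 0 < eta /\ forall N, \sum_(n < N) cmod (cb n) ^+ 2 <= 1 - eta.
Proof.
move=> ha hb oa b1 /pyth_rad pab.
have [f [hf f1 af1 af0 _]] := outer_inverse oa; have [cf hcf] := hf 0%N.
have hg := psum_mul ha hcf; set g := (fun z => a z * f 0%N z) in hg.
have d0 : disk (0 : R[i]) by change (cmod (0 : R[i]) < 1); rewrite cmod0.
pose eta := cmod (g 0) ^+ 2.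
have eta0 : 0 < eta by rewrite exprn_gt0 // lt_neqAle cmod_ge0 eq_sym cmod_eq0 af0.
exists eta; split => // N; rewrite lerBrDr.
(* The excess over 1 on the circle of radius [rad j]: bounded by 1, and tending to 0 almost
   everywhere. *)
pose G j t := Num.max (cmod (g ((rad j)%:C * expi t)) ^+ 2 + cmod (b ((rad j)%:C * expi t)) ^+ 2 - 1) 0.
have dr j t := disk_circle t (rad01 j).
have mg j := psum_cmeasurable hg (rad01 j).
have mb j := psum_cmeasurable hb (rad01 j).
have mG j : measurable_fun circle (G j).
  apply: measurable_maxr; last exact: measurable_cst.
  apply: measurable_funB; last exact: measurable_cst.
  by apply: measurable_funD; exact: measurable_cmod2.
have s1 x : cmod x <= 1 -> cmod x ^+ 2 <= 1 :> R by move=> /sq_le; rewrite expr1n.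
have GB j t : circle t -> `|G j t| <= 1.
  move=> _; rewrite ger0_norm ?le_max ?lexx ?orbT // ge_max ler01 andbT.
  by have := s1 _ (af1 0%N _ (dr j t)); have := s1 _ (b1 _ (dr j t)); rewrite /g; lra.
have G0 : {ae mu, forall t, circle t -> G n t @[n --> \oo] --> (0 : R)}.
  apply: filterS pab => t h ct; have h1 := h ct.
  apply: (@cvg0_le _ _ (fun j => Num.max (cmod (a ((rad j)%:C * expi t)) ^+ 2 + cmod (b ((rad j)%:C * expi t)) ^+ 2 - 1) 0)).
    move=> n; rewrite le_max lexx orbT /=; apply: le_max2 => //; rewrite lerD2r lerD2r.
    rewrite /g cmodM exprMn ler_piMr ?sqr_ge0 // s1 //.
    by have := f1 0%N _ (dr n t); rewrite expR0.
  apply: cvg_max0; rewrite -[X in _ --> X](subrr 1); apply: cvgB => //; exact: cvg_cst.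
have JG := bounded_convergence mG GB G0.
have key j : 2 * pi * (eta + \sum_(n < N) cmod (cb n) ^+ 2 * rad j ^+ (2 * n)) <= 2 * pi * 1 + J (G j).
  have h1 := bessel 1 hg (rad01 j); rewrite big_ord1 mulr1 -(psum_at0 hg) in h1.
  have h2 := bessel N hb (rad01 j).
  have ig := cmod2_int (mg j) (fun t _ => af1 0%N _ (dr j t)).
  have ib := cmod2_int (mb j) (fun t _ => b1 _ (dr j t)).
  have iG : mu.-integrable circle (EFin \o G j) by apply: bounded_integrable (mG j) (GB j).
  have i1 : mu.-integrable circle (EFin \o (fun=> 1 : R)).
    by apply: (@bounded_integrable _ _ 1) => [|t _]; [exact: measurable_cst|rewrite normr1].
  rewrite mulrDr; apply: (le_trans (lerD h1 h2)); rewrite -circle_int_add // -(circle_int_cst (1 : R)) -circle_int_add //.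
  apply: le_Rintegral; [exact: measurable_circle|exact: integrable_add|exact: integrable_add|].
  by move=> t _; rewrite -lerBlDl le_max lexx.
have c1 : 2 * pi * (eta + \sum_(n < N) cmod (cb n) ^+ 2 * rad j ^+ (2 * n)) - J (G j) @[j --> \oo] -->
    2 * pi * (eta + \sum_(n < N) cmod (cb n) ^+ 2) - 0.
  apply: cvgB => //; apply: cvgM; first exact: cvg_cst.
  by apply: cvgD; [exact: cvg_cst|exact: cvg_radsum].
have := cvg_le_bound c1 (n0 := 0%N) (fun j _ => _ : _ <= 2 * pi * 1).
rewrite subr0 ler_pM2l ?pi2_gt0 // addrC; apply.
by move=> j; rewrite lerBlDr; exact: key.
Qed.

(** On the boundary ||f||^2 - ||b f||^2 = ||a f||^2 <= ||k_w||^2 = 1 / (1 - |w|^2). With sums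
    truncated at N, the error [e] N is the part of ||b f||^2 beyond N. *)
Lemma pythagorean_defect a b f ca cb cf (B : R) (w : R[i]) :
  psum a ca -> psum b cb -> psum f cf -> (forall z, disk z -> cmod (f z) <= B) ->
  (forall z, disk z -> cmod (b z) <= 1) -> pythagorean_ae a b -> disk w ->
  (forall z, disk z -> cmod (a z * f z) <= cmod (1 - z * cj w)^-1) ->
  exists e : nat -> R, [/\ e @ \oo --> (0 : R), forall N, 0 <= e N & forall N,
    \sum_(n < N) cmod (cf n) ^+ 2 - \sum_(n < N) cmod (cauchy_prod cb cf n) ^+ 2 <= (1 - cmod w ^+ 2)^-1 + e N].
Proof.
move=> ha hb hf fB b1 /pyth_rad pab hw afk.
have w1 : cmod w < 1 by [].
have dr j t := disk_circle t (rad01 j).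
have hx := psum_mul hb hf; have hg := psum_mul ha hf; have hk := psum_szego hw.
have B0 : 0 <= B by apply: le_trans (cmod_ge0 _) (fB 0 _); change (cmod (0 : R[i]) < 1); rewrite cmod0.
have xB z : disk z -> cmod (b z * f z) <= B.
  move=> hz; rewrite cmodM -[leRHS]mul1r; apply: ler_pM; rewrite ?cmod_ge0 //; [exact: b1|exact: fB].
have mono c : {homo (fun N => \sum_(n < N) cmod (c n) ^+ 2) : m n / (m <= n)%N >-> m <= n}.
  move=> m n /subnKC <-; rewrite big_split_ord /= lerDl; apply: sumr_ge0 => i _; exact: sqr_ge0.
have bnd g c N : psum g c -> (forall z, disk z -> cmod (g z) <= B) -> \sum_(n < N) cmod (c n) ^+ 2 <= B ^+ 2.
  move=> hgc gB; apply: (cvg_le_bound (@cvg_radsum c N) (n0 := 0%N)) => j _.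
  rewrite -(ler_pM2l (pi2_gt0 R)); apply: (le_trans (bessel N hgc (rad01 j))).
  apply: circle_int_le_cst => [|t _]; last by apply: sq_le; exact: gB.
  exact: cmod2_int (psum_cmeasurable hgc (rad01 j)) (fun t _ => gB _ (dr j t)).
pose X N := \sum_(n < N) cmod (cauchy_prod cb cf n) ^+ 2.
have cX : cvgn X.
  apply: nondecreasing_is_cvgn; first by move=> m n; exact: mono.
  by exists (B ^+ 2) => _ [n _ <-]; exact: bnd hx xB.
have XX N : X N <= limn X by apply: nondecreasing_cvgn_le => //; move=> m n; exact: mono.
(* Here |f|^2 <= |b f|^2 + |a f|^2 + G on the circle. The cut at 0 keeps G between 0 and B^2, with
   no bound on [a] entering. *)
pose G j t := cmod (f ((rad j)%:C * expi t)) ^+ 2 *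
  Num.max (1 - (cmod (a ((rad j)%:C * expi t)) ^+ 2 + cmod (b ((rad j)%:C * expi t)) ^+ 2)) 0.
have mf j := psum_cmeasurable hf (rad01 j).
have ma j := psum_cmeasurable ha (rad01 j).
have mb j := psum_cmeasurable hb (rad01 j).
have mG j : measurable_fun circle (G j).
  apply: measurable_funM; first exact: measurable_cmod2.
  apply: measurable_maxr; last exact: measurable_cst.
  apply: measurable_funB; first exact: measurable_cst.
  by apply: measurable_funD; exact: measurable_cmod2.
have mx0 j t : 0 <= Num.max (1 - (cmod (a ((rad j)%:C * expi t)) ^+ 2 + cmod (b ((rad j)%:C * expi t)) ^+ 2)) 0 <= 1.
  rewrite le_max lexx orbT /= ge_max ler01 andbT.
  by have := sqr_ge0 (cmod (a ((rad j)%:C * expi t))); have := sqr_ge0 (cmod (b ((rad j)%:C * expi t))); lra.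
have GB j t : circle t -> `|G j t| <= B ^+ 2.
  move=> _; have /andP[h1 h2] := mx0 j t.
  have G1 : 0 <= G j t by rewrite mulr_ge0 ?sqr_ge0.
  rewrite ger0_norm // /G -[leRHS]mulr1; apply: ler_pM => //; first exact: sqr_ge0.
  by apply: sq_le; exact: fB.
have G0 : {ae mu, forall t, circle t -> G n t @[n --> \oo] --> (0 : R)}.
  apply: filterS pab => t h ct; have h1 := h ct.
  apply: (@cvg0_le _ _ (fun j => B ^+ 2 * Num.max (1 - (cmod (a ((rad j)%:C * expi t)) ^+ 2 + cmod (b ((rad j)%:C * expi t)) ^+ 2)) 0)).
    move=> n; have /andP[h2 _] := mx0 n t; rewrite mulr_ge0 ?sqr_ge0 //=.
    by apply: ler_wpM2r => //; apply: sq_le; exact: fB.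
  apply: cvg0_M; apply: cvg_max0; rewrite -[X in _ --> X](subrr 1); apply: cvgB => //; exact: cvg_cst.
have JG := bounded_convergence mG GB G0.
have key N j : 2 * pi * \sum_(n < N) cmod (cf n) ^+ 2 * rad j ^+ (2 * n) <=
    2 * pi * limn X + 2 * pi * (1 - cmod w ^+ 2)^-1 + J (G j).
  have h1 := bessel N hf (rad01 j).
  have /andP[r0 r1] := rad01 j.
  have rX n : rad j ^+ n <= 1 by rewrite exprn_ile1 // ltW.
  have ix := cmod2_int (psum_cmeasurable hx (rad01 j)) (fun t _ => xB _ (dr j t)).
  have iff := cmod2_int (mf j) (fun t _ => fB _ (dr j t)).
  have [Bk [_ _ hBk]] := psum_bounded hk (rad01 j).
  have cr t : cmod ((rad j)%:C * expi t) <= rad j by rewrite cmodM cmod_expi mulr1 cmod_real ger0_norm.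
  have ik := cmod2_int (psum_cmeasurable hk (rad01 j)) (fun t _ => hBk _ (cr t)).
  have ig : mu.-integrable circle (EFin \o (fun t => cmod (a ((rad j)%:C * expi t) * f ((rad j)%:C * expi t)) ^+ 2)).
    by apply: (cmod2_int (psum_cmeasurable hg (rad01 j)) (B := Bk)) => t _; apply: le_trans (afk _ (dr j t)) (hBk _ (cr t)).
  have iG : mu.-integrable circle (EFin \o G j) by apply: bounded_integrable (mG j) (GB j).
  have h2 : J (fun t => cmod (b ((rad j)%:C * expi t) * f ((rad j)%:C * expi t)) ^+ 2) <= 2 * pi * limn X.
    apply: (cvg_le_bound (parseval hx (rad01 j)) (n0 := 0%N)) => M _.
    rewrite ler_wpM2l ?(ltW (pi2_gt0 R)) //; apply: le_trans (XX M); apply: ler_sum => n _.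
    by rewrite ler_piMr ?sqr_ge0.
  have h3 : J (fun t => cmod (a ((rad j)%:C * expi t) * f ((rad j)%:C * expi t)) ^+ 2) <= 2 * pi * (1 - cmod w ^+ 2)^-1.
    apply: (@le_trans _ _ (J (fun t => cmod (1 - (rad j)%:C * expi t * cj w)^-1 ^+ 2))).
      apply: le_Rintegral => //.
      by move=> t _; apply: sq_le; exact: afk.
    apply: (cvg_le_bound (parseval hk (rad01 j)) (n0 := 0%N)) => M _.
    rewrite ler_wpM2l ?(ltW (pi2_gt0 R)) //.
    apply: le_trans (geo_le M (_ : 0 <= cmod w ^+ 2 < 1)); last first.
      by rewrite sqr_ge0 exprn_ilt1 // cmod_ge0.
    by apply: ler_sum => n _; rewrite cmodX cmodJ -!exprM mulnC ler_piMr ?exprn_ge0 ?cmod_ge0.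
  apply: (le_trans h1); apply: le_trans (lerD (lerD h2 h3) (lexx (J (G j)))).
  rewrite -circle_int_add // -circle_int_add //; last exact: integrable_add.
  apply: le_Rintegral => //.
    by apply: integrable_add => //; exact: integrable_add.
  move=> t _; rewrite /G !cmodM !exprMn.
  set F := cmod (f _) ^+ 2; set Aa := cmod (a _) ^+ 2; set Bb := cmod (b _) ^+ 2.
  have F0 : 0 <= F by exact: sqr_ge0.
  have h4 : F * (1 - (Aa + Bb)) <= F * Num.max (1 - (Aa + Bb)) 0 by rewrite ler_wpM2l // le_max lexx.
  lra.
have main N : \sum_(n < N) cmod (cf n) ^+ 2 <= limn X + (1 - cmod w ^+ 2)^-1.
  have c1 : 2 * pi * (\sum_(n < N) cmod (cf n) ^+ 2 * rad j ^+ (2 * n)) - J (G j) @[j --> \oo] -->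
      2 * pi * (\sum_(n < N) cmod (cf n) ^+ 2) - 0.
    by apply: cvgB => //; apply: cvgM; [exact: cvg_cst|exact: cvg_radsum].
  have := cvg_le_bound c1 (n0 := 0%N) (fun j _ => _ : _ <= 2 * pi * (limn X + (1 - cmod w ^+ 2)^-1)).
  rewrite subr0 ler_pM2l ?pi2_gt0 //; apply.
  by move=> j; rewrite lerBlDr (mulrDr (2 * pi)); exact: key.
exists (fun N => limn X - X N); split.
- by rewrite -[X in _ --> X](subrr (limn X)); apply: cvgB => //; exact: cvg_cst.
- by move=> N; rewrite subr_ge0.
- by move=> N; have := main N; rewrite -/(X N); lra.
Qed.
End Pythagorean.

(** * The Gram matrix of the coefficient functionals *)

Section CoefficientGram.
Variables (R : realType).
Local Notation C := (R[i] : numFieldType).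

Lemma psum_poly (c : nat -> R[i]) M :
  psum (fun z => \sum_(j < M) c j * z ^+ j) (fun n => if (n < M)%N then c n else 0).
Proof.
move=> z hz.
have E K : \sum_(n < M + K) (if (n < M)%N then c n else 0) * z ^+ n = \sum_(j < M) c j * z ^+ j.
  rewrite big_split_ord /= [X in _ + X]big1 ?addr0; last first.
    by move=> i _; rewrite ltnNge leq_addr mul0r.
  by apply: eq_bigr => i _; rewrite ltn_ord.
apply/ctends_eps => e e0; exists M => n nM.
by rewrite -(subnKC nM) E subrr cmod0.
Qed.

Lemma cauchy_prod1 (c : nat -> R[i]) (m : nat) :
  cauchy_prod (fun n => if n is 0%N then 1 else 0) c m = c m.
Proof.
rewrite /cauchy_prod big_ord_recl /= mul1r subn0 big1 ?addr0 // => i _; by rewrite mul0r.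
Qed.

Variables (b : C -> C) (V : lmodType C) (ip : V -> V -> C) (ev : V -> C -> C) (kv : C -> V).
Hypothesis ipL : forall (c : C) (u v w : V), ip (c *: u + v) w = c * ip u w + ip v w.
Hypothesis ipJ : forall u v : V, ip v u = cj (ip u v).
Hypothesis ip_ge0 : forall u : V, 0 <= ip u u.
Hypothesis ip_def : forall u : V, ip u u = 0 -> u = 0.
Hypothesis ev_kv : forall w z, disk w -> disk z -> ev (kv w) z = (1 - b z * cj (b w)) / (1 - z * cj w).
Hypothesis ip_kv : forall w (u : V), disk w -> ip u (kv w) = ev u w.
Variable e : nat -> V.
Hypothesis ev_psum : forall h, psum (ev h) (fun n => ip h (e n)).
Local Notation N := (ip_norm ip).

Lemma szego_neq0 (w z : R[i]) : disk w -> disk z -> 1 - z * cj w != 0.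
Proof.
move=> hw hz; have := disk_mulJ hw hz; rewrite subr_eq0 eq_sym.
by apply: contraTneq => ->; rewrite cmod1 ltxx.
Qed.

(* b is recovered from the single kernel function K_w, for any w with b(w) <> 0. *)
Lemma dBR_psum : exists c, psum b c.
Proof.
have [[w hw bw]|b0] := pselect (exists2 w, disk w & b w != 0); last first.
  exists (fun n => if n is 0%N then 0 else 0); apply: psum_eq (psum_cst 0) => // z hz.
  by apply/esym/eqP; apply: contrapT => /negP h; apply: b0; exists z.
have h1 := psum_lin (- cj w) (@psum_X R) (psum_cst 1).
have h2 := psum_lin (- (cj (b w))^-1) (psum_mul h1 (ev_psum (kv w))) (psum_cst (cj (b w))^-1).
eexists; apply: psum_eq h2 => // z hz; rewrite ev_kv //.
have d0 := szego_neq0 hw hz; have b1 : cj (b w) != 0 by rewrite conjc_eq0.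
rewrite (_ : - cj w * z + 1 = 1 - z * cj w); last by ring.
by field; rewrite d0 b1.
Qed.

Variable cb : nat -> R[i].
Hypothesis b_psum : psum b cb.

(** The lower triangular matrix of multiplication by b in the monomial basis. *)
Let beta m k : R[i] := if (k <= m)%N then cb (m - k)%N else 0.

(** e_m(w) is the conjugate of the m-th Taylor coefficient of K_w, and K_w = (1 - conj(b(w)) b) k_w
    makes that coefficient a Cauchy product. *)
Lemma ev_coef_vector m w : disk w -> ev (e m) w = w ^+ m - b w * \sum_(k < m.+1) cj (cb k) * w ^+ (m - k).
Proof.
move=> hw.
have h1 := psum_lin (- cj (b w)) b_psum (psum_cst 1).
have h2 := psum_mul h1 (psum_szego hw).
have h3 : psum (ev (kv w)) (cauchy_prod (fun n => - cj (b w) * cb n + (if n is 0%N then 1 else 0)) (fun n => cj w ^+ n)).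
  by apply: psum_eq h2 => // z hz; rewrite ev_kv //; congr (_ / _); ring.
have h4 := psum_unique (ev_psum (kv w)) h3 m.
rewrite -ip_kv // ipJ h4 /cauchy_prod.
under eq_bigr do rewrite mulrDl.
rewrite big_split /= (_ : \sum_(i < m.+1) (if i : nat is 0%N then 1 else 0) * cj w ^+ (m - i) = cj w ^+ m); last first.
  exact: (cauchy_prod1 (fun n => cj w ^+ n)).
rewrite rmorphD /= rmorphXn /= conjcK addrC; congr (_ + _).
rewrite rmorph_sum /= mulr_sumr -sumrN; apply: eq_bigr => k _.
by rewrite !rmorphM rmorphN rmorphXn /= !conjcK; ring.
Qed.

(** <e_m, e_n> is the n-th Taylor coefficient of e_m. The result is an entry of 1 - T_b T_b^* up to
    the index convention; since T_b is triangular, cutting the sum at any M above m and n is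
    exact. *)
Lemma gram_coef m n M : (m < M)%N -> (n < M)%N ->
  ip (e m) (e n) = (n == m)%:R - \sum_(k < M) cj (beta m k) * beta n k.
Proof.
move=> mM nM.
pose q j := if (j < m.+1)%N then cj (cb (m - j)%N) else 0.
have h1 : psum (fun z => \sum_(k < m.+1) cj (cb k) * z ^+ (m - k)) q.
  apply: psum_eq (psum_poly (fun j => cj (cb (m - j)%N)) m.+1) => // z _.
  rewrite (reindex_inj rev_ord_inj) /=; apply: eq_bigr => k _.
  by rewrite subSS subKn // -ltnS.
have h0 : psum (fun z : R[i] => z ^+ m) (fun n => (n == m)%:R).
  apply: psum_eq (psum_poly (fun j => (j == m)%:R) m.+1) => [z _|k].
    rewrite (bigD1 ord_max) //= eqxx mul1r big1 ?addr0 // => i hi.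
    rewrite (_ : (i == m :> nat) = false) ?mul0r //; apply/negbTE; apply: contra hi => /eqP im.
    by apply/eqP/val_inj.
  by have [->|km] := eqVneq k m; rewrite ?ltnSn //; case: ifP.
have h2 := psum_lin (-1) (psum_mul b_psum h1) h0.
have h3 : psum (ev (e m)) (fun n => -1 * cauchy_prod cb q n + (n == m)%:R).
  by apply: psum_eq h2 => // z hz; rewrite ev_coef_vector //; ring.
rewrite (psum_unique (ev_psum (e m)) h3 n) addrC mulN1r; congr (_ - _).
rewrite -(big_mkord xpredT (fun k => cj (beta m k) * beta n k)) (@big_cat_nat _ _ _ n.+1) //=.
rewrite [X in _ + X]big_nat_cond [X in _ + X]big1 ?addr0; last first.
  by move=> i /andP[/andP[ni _] _]; rewrite /beta [(i <= n)%N]leqNgt ni mulr0.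
rewrite big_mkord /cauchy_prod (reindex_inj rev_ord_inj) /=; apply: eq_bigr => k _.
have kn : (k <= n)%N by rewrite -ltnS.
rewrite subSS subKn // /beta kn /q ltnS mulrC; by case: ifP; rewrite ?conjc0.
Qed.

Lemma norm_coef_vector n : N (e n) ^+ 2 = 1 - \sum_(k < n.+1) cmod (cb k) ^+ 2.
Proof.
apply: (@complexI R); rewrite -(ip_normC ip_ge0) (gram_coef (ltnSn n) (ltnSn n)) eqxx.
rewrite rmorphB /= realC_sum; congr (_ - _).
rewrite (reindex_inj rev_ord_inj) /=; apply: eq_bigr => k _.
by rewrite cmod_sqrC /beta subSS leq_subr subKn 1?mulrC // -ltnS.
Qed.

(* For x = b f the vector y = sum x_n e_n satisfies |y|^2 = |x|^2 - |S|^2, where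
   S_k = sum x_m conj(b_(m-k)); since <S, f> = |x|^2, expanding |f - S|^2 >= 0 gives the bound. *)
Lemma dBR_test_bound (d : nat -> R[i]) (u : V) M :
  cmod (\sum_(n < M) cj (cauchy_prod cb d n) * ip u (e n)) ^+ 2 <=
  N u ^+ 2 * (\sum_(n < M) cmod (d n) ^+ 2 - \sum_(n < M) cmod (cauchy_prod cb d n) ^+ 2).
Proof.
pose x n := cauchy_prod cb d n.
pose y := \sum_(n < M) (x n : C) *: e n.
pose S k := \sum_(m < M) x m * cj (beta m k).
have uy : ip u y = \sum_(n < M) cj (x n) * ip u (e n).
  by rewrite (ip_sumr ipL ipJ); apply: eq_bigr => n _; rewrite (ipZr ipL ipJ).
have yy : N y ^+ 2 = \sum_(n < M) cmod (x n) ^+ 2 - \sum_(k < M) cmod (S k) ^+ 2.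
  apply: (@complexI R); rewrite -(ip_normC ip_ge0) {1}/y (ip_suml ipL) rmorphB /= !realC_sum.
  have -> : \sum_(m < M) ip ((x m : C) *: e m) y =
     \sum_(m < M) (x m * cj (x m) - \sum_(k < M) x m * cj (beta m k) * cj (S k)).
    apply: eq_bigr => m _; rewrite (ipZl ipL) (ip_sumr ipL ipJ).
    have -> : \sum_(n < M) ip (e m) ((x n : C) *: e n) =
       \sum_(n < M) (cj (x n) * (n == m :> nat)%:R - \sum_(k < M) cj (beta m k) * (cj (x n) * beta n k)).
      apply: eq_bigr => n _; rewrite (ipZr ipL ipJ) (gram_coef (ltn_ord m) (ltn_ord n)) mulrBr mulr_sumr.
      by congr (_ - _); apply: eq_bigr => k _; ring.
    rewrite sumrB (bigD1 m) //= eqxx mulr1 big1 ?addr0; last first.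
      move=> n nm; rewrite (_ : (n == m :> nat) = false) ?mulr0 //.
      by apply/negbTE; apply: contra nm => /eqP h; apply/eqP/val_inj.
    rewrite mulrBr exchange_big /= mulr_sumr; congr (_ - _); apply: eq_bigr => k _.
    rewrite -mulr_sumr mulrA; congr (_ * _); rewrite /S rmorph_sum /=; apply: eq_bigr => n _.
    by rewrite rmorphM /= conjcK.
  rewrite sumrB exchange_big /=; congr (_ - _); apply: eq_bigr => k _; rewrite cmod_sqrC //.
  by rewrite -mulr_suml.
have SX : \sum_(k < M) S k * cj (d k) = (\sum_(n < M) cmod (x n) ^+ 2)%:C.
  rewrite realC_sum; under eq_bigr do rewrite mulr_suml.
  rewrite exchange_big /=; apply: eq_bigr => m _; rewrite cmod_sqrC.
  under eq_bigr do rewrite -mulrA; rewrite -mulr_sumr; congr (_ * _).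
  rewrite -(big_mkord xpredT (fun k => cj (beta m k) * cj (d k))) (@big_cat_nat _ _ _ m.+1) //=.
  rewrite [X in _ + X]big_nat_cond [X in _ + X]big1 ?addr0; last first.
    by move=> i /andP[/andP[ni _] _]; rewrite /beta [(i <= m)%N]leqNgt ni conjc0 mul0r.
  rewrite big_mkord /x /cauchy_prod rmorph_sum /= [RHS](reindex_inj rev_ord_inj) /=.
  apply: eq_bigr => k _; have km : (k <= m)%N by rewrite -ltnS.
  by rewrite subSS subKn // /beta km rmorphM.
have key : 0 <= \sum_(k < M) cmod (d k) ^+ 2 + \sum_(k < M) cmod (S k) ^+ 2 - 2 * \sum_(n < M) cmod (x n) ^+ 2.
  have -> : \sum_(n < M) cmod (x n) ^+ 2 = Re (\sum_(k < M) S k * cj (d k)) by rewrite SX.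
  rewrite Re_sum mulr_sumr -big_split /= -sumrB; apply: sumr_ge0 => k _.
  have := sqr_ge0 (cmod (S k - d k)).
  by rewrite !cmod_sqr ReD ImD ReN ImN cReM; case: (S k) (d k) => p q [r s] /=; lra.
rewrite -/(x _); have := cauchy_schwarz ipL ipJ ip_ge0 ip_def u y; rewrite uy => h.
have h1 : cmod (\sum_(n < M) cj (x n) * ip u (e n)) ^+ 2 <= N u ^+ 2 * N y ^+ 2.
  by rewrite -exprMn lerXn2r ?nnegrE ?cmod_ge0 ?mulr_ge0 ?ip_norm_ge0.
apply: (le_trans h1); apply: ler_wpM2l; first exact: sqr_ge0.
by rewrite yy; lra.
Qed.
End CoefficientGram.

(** * Cesaro means *)

Section CesaroNumbers.
Variable R : realType.
Implicit Types (beta x r : R).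

(* cesA beta n and cesC beta n are the n-th Taylor coefficients of (1 - x)^(-beta) and (1 - x)^beta. *)
Fixpoint cesA beta n : R := if n is m.+1 then cesA beta m * (beta + m%:R) / m.+1%:R else 1.
Fixpoint cesC beta n : R := if n is m.+1 then cesC beta m * (m%:R - beta) / m.+1%:R else 1.

Lemma natS_neq0 n : (n.+1%:R : R) != 0. Proof. by rewrite pnatr_eq0. Qed.

Lemma cesA_rec beta n : n.+1%:R * cesA beta n.+1 = (beta + n%:R) * cesA beta n.
Proof. by rewrite /= mulrC divfK ?natS_neq0 // mulrC. Qed.

Lemma cesC_rec beta n : n.+1%:R * cesC beta n.+1 = (n%:R - beta) * cesC beta n.
Proof. by rewrite /= mulrC divfK ?natS_neq0 // mulrC. Qed.

Lemma cesA_gt0 beta n : 0 < beta -> 0 < cesA beta n.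
Proof.
move=> b0; elim: n => [|n IH] /=; first exact: ltr01.
by rewrite divr_gt0 // mulr_gt0 // ltr_wpDr.
Qed.

Lemma cesA_mono beta m n : 1 <= beta -> (m <= n)%N -> cesA beta m <= cesA beta n.
Proof.
move=> b1 /subnKC <-; elim: (n - m)%N => [|k IH]; first by rewrite addn0.
apply: (le_trans IH); rewrite addnS /= ler_pdivlMr //.
have h := cesA_gt0 (m + k) (lt_le_trans ltr01 b1).
by rewrite ler_wpM2l ?(ltW h) // -natr1 addrC lerD2r.
Qed.

(* n D_n = sum (i + (n - i)) A_i C_(n-i), and the two recursions turn this into (n - 1) D_(n-1). *)
Lemma cesA_cesC beta n : \sum_(i < n.+1) cesA beta i * cesC beta (n - i) = (n == 0%N)%:R.
Proof.
pose D m := \sum_(i < m.+1) cesA beta i * cesC beta (m - i).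
have step m : m.+1%:R * D m.+1 = m%:R * D m.
  have -> : m.+1%:R * D m.+1 = \sum_(i < m.+2) i%:R * cesA beta i * cesC beta (m.+1 - i) +
     \sum_(i < m.+2) cesA beta i * ((m.+1 - i)%:R * cesC beta (m.+1 - i)).
    rewrite /D mulr_sumr -big_split /=; apply: eq_bigr => i _.
    have im : (i <= m.+1)%N by rewrite -ltnS.
    by rewrite natrB //; ring.
  rewrite [X in X + _]big_ord_recl mul0r mul0r add0r [X in _ + X]big_ord_recr /= subnn mul0r mulr0 addr0.
  rewrite -big_split /D mulr_sumr /=; apply: eq_bigr => i _.
  have im : (i <= m)%N by rewrite -ltnS.
  rewrite /bump /= add1n subSS cesA_rec subSn // cesC_rec natrB //; ring.
have D0 m : D m.+1 = 0.
  elim: m => [|m IH]; first by apply: (mulfI (natS_neq0 0)); rewrite step mul0r mulr0.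
  by apply: (mulfI (natS_neq0 m.+1)); rewrite step IH !mulr0.
case: n => [|n]; last exact: D0.
by rewrite big_ord1 /= mulr1.
Qed.

(** For i > beta the recursion reads beta |C_i| = i |C_i| - (i + 1) |C_(i+1)|, so the sum
    telescopes: the partial sum plus n |C_n| / beta is constant from n0 on. *)
Lemma cesC_summable beta : 0 < beta -> exists B, 0 <= B /\ forall n, \sum_(i < n) `|cesC beta i| <= B.
Proof.
move=> b0; have [n0 hn0] : exists n0 : nat, beta < n0%:R.
  by exists (Num.bound beta); apply: archi_boundP; exact: ltW.
pose B := \sum_(i < n0) `|cesC beta i| + n0%:R * `|cesC beta n0| / beta.
have step k : \sum_(i < n0 + k) `|cesC beta i| + (n0 + k)%:R * `|cesC beta (n0 + k)| / beta = B.
  elim: k => [|k IH]; first by rewrite addn0.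
  rewrite -IH addnS big_ord_recr /= -addrA; congr (_ + _).
  have -> : (n0 + k).+1%:R * `|cesC beta (n0 + k) * ((n0 + k)%:R - beta) / (n0 + k).+1%:R| =
      ((n0 + k)%:R - beta) * `|cesC beta (n0 + k)|.
    have h : 0 <= (n0 + k)%:R - beta by rewrite natrD; have := ler0n R k; lra.
    rewrite !normrM normfV normr_nat (ger0_norm h).
    by move: (natS_neq0 (n0 + k)); move: ((n0 + k).+1%:R : R) => s s0; field.
  by field; rewrite gt_eqF.
have B0 : 0 <= B by rewrite addr_ge0 ?sumr_ge0 // divr_ge0 ?mulr_ge0 // ltW.
exists B; split => // n.
rewrite -(step n); apply: le_trans (_ : \sum_(i < n0 + n) `|cesC beta i| <= _).
  by rewrite addnC big_split_ord /= lerDl sumr_ge0.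
by rewrite lerDl divr_ge0 ?mulr_ge0 // ltW.
Qed.

(** Passing from j to j + 1 multiplies both sides by (n - j) / (n + alpha - j). *)
Lemma cesaro_weight (alpha : R) n j : 0 <= alpha -> (j <= n)%N ->
  'C(n, j)%:R / gbinom (n%:R + alpha) j = cesA (alpha + 1) (n - j) / cesA (alpha + 1) n.
Proof.
move=> a0; have b0 : 0 < alpha + 1 by lra.
elim: j => [_|j IH jn].
  by rewrite bin0 /gbinom big_ord0 fact0 divr1 divr1 subn0 divff // gt_eqF // cesA_gt0.
have jn' := ltnW jn; have {IH} IH := IH jn'.
have nj : (n - j = (n - j.+1).+1)%N by rewrite subnSK.
have x0 : 0 < n%:R + alpha - j%:R :> R.
  have : (j.+1%:R : R) <= n%:R by rewrite ler_nat.
  by rewrite -natr1; lra.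
have g0 : gbinom (n%:R + alpha) j != 0.
  rewrite /gbinom mulf_neq0 ?invr_eq0 ?pnatr_eq0 -?lt0n ?fact_gt0 //.
  apply/prodf_neq0 => i _; rewrite gt_eqF //.
  have : (i%:R : R) <= j%:R by rewrite ler_nat ltnW.
  by lra.
have gS : gbinom (n%:R + alpha) j.+1 = gbinom (n%:R + alpha) j * (n%:R + alpha - j%:R) / j.+1%:R.
  rewrite /gbinom big_ord_recr /= factS natrM.
  have f0 : (j`!%:R : R) != 0 by rewrite pnatr_eq0 -lt0n fact_gt0.
  by move: (natS_neq0 j); move: (j.+1%:R : R) => s s0; field; rewrite s0 f0.
have bS : ('C(n, j.+1)%:R : R) = 'C(n, j)%:R * (n - j)%:R / j.+1%:R.
  have h := congr1 (fun n : nat => n%:R : R) (mul_bin_left n j); rewrite !natrM in h.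
  by apply: (mulfI (natS_neq0 j)); rewrite h; move: (natS_neq0 j); move: (j.+1%:R : R) => s s0; field.
have AS : cesA (alpha + 1) (n - j.+1) = cesA (alpha + 1) (n - j) * (n - j)%:R / (n%:R + alpha - j%:R).
  have h := cesA_rec (alpha + 1) (n - j.+1); rewrite -nj in h.
  have e : alpha + 1 + (n - j.+1)%:R = n%:R + alpha - j%:R.
    by rewrite natrB // -natr1; ring.
  rewrite e in h; apply: (mulfI (lt0r_neq0 x0)); rewrite -h; field; exact: lt0r_neq0.
rewrite AS gS bS.
transitivity ('C(n, j)%:R / gbinom (n%:R + alpha) j * ((n - j)%:R / (n%:R + alpha - j%:R))).
  have y0 := lt0r_neq0 x0; move: (natS_neq0 j); move: (j.+1%:R : R) => s s0.
  by field; rewrite s0 g0 y0.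
rewrite IH; field; rewrite (lt0r_neq0 x0) gt_eqF // cesA_gt0 //.
Qed.

Let S beta N x := \sum_(n < N) cesA beta n * x ^+ n.
Let S' beta N x := \sum_(n < N) cesA beta n * (n%:R * x ^+ n.-1).

(** The full series satisfies (1 - x) F' = beta F; for the partial sum the difference is the single
    nonnegative term N A_N x^(N-1). *)
Let S'_le beta N x : 0 < beta -> 0 <= x -> (1 - x) * S' beta N x <= beta * S beta N x.
Proof.
move=> b0 x0; rewrite -subr_ge0.
have -> : beta * S beta N x - (1 - x) * S' beta N x = N%:R * cesA beta N * x ^+ N.-1.
  elim: N => [|N IH]; first by rewrite /S /S' !big_ord0 !mulr0 !mul0r subrr.
  rewrite /S /S' !big_ord_recr [in LHS]/= (mulrDr beta) (mulrDr (1 - x)) opprD addrACA.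
  rewrite -/(S beta N x) -/(S' beta N x) IH cesA_rec [N.+1.-1]/=.
  by case: N {IH} => [|N] /=; rewrite ?expr0 ?exprS; ring.
by rewrite mulr_ge0 ?exprn_ge0 // mulr_ge0 // ltW // cesA_gt0.
Qed.

(** By the inequality for the derivative, (1 - x)^beta times the partial sum is nonincreasing on
    [0, r]; its value at 0 is 1 as soon as N > 0. *)
Lemma cesA_sum_le beta N r : 0 < beta -> 0 <= r < 1 ->
  \sum_(n < N) cesA beta n * r ^+ n <= (1 - r) `^ (- beta).
Proof.
move=> b0 /andP[r0 r1].
have [->|N0] := posnP N; first by rewrite big_ord0 powR_ge0.
pose h (x : R) := expR (beta * ln (1 - x)).
have dS (x : R) : is_derive x 1 (S beta N) (S' beta N x).
  rewrite /S /S'; elim: N {N0} => [|n IH].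
    have -> : (fun x : R => \sum_(n < 0) cesA beta n * x ^+ n) = cst 0.
      by apply/funext => y; rewrite big_ord0.
    by rewrite big_ord0; exact: is_derive_cst.
  have -> : (fun x : R => \sum_(n0 < n.+1) cesA beta n0 * x ^+ n0) =
     (fun x : R => \sum_(n0 < n) cesA beta n0 * x ^+ n0) + (fun x : R => cesA beta n * x ^+ n).
    by apply/funext => y; rewrite big_ord_recr.
  rewrite big_ord_recr /=; apply: is_deriveD.
  have d1 : is_derive x 1 (fun y : R => y ^+ n) (n%:R * x ^+ n.-1).
    by apply: DeriveDef; [exact: exprn_derivable|rewrite exp_derive /GRing.scale /= mulr1].
  exact: (is_deriveZ (cesA beta n) d1).
have dh (x : R) : x < 1 -> is_derive x 1 h (- beta / (1 - x) * h x).
  move=> x1; have p : 0 < 1 - x by lra.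
  have dl : is_derive (1 - x) 1 (@ln R) (1 - x)^-1 by exact: is_derive1_ln.
  have d1 : is_derive x 1 (fun y : R => 1 - y) (-1).
    have := is_deriveB (is_derive_cst (1 : R) x 1) (is_derive_id x (1 : R)); rewrite sub0r; exact.
  have d2 : is_derive x 1 (fun y : R => ln (1 - y)) ((1 - x)^-1 * -1).
    exact: (@is_derive1_comp _ (@ln R) (fun y : R => 1 - y)).
  rewrite /h; apply: is_derive_eq; rewrite /GRing.scale /=; ring.
pose g (x : R) := S beta N x * h x.
have dg (x : R) : x < 1 -> is_derive x 1 g (S beta N x * (- beta / (1 - x) * h x) + h x * S' beta N x).
  by move=> x1; have := dh x x1 => d; apply: is_derive_eq; rewrite /GRing.scale /=.
have gle : g r <= g 0.
  apply: (@ler0_derive1_nincr _ g 0 r) => //.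
  - by move=> x; rewrite in_itv /= => /andP[_ xr]; have [] := dg x (lt_trans xr r1).
  - move=> x; rewrite in_itv /= => /andP[x0 xr]; have x1 := lt_trans xr r1.
    rewrite derive1E; have [_ ->] := dg x x1.
    have p : 0 < 1 - x by lra.
    have hx : 0 < h x by exact: expR_gt0.
    have -> : S beta N x * (- beta / (1 - x) * h x) + h x * S' beta N x =
        h x / (1 - x) * ((1 - x) * S' beta N x - beta * S beta N x) by field; exact: lt0r_neq0.
    rewrite pmulr_rle0 ?divr_gt0 // subr_le0; exact: S'_le (ltW x0).
  - apply: derivable_within_continuous => x; rewrite in_itv /= => /andP[_ xr].
    by have [] := dg x (le_lt_trans xr r1).
have p : 0 < 1 - r by lra.
have g0 : g 0 = 1.
  rewrite /g /h subr0 ln1 mulr0 expR0 mulr1 /S; case: N N0 {dS dg gle g} => // n _.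
  rewrite big_ord_recl /= expr0 mulr1 big1 ?addr0 // => i _; by rewrite exprS mul0r mulr0.
rewrite /powR (gt_eqF p) mulNr expRN -[leRHS]mul1r ler_pdivlMr ?expR_gt0 //.
by move: gle; rewrite g0.
Qed.
End CesaroNumbers.

(** * From convergent Cesaro means to the size of z^n in H(b) *)

Section CesaroInHb.
Variables (R : realType) (alpha : R).
Local Notation C := (R[i] : numFieldType).
Variables (V : lmodType C) (ip : V -> V -> C) (ev : V -> C -> C).
Hypothesis alpha0 : 0 <= alpha.
Hypothesis ipL : forall (c : C) (u v w : V), ip (c *: u + v) w = c * ip u w + ip v w.
Hypothesis ipJ : forall u v : V, ip v u = cj (ip u v).
Hypothesis ip_ge0 : forall u : V, 0 <= ip u u.
Hypothesis ip_def : forall u : V, ip u u = 0 -> u = 0.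
Hypothesis ip_complete : forall s : nat -> V,
  (forall e : R, 0 < e -> exists n0 : nat, forall m n : nat,
     (n0 <= m)%N -> (n0 <= n)%N -> ip_norm ip (s m - s n) < e) ->
  exists v : V, ip_norm ip (s n - v) @[n --> \oo] --> 0.
Hypothesis ev_inj : forall u v : V, (forall z, disk z -> ev u z = ev v z) -> u = v.
Variables (e : nat -> V) (eta : R).
Hypothesis ev_psum : forall h, psum (ev h) (fun n => ip h (e n)).
Local Notation N := (ip_norm ip).
Hypothesis eta0 : 0 < eta.
Hypothesis e_norm : forall n, eta <= N (e n) ^+ 2.
Hypothesis sigma_cvg : forall h, exists s : nat -> V,
  (forall n z, disk z -> ev (s n) z = sigma_poly alpha (fun j => ip h (e j)) n z) /\
  (forall g, ctends (fun n => ip (s n) g) (ip h g)).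

Let A := cesA (alpha + 1).
Let c := cesC (alpha + 1).

Lemma coef_ext (u v : V) : (forall j, ip u (e j) = ip v (e j)) -> u = v.
Proof.
move=> h; apply: ev_inj => z hz; apply: (ctends_unique (ev_psum u hz)).
by apply: eq_ctends (ev_psum v hz) => M; apply: eq_bigr => i _; rewrite h.
Qed.

Let A_gt0 n : 0 < A n. Proof. by apply: cesA_gt0; rewrite ltr_wpDl. Qed.

(* Inverting the Cesaro means: sum_k C_(n-k) A_k sigma_k(h) = h^(n) z^n. *)
Lemma monomial_part : exists G, 0 <= G /\ forall h, exists M, forall n, exists q,
  [/\ forall j, ip q (e j) = (j == n)%:R * ip h (e j) & N q <= G * A n * M].
Proof.
have b0 : 0 < alpha + 1 by rewrite ltr_wpDl.
have [G [G0 hG]] := cesC_summable b0; exists G; split => // h.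
have [s [sv sg]] := sigma_cvg h.
(* First use of uniform boundedness: a weakly convergent sequence is bounded in norm. *)
have [M [M0 hM]] : exists M, 0 <= M /\ forall n, N (s n) <= M.
  apply: (uniform_boundedness ipL ipJ ip_ge0 ip_def ip_complete) => x.
  have [B [_ hB]] := ctends_bnd (sg x); exists B => n.
  by rewrite ipJ cmodJ.
exists M => n.
have sc k j : ip (s k) (e j) = if (j < k.+1)%N then (A (k - j) / A k)%:C * ip h (e j) else 0.
  have h1 : psum (ev (s k)) (fun j => if (j < k.+1)%N then (A (k - j) / A k)%:C * ip h (e j) else 0).
    apply: psum_eq (psum_poly (fun j => (A (k - j) / A k)%:C * ip h (e j)) k.+1) => // z hz.
    rewrite sv // /sigma_poly; apply: eq_bigr => i _; congr (_%:C * _ * _).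
    by rewrite /A -cesaro_weight // -ltnS.
  exact: psum_unique (ev_psum (s k)) h1 j.
pose q := \sum_(k < n.+1) ((c (n - k) * A k)%:C : C) *: s k.
exists q; split=> [j|].
  rewrite (ip_suml ipL); under eq_bigr do rewrite (ipZl ipL) sc.
  have [nj|jn] := ltnP n j.
    rewrite big1 ?(gtn_eqF nj) ?mul0r // => k _.
    by rewrite ltnNge (leq_ltn_trans _ nj) ?mulr0 // -ltnS.
  rewrite -(big_mkord xpredT (fun k => (c (n - k) * A k)%:C * (if (j < k.+1)%N then (A (k - j) / A k)%:C * ip h (e j) else 0))).
  rewrite (@big_cat_nat _ _ _ j) //=; last exact: leqW.
  rewrite [X in X + _]big_nat_cond [X in X + _]big1 ?add0r; last first.
    by move=> k /andP[/andP[_ kj] _]; rewrite ltnNge kj mulr0.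
  rewrite -{1}[j]add0n big_addn big_mkord subSn //.
  have := cesA_cesC (alpha + 1) (n - j); rewrite -/A -/c => h1.
  have -> : (j == n)%:R = ((n - j == 0)%N%:R : R)%:C :> R[i].
    by rewrite rmorph_nat subn_eq0 eqn_leq jn.
  rewrite -h1 realC_sum mulr_suml; apply: eq_bigr => i _.
  rewrite ltnS leq_addl addnK mulrA -rmorphM; congr (_%:C * _).
  rewrite -subnDA [(j + i)%N]addnC mulrC; field; exact: lt0r_neq0.
apply: (le_trans (ip_norm_sum ipL ipJ ip_ge0 ip_def _ _ _)).
apply: le_trans (_ : \sum_(k < n.+1) `|c k| * (A n * M) <= _); last first.
  rewrite -mulr_suml -mulrA ler_wpM2r // mulr_ge0 // ltW //.
(* After reversal the k-th term carries |C_k| A_(n-k), and A_(n-k) <= A_n because alpha + 1 >= 1. *)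
rewrite (reindex_inj rev_ord_inj) /=; apply: ler_sum => k _.
have kn : (k <= n)%N by rewrite -ltnS.
rewrite subSS subKn // (ip_normZ ipL ipJ ip_ge0) cmod_real normrM -mulrA ler_wpM2l //.
rewrite (ger0_norm (ltW (A_gt0 _))); apply: ler_pM => //; [exact: ltW|exact: ip_norm_ge0|].
by apply: cesA_mono; [rewrite lerDr|exact: leq_subr].
Qed.

(** z^n belongs to H(b): the n-th coefficient of h = e_n is ||e_n||^2 > 0, and dividing its monomial
    part by this number gives z^n. For general h, |h^(n)| ||z^n|| = O(A_n) says that the vectors
    (||z^n|| / A_n) e_n are pointwise bounded; uniform boundedness and ||e_n||^2 >= eta then bound
    ||z^n|| / A_n. *)
Lemma monomial_vectors : exists (p : nat -> V) K, [/\ 0 <= K,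
  forall n j, ip (p n) (e j) = (j == n)%:R & forall n, N (p n) <= K * A n].
Proof.
have [G [G0 hG]] := monomial_part.
have en0 n : 0 < N (e n).
  rewrite lt_neqAle ip_norm_ge0 andbT eq_sym; apply/eqP => h0.
  by have := e_norm n; rewrite h0 expr0n /= leNgt eta0.
have ex n : exists p, forall j, ip p (e j) = (j == n)%:R.
  have [M hM] := hG (e n); have [q [hq _]] := hM n.
  exists (((N (e n) ^- 2)%:C : C) *: q) => j; rewrite (ipZl ipL) hq.
  have [->|_] := eqVneq j n; last by rewrite mul0r mulr0.
  rewrite mul1r (ip_normC ip_ge0) -rmorphM mulVf //.
  by rewrite expf_neq0 // gt_eqF.
have /choice[p hp] := ex.
have [K [K0 hK]] : exists K, 0 <= K /\ forall n, N (((N (p n) / A n)%:C : C) *: e n) <= K.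
  apply: (uniform_boundedness ipL ipJ ip_ge0 ip_def ip_complete) => h.
  have [M hM] := hG h; exists (G * M) => n.
  have [q [hq Nq]] := hM n.
  have qp : q = ip h (e n) *: p n.
    apply: coef_ext => j; rewrite hq (ipZl ipL) hp mulrC.
    by have [->|_] := eqVneq j n; rewrite ?mulr0.
  rewrite (ipZr ipL ipJ) conjc_real cmodM cmod_real.
  rewrite (ger0_norm (divr_ge0 (ip_norm_ge0 _ _) (ltW (A_gt0 n)))).
  rewrite mulrAC ler_pdivrMr // mulrAC mulrC.
  by move: Nq; rewrite qp (ip_normZ ipL ipJ ip_ge0).
have se : 0 < Num.sqrt eta by rewrite sqrtr_gt0.
exists p, (K / Num.sqrt eta); split => //; first by rewrite divr_ge0 // ltW.
move=> n; have := hK n.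
rewrite (ip_normZ ipL ipJ ip_ge0) cmod_real (ger0_norm (divr_ge0 (ip_norm_ge0 _ _) (ltW (A_gt0 n)))) => h1.
have h2 : Num.sqrt eta <= N (e n).
  by rewrite -[leRHS](ger0_norm (ip_norm_ge0 _ _)) -sqrtr_sqr ler_wsqrtr.
rewrite mulrAC ler_pdivlMr //; apply: le_trans (_ : N (p n) * N (e n) <= _).
  by rewrite ler_wpM2l // ip_norm_ge0.
by rewrite -ler_pdivrMr // mulrAC.
Qed.

(** The triangle inequality leads to the generating function of the A_n at |w|. The bound is the
    same for all M, so M can tend to infinity without k_w itself being placed in H(b). *)
Lemma szego_partial : exists K, 0 <= K /\ forall (w : R[i]) M, disk w -> exists u,
  (forall n, (n < M)%N -> ip u (e n) = cj w ^+ n) /\ N u <= K * (1 - cmod w) `^ (- (alpha + 1)).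
Proof.
have [p [K [K0 hp hK]]] := monomial_vectors.
exists K; split => // w M hw.
exists (\sum_(k < M) (cj w ^+ k : C) *: p k); split=> [n nM|].
  rewrite (ip_suml ipL) (bigD1 (Ordinal nM)) //= (ipZl ipL) hp eqxx mulr1 big1 ?addr0 // => i hi.
  rewrite (ipZl ipL) hp (_ : (n == i) = false) ?mulr0 //; apply/negbTE.
  by apply: contra hi => /eqP h; apply/eqP/val_inj.
apply: (le_trans (ip_norm_sum ipL ipJ ip_ge0 ip_def _ _ _)).
apply: le_trans (_ : K * \sum_(k < M) A k * cmod w ^+ k <= _).
  rewrite mulr_sumr; apply: ler_sum => k _; rewrite (ip_normZ ipL ipJ ip_ge0) cmodX cmodJ mulrA mulrC.
  by rewrite ler_wpM2r ?exprn_ge0 ?cmod_ge0.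
apply: ler_wpM2l => //; apply: cesA_sum_le; first by rewrite ltr_wpDl.
by rewrite cmod_ge0 /=.
Qed.
End CesaroInHb.

(** * The growth of b / a *)

Theorem theorem6p12 (R : realType) (alpha : R) (b a : R[i] -> R[i])
  (V : lmodType (R[i] : numFieldType)) (ip : V -> V -> (R[i] : numFieldType))
  (ev : V -> R[i] -> R[i]) (kv : R[i] -> V) :
  0 <= alpha ->
  Hinf_nonextreme b ->
  outer a -> 0 < a 0 -> pythagorean_ae a b ->
  is_dBR_space b ip ev kv ->
  ((forall (h : V) (c : nat -> R[i]), taylor_coeffs (ev h) c ->
      exists s : nat -> V,
        (forall n z, disk z -> ev (s n) z = sigma_poly alpha c n z) /\
        (forall g : V, ip (s n) g @[n --> \oo] --> ip h g))
   \/
   (forall (h : V) (c : nat -> R[i]), taylor_coeffs (ev h) c ->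
      exists s : nat -> V,
        (forall n z, disk z -> ev (s n) z = sigma_poly alpha c n z) /\
        ip_norm ip (s n - h) @[n --> \oo] --> 0)) ->
  exists (M r0 : R), r0 < 1 /\
    forall z : R[i], r0 < cmod z < 1 ->
      cmod (b z / a z) <= M * (1 - cmod z) `^ (- (alpha + 2^-1)).
Proof.
move=> alpha0 [[_ b1] _] oa _ pab [ipL [ipJ [ip_ge0 [ip_def [ip_complete [_ [ev_inj [ev_kv ip_kv]]]]]]]] sig.
have [e he] := coef_vectors ipL ipJ ip_ge0 ip_def ip_complete ev_kv ip_kv.
have ev_psum h : psum (ev h) (fun n => ip h (e n)) := he h.
have [cb hb] := dBR_psum ev_kv ev_psum.
have [ca ha] := outer_psum oa.
have [eta [eta0 heta]] := sum_cmod2_lt1 ha hb oa b1 pab.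
have e_norm n : eta <= ip_norm ip (e n) ^+ 2.
  rewrite (norm_coef_vector ipJ ip_ge0 ev_kv ip_kv ev_psum hb).
  by have := heta n.+1; lra.
have sigma_cvg h : exists s : nat -> V,
    (forall n z, disk z -> ev (s n) z = sigma_poly alpha (fun j => ip h (e j)) n z) /\
    (forall g, ctends (fun n => ip (s n) g) (ip h g)).
  have th : taylor_coeffs (ev h) (fun n => ip h (e n)) by apply/taylor_coeffsP; exact: ev_psum.
  (* Norm convergence implies weak convergence by Cauchy-Schwarz, so the weak form covers both
     alternatives. *)
  case: sig => sig; have [s [sv sg]] := sig h _ th; exists s; split => // g.
    by apply/cvg_ctends; exact: sg.
  exact: ctends_ipl ipL ipJ ip_ge0 ip_def _ _ _ sg.
have [K [K0 hK]] := szego_partial alpha0 ipL ipJ ip_ge0 ip_def ip_complete ev_inj ev_psum eta0 e_norm sigma_cvg.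
have [f [hf f1 af1 af0 afl]] := outer_inverse oa.
(* The estimate holds throughout the disk, whence [r0] = 0; the factor 2 absorbs 1 + |w| in 1 -
   |w|^2. *)
exists (2 * K), 0; split => // w /andP[_ w1].
have hw : disk w by [].
have w0 := cmod_ge0 w.
have p : 0 < 1 - cmod w by rewrite subr_gt0.
have p2 : 0 < 1 - cmod w ^+ 2 by rewrite subr_gt0 exprn_ilt1.
pose U := K * (1 - cmod w) `^ (- (alpha + 1)).
have ww : 1 - w * cj w = (1 - cmod w ^+ 2)%:C by rewrite -cmod_sqrC rmorphB.
(* Tested on f_m k_w, whose product with b takes the value b(w) f_m(w) / (1 - |w|^2) at w; the
   defect bound is 1 / (1 - |w|^2), so one factor 1 - |w|^2 remains on the right. *)
have key m : cmod (b w * f m w) ^+ 2 <= U ^+ 2 * (1 - cmod w ^+ 2).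
  have [d hd] := hf m; have hfk := psum_mul hd (psum_szego hw).
  have fB z : disk z -> cmod (f m z * (1 - z * cj w)^-1) <= expR m%:R * (1 - cmod w)^-1.
    move=> hz; rewrite cmodM; apply: ler_pM; rewrite ?cmod_ge0 //; first exact: f1.
    rewrite cmodV lef_pV2 ?posrE //; last by rewrite lt_neqAle cmod_ge0 eq_sym cmod_eq0 szego_neq0.
    have h1 : cmod (z * cj w) <= cmod w.
      by rewrite cmodM cmodJ ler_piMl //; exact: ltW.
    by have := cmodD (1 - z * cj w) (z * cj w); rewrite subrK cmod1; lra.
  have afk z : disk z -> cmod (a z * (f m z * (1 - z * cj w)^-1)) <= cmod (1 - z * cj w)^-1.
    by move=> hz; rewrite mulrA cmodM ler_piMl ?cmod_ge0 // af1.
  have [er [er0 erp her]] := pythagorean_defect ha hb hfk fB b1 pab hw afk.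
  set X := cauchy_prod cb _ in her.
  have hX : psum (fun z => b z * (f m z * (1 - z * cj w)^-1)) X := psum_mul hb hfk.
  have lim := ctends_cmod (hX w hw).
  (* [u] has the coefficients conj(w)^n for n < M, so its pairing with X is the conjugate of the
     M-th partial sum of b f_m k_w at w. *)
  have step M : cmod (\sum_(n < M) X n * w ^+ n) ^+ 2 <= U ^+ 2 * ((1 - cmod w ^+ 2)^-1 + er M).
    have [u [uc Nu]] := hK w M hw.
    have := dBR_test_bound ipL ipJ ip_ge0 ip_def ev_kv ip_kv ev_psum hb (cauchy_prod d (fun n => cj w ^+ n)) u M.
    rewrite -/X => h1.
    have -> : cmod (\sum_(n < M) X n * w ^+ n) = cmod (\sum_(n < M) cj (X n) * ip u (e n)).
      rewrite -cmodJ rmorph_sum /=; congr cmod; apply: eq_bigr => n _.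
      by rewrite rmorphM rmorphXn /= uc.
    have D0 : 0 <= (1 - cmod w ^+ 2)^-1 + er M by rewrite addr_ge0 // invr_ge0 ltW.
    apply: (le_trans h1); apply: le_trans (ler_wpM2l (sqr_ge0 _) (her M)) _.
    by rewrite ler_wpM2r // lerXn2r ?nnegrE ?ip_norm_ge0 // (le_trans (ip_norm_ge0 ip u)).
  have lim2 : U ^+ 2 * ((1 - cmod w ^+ 2)^-1 + er M) - cmod (\sum_(n < M) X n * w ^+ n) ^+ 2 @[M --> \oo] -->
      U ^+ 2 * ((1 - cmod w ^+ 2)^-1 + 0) - cmod (b w * (f m w * (1 - w * cj w)^-1)) ^+ 2.
    apply: cvgB.
      by apply: cvgM; [exact: cvg_cst|apply: cvgD => //; exact: cvg_cst].
    by under eq_fun do rewrite expr2; rewrite expr2; exact: cvgM.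
  have h : 0 <= U ^+ 2 * ((1 - cmod w ^+ 2)^-1 + 0) - cmod (b w * (f m w * (1 - w * cj w)^-1)) ^+ 2.
    by apply: (cvg_ge_bound lim2 (n0 := 0%N)) => M _; rewrite subr_ge0; exact: step.
  rewrite addr0 subr_ge0 ww mulrA cmodM -fmorphV cmod_real ger0_norm ?invr_ge0 ?(ltW p2) // in h.
  rewrite exprMn in h.
  have -> : cmod (b w * f m w) ^+ 2 = cmod (b w * f m w) ^+ 2 * (1 - cmod w ^+ 2)^-1 ^+ 2 * (1 - cmod w ^+ 2) ^+ 2.
    by field; rewrite gt_eqF.
  apply: le_trans (ler_wpM2r (sqr_ge0 _) h) _.
  by apply: le_of_eq; field; rewrite gt_eqF.
have a0 : a w != 0 by have := af0 0%N w hw; apply: contraNneq => ->; rewrite mul0r.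
(* |b f_m| = |b/a| |a f_m|, and the last factor tends to 1, so bounds for |b f_m| uniform in m pass
   to |b/a|. *)
have lim : cmod (b w / a w) * cmod (a w * f m w) @[m --> \oo] --> cmod (b w / a w) * 1.
  by apply: cvgM; [exact: cvg_cst|exact: afl].
pose Q := 2 * K * (1 - cmod w) `^ (- (alpha + 2^-1)).
have Q0 : 0 <= Q by rewrite mulr_ge0 ?powR_ge0 // mulr_ge0.
(* The half power of 1 - |w| raises the exponent from -(alpha + 1) to -(alpha + 1/2). *)
have UQ : U ^+ 2 * (1 - cmod w ^+ 2) <= Q ^+ 2.
  have E : (1 - cmod w) `^ (- (alpha + 2^-1)) = (1 - cmod w) `^ (- (alpha + 1)) * (1 - cmod w) `^ 2^-1.
    rewrite -powRD; last by rewrite (gt_eqF p) implybT.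
    by congr (_ `^ _); lra.
  have E2 : (1 - cmod w) `^ 2^-1 ^+ 2 = 1 - cmod w.
    by rewrite powR12_sqrt ?sqr_sqrtr // ltW.
  rewrite /Q /U E; move: ((1 - cmod w) `^ (- (alpha + 1))) ((1 - cmod w) `^ 2^-1) E2 => P H E2.
  have -> : (2 * K * (P * H)) ^+ 2 = (K * P) ^+ 2 * (2 ^+ 2 * H ^+ 2) by ring.
  by rewrite E2; apply: ler_wpM2l; [exact: sqr_ge0|nra].
rewrite -/Q -[leLHS]mulr1; apply: (cvg_le_bound lim (n0 := 0%N)) => m _.
rewrite -cmodM mulrA divfK // -(@ler_pXn2r _ 2) ?nnegrE ?cmod_ge0 //.
exact: le_trans (key m) UQ.
Qed.
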